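(* Let $R$ be a commutative ring and assume that $(\mathcal{G},\mathcal{S})$ satisfies Axioms (i)--(iv) and (vi) of the context. Then the functor $-_+\colon\mathcal{F}^\mu_{\mathcal{D}_-,R}\to\mathcal{F}^\mu_{\mathcal{D}_+,R}$ is left adjoint to the restriction functor $\mathrm{Res}^{\mathcal{D}_+}_{\mathcal{D}_-}\colon\mathcal{F}^\mu_{\mathcal{D}_+,R}\to\mathcal{F}^\mu_{\mathcal{D}_-,R}$. The adjunction bijection is given by composition with $\eta_F$: for $F\in\mathcal{F}^\mu_{\mathcal{D}_-,R}$ and $M\in\mathcal{F}^\mu_{\mathcal{D}_+,R}$, the map $$\mathrm{Hom}_{\mathcal{F}^\mu_{\mathcal{D}_+,R}}(F_+,M)\to\mathrm{Hom}_{\mathcal{F}^\mu_{\mathcal{D}_-,R}}(F,\mathrm{Res}^{\mathcal{D}_+}_{\mathcal{D}_-}(M)),\quad\varphi\mapsto\varphi\circ\eta_F,$$ is a bijection.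
   Context: Bisets. For finite groups $G,H$, a $(G,H)$-biset is a finite set $U$ with commuting left $G$-action and right $H$-action; it is viewed as a left $G\times H$-set via $(g,h)u=guh^{-1}$, and $(G\times H)_u$ is the stabilizer of $u\in U$; for $L\le H$, $(G\times L)_u=(G\times H)_u\cap(G\times L)$. $B(G,H)$ is the Grothendieck group of $(G,H)$-bisets with respect to disjoint unions; it is free abelian on the classes $[(G\times H)/D]$, $D$ up to conjugacy. For a $(G,H)$-biset $U$ and an $(H,K)$-biset (or left $H$-set) $V$, $U\times_H V$ is the set of $H$-orbits $[u,v]$ of $U\times V$ under $h(u,v)=(uh^{-1},hv)$. The biset category $\mathcal{C}$ has the finite groups as objects, $\mathrm{Hom}_{\mathcal{C}}(H,G)=B(G,H)$, composition induced by $U\times_H V$, and identity $[G]$. For $H\le G$, $\mathrm{res}^G_H:=[(H\times G)/\Delta(H)]$, where $\Delta(H)=\{(h,h)\mid h\in H\}$. Subgroups. $p_1(D)$ is the image of $D\le G\times H$ in $G$. For $D\le G\times H$, $E\le H\times K$, $D*E=\{(g,k)\mid\exists h\in H:(g,h)\in D,(h,k)\in E\}$; for $K\le H$, $D*K=\{g\in G\mid\exists k\in K:(g,k)\in D\}$. A subgroup of $G\times H$ contained in $G'\times H'$ ($G'\le G$, $H'\le H$) is also regarded as a subgroup of $G'\times H'$. ${}^gH=gHg^{-1}$. Data. $\mathcal{G}$ is a class of finite groups and $\mathcal{S}=(\mathcal{S}(G,H))_{G,H\in\mathcal{G}}$ with $\mathcal{S}(G,H)$ a set of subgroups of $G\times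 H$. $\Sigma_{\mathcal{G}}(G)$ is the set of subgroups $H\le G$ with $H\in\mathcal{G}$. Axioms: (i) $\Delta(G)\in\mathcal{S}(G,G)$ for all $G\in\mathcal{G}$. (ii) $\mathcal{S}(G,H)$ is closed under $G\times H$-conjugation. (iii) If $D\in\mathcal{S}(G,H)$, $E\in\mathcal{S}(H,K)$ then $D*E\in\mathcal{S}(G,K)$. (iv) For all $D\in\mathcal{S}(G,H)$, $K\in\Sigma_{\mathcal{G}}(H)$ one has $D*K\in\mathcal{G}$ and $D*\Delta(K)=D\cap(G\times K)\in\mathcal{S}(D*K,K)$. (vi) For all $G\in\mathcal{G}$, $H\in\Sigma_{\mathcal{G}}(G)$ one has $\Delta(H)\in\mathcal{S}(H,G)$. For a pair satisfying (i)--(iii), $\mathcal{C}(\mathcal{G},\mathcal{S})$ is the subcategory of $\mathcal{C}$ with objects $\mathcal{G}$ and $\mathrm{Hom}(H,G)=\langle[(G\times H)/D]\mid D\in\mathcal{S}(G,H)\rangle_{\mathbb{Z}}$. A biset functor on it over $R$ is an additive functor to ${}_R\mathsf{Mod}$. Put $\mathcal{S}_+(G,H):=\{D\le G\times H\mid p_1(D)\in\mathcal{G},\ D\in\mathcal{S}(p_1(D),H)\}$ and $\mathcal{S}_-(G,H):=\{D\in\mathcal{S}(G,H)\mid p_1(D)=G\}$. Then $(\mathcal{G},\mathcal{S}_-)$ again satisfies (i)--(iv) and (vi), $(\mathcal{G},\mathcal{S}_+)$ satisfies (i)--(iii), and $(\mathcal{S}_-)_+=\mathcal{S}_+$. Put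 $\mathcal{D}_-:=\mathcal{C}(\mathcal{G},\mathcal{S}_-)\subseteq\mathcal{D}_+:=\mathcal{C}(\mathcal{G},\mathcal{S}_+)$. Green biset functors. For a group homomorphism $\varphi\colon H\to K$ put $D^\varphi=\{(h,\varphi(h))\mid h\in H\}$, ${}^\varphi D=\{(\varphi(h),h)\mid h\in H\}$, $r_\varphi:=[(H\times K)/D^\varphi]\in B(H,K)$, $i_\varphi:=[(K\times H)/{}^\varphi D]\in B(K,H)$. For a pair $(\mathcal{G},\mathcal{T})$ satisfying (i)--(iii), a Green biset functor on $\mathcal{C}(\mathcal{G},\mathcal{T})$ over $R$ is a biset functor $F$ together with a (unital associative) $R$-algebra structure on each $F(G)$, $G\in\mathcal{G}$, such that for all $H,K\in\mathcal{G}$, $\varphi\colon H\to K$: (1) if $D^\varphi\in\mathcal{T}(H,K)$, then $F(r_\varphi)\colon F(K)\to F(H)$ is an $R$-algebra homomorphism; (2) if $D^\varphi\in\mathcal{T}(H,K)$ and ${}^\varphi D\in\mathcal{T}(K,H)$, then $F(i_\varphi)(a)\cdot b=F(i_\varphi)(a\cdot F(r_\varphi)(b))$ and $b\cdot F(i_\varphi)(a)=F(i_\varphi)(F(r_\varphi)(b)\cdot a)$ for $a\in F(H)$, $b\in F(K)$. Morphisms are natural transformations whose components are $R$-algebra homomorphisms. The resulting categories for $\mathcal{D}_-$ and $\mathcal{D}_+$ are $\mathcal{F}^\mu_{\mathcal{D}_-,R}$ and $\mathcal{F}^\mu_{\mathcal{D}_+,R}$. Functor $-_+$. Let $F\in\mathcal{F}^\mu_{\mathcal{D}_-,R}$.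 For $H\in\Sigma_{\mathcal{G}}(G)$, $g\in G$, $a\in F(H)$: ${}^ga:=F([({}^gH\times H)/\{(ghg^{-1},h)\mid h\in H\}])(a)\in F({}^gH)$. $\Gamma_F(G)$ is the category of pairs $(X,s)$, $X$ a finite $G$-set with all stabilizers $G_x\in\mathcal{G}$ and $s$ a function on $X$ with $s(x)\in F(G_x)$ and $s(gx)={}^gs(x)$; morphisms $(X,s)\to(Y,t)$ are $G$-maps $\alpha$ with $G_{\alpha(x)}=G_x$, $t(\alpha(x))=s(x)$. $F_+(G)$ is the free abelian group on isomorphism classes $\{X,s\}$ modulo all $\{X\sqcup Y,s\sqcup t\}-\{X,s\}-\{Y,t\}$ and $\{X,s+u\}-\{X,s\}-\{X,u\}$; $[X,s]$ is the image of $\{X,s\}$ and $r[X,s]=[X,rs]$ for $r\in R$. For a $(G,H)$-biset $U$ with stabilizers in $\mathcal{S}_+(G,H)$, $F_+([U])([X,s])=[U\times_HX,U(s)]$ with $U(s)([u,x])=F\bigl(\bigl[\frac{G_{[u,x]}\times H_x}{(G\times H_x)_u}\bigr]\bigr)(s(x))$. The multiplication on $F_+(G)$ is $[X,s]\cdot[Y,t]:=[X\times Y,s\times t]$ with $(s\times t)(x,y)=F(\mathrm{res}^{G_x}_{G_{(x,y)}})(s(x))\cdot F(\mathrm{res}^{G_y}_{G_{(x,y)}})(t(y))$. This makes $F_+$ a Green biset functor on $\mathcal{D}_+$; a morphism $\psi\colon F\to F'$ induces $\psi_+$ with $[X,s]\mapsto[X,\psi(s)]$, $\psi(s)(x)=\psi_{G_x}(s(x))$.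 Unit. $[G,a]_G\in F_+(G)$ denotes the class of the one-point $G$-set with section value $a\in F(G)$. $\eta_F\colon F\to\mathrm{Res}^{\mathcal{D}_+}_{\mathcal{D}_-}(F_+)$ is the morphism in $\mathcal{F}^\mu_{\mathcal{D}_-,R}$ with $\eta_{F,G}(a)=[G,a]_G$ for $G\in\mathcal{G}$, $a\in F(G)$. In $\varphi\circ\eta_F$, $\varphi$ is regarded as a morphism of the restricted functors. *)

(* Defs.v *)
From HB Require Import structures.
From mathcomp Require Import all_boot all_fingroup all_algebra.
From mathcomp Require Import generic_quotient boolp.

Set Implicit Arguments.
Unset Strict Implicit.
Unset Printing Implicit Defensive.

Import GRing.Theory.
Local Open Scope ring_scope.
Local Open Scope quotient_scope.

Inductive fsum (T : Type) :=
  | FZero | FGen of T | FAdd of fsum T & fsum T | FOpp of fsum T.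
Arguments FZero {T}.

HB.instance Definition _ (T : Type) := gen_eqMixin (fsum T).
HB.instance Definition _ (T : Type) := gen_choiceMixin (fsum T).

(* [rel t ts] stands for the relation t = \sum_(u <- ts) u. *)
Inductive fcong (T : Type) (rel : T -> seq T -> Prop) :
    fsum T -> fsum T -> Prop :=
  | fcong_refl a : fcong rel a a
  | fcong_sym a b : fcong rel a b -> fcong rel b a
  | fcong_trans a b c : fcong rel a b -> fcong rel b c -> fcong rel a c
  | fcong_add a a' b b' : fcong rel a a' -> fcong rel b b' ->
      fcong rel (FAdd a b) (FAdd a' b')
  | fcong_opp a a' : fcong rel a a' -> fcong rel (FOpp a) (FOpp a')
  | fcong_addA a b c : fcong rel (FAdd a (FAdd b c)) (FAdd (FAdd a b) c)
  | fcong_addC a b : fcong rel (FAdd a b) (FAdd b a)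
  | fcong_add0 a : fcong rel (FAdd FZero a) a
  | fcong_addN a : fcong rel (FAdd (FOpp a) a) FZero
  | fcong_rel t ts : rel t ts ->
      fcong rel (FGen t) (foldr (fun u e => FAdd (FGen u) e) FZero ts).

Definition fcongb (T : Type) (rel : T -> seq T -> Prop) (a b : fsum T) :=
  `[< fcong rel a b >].

Section Presentation.
Variables (T : Type) (rel : T -> seq T -> Prop).

Lemma fcongb_refl : reflexive (fcongb rel).
Proof. by move=> a; apply/asboolP/fcong_refl. Qed.

Lemma fcongb_sym : symmetric (fcongb rel).
Proof. by move=> a b; apply/asboolP/asboolP; apply: fcong_sym. Qed.

Lemma fcongb_trans : transitive (fcongb rel).
Proof.
by move=> b a c /asboolP ab /asboolP bc; apply/asboolP/(fcong_trans ab).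
Qed.

Canonical fcong_equiv := EquivRel (fcongb rel)
  fcongb_refl fcongb_sym fcongb_trans.

Definition pres := {eq_quot fcong_equiv}.
HB.instance Definition _ := Choice.on pres.

Definition pi_pres (a : fsum T) : pres := \pi_pres a.

Lemma pi_presP a b : pi_pres a = pi_pres b <-> fcong rel a b.
Proof.
split=> [/eqmodP/asboolP//|ab]; by apply/eqmodP/asboolP.
Qed.

Lemma pi_presK (x : pres) : pi_pres (repr x) = x.
Proof. exact: reprK. Qed.

Definition pres_zero : pres := pi_pres FZero.
Definition pres_add (x y : pres) : pres := pi_pres (FAdd (repr x) (repr y)).
Definition pres_opp (x : pres) : pres := pi_pres (FOpp (repr x)).

Lemma fcong_repr a : fcong rel (repr (pi_pres a)) a.
Proof. by apply/pi_presP; rewrite pi_presK. Qed.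

Lemma pres_addE a b : pres_add (pi_pres a) (pi_pres b) = pi_pres (FAdd a b).
Proof. by apply/pi_presP; apply: fcong_add; apply: fcong_repr. Qed.

Lemma pres_oppE a : pres_opp (pi_pres a) = pi_pres (FOpp a).
Proof. by apply/pi_presP; apply/fcong_opp/fcong_repr. Qed.

Lemma pres_addA : associative pres_add.
Proof.
move=> x y z; rewrite -(pi_presK x) -(pi_presK y) -(pi_presK z) !pres_addE.
by apply/pi_presP/fcong_addA.
Qed.

Lemma pres_addC : commutative pres_add.
Proof.
move=> x y; rewrite -(pi_presK x) -(pi_presK y) !pres_addE.
by apply/pi_presP/fcong_addC.
Qed.

Lemma pres_add0 : left_id pres_zero pres_add.
Proof.
move=> x; rewrite -(pi_presK x) pres_addE.
by apply/pi_presP/fcong_add0.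
Qed.

Lemma pres_addN : left_inverse pres_zero pres_opp pres_add.
Proof.
move=> x; rewrite -(pi_presK x) pres_oppE pres_addE.
by apply/pi_presP/fcong_addN.
Qed.

HB.instance Definition _ :=
  GRing.isZmodule.Build pres pres_addA pres_addC pres_add0 pres_addN.

Definition pgen (t : T) : pres := pi_pres (FGen t).

Lemma pi_presD a b : pi_pres (FAdd a b) = pi_pres a + pi_pres b.
Proof. by rewrite -pres_addE. Qed.

Lemma pi_presN a : pi_pres (FOpp a) = - pi_pres a.
Proof. by rewrite -pres_oppE. Qed.

Lemma pi_pres0 : pi_pres FZero = 0.
Proof. by []. Qed.

Lemma pgen_rel t ts : rel t ts -> pgen t = \sum_(u <- ts) pgen u.
Proof.
move=> r; transitivity (pi_pres (foldr (fun u => FAdd (FGen u)) FZero ts)).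
  exact/pi_presP/fcong_rel.
elim: ts {r} => [|u ts IH]; first by rewrite big_nil.
by rewrite big_cons /= pi_presD IH.
Qed.

Lemma pres_ind (P : pres -> Prop) : P 0 -> (forall t, P (pgen t)) ->
  (forall x y, P x -> P y -> P (x + y)) -> (forall x, P x -> P (- x)) ->
  forall x, P x.
Proof.
move=> P0 Pg PD PN x; rewrite -(pi_presK x).
elim: (repr x) => [|t|a IHa b IHb|a IHa] //; first exact: Pg.
- by rewrite pi_presD; apply: PD.
- by rewrite pi_presN; apply: PN.
Qed.

Section Lift.
Variables (A : zmodType) (f : T -> A).

Definition respects := forall t ts, rel t ts -> f t = \sum_(u <- ts) f u.

Fixpoint feval (a : fsum T) : A :=
  match a with
  | FZero => 0
  | FGen t => f t
  | FAdd a b => feval a + feval b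
  | FOpp a => - feval a
  end.

Hypothesis hf : respects.

Lemma feval_cong a b : fcong rel a b -> feval a = feval b.
Proof.
elim=> {a b} //=.
- by move=> a b c _ -> _ ->.
- by move=> a a' b b' _ -> _ ->.
- by move=> a a' _ ->.
- by move=> a b c; rewrite addrA.
- by move=> a b; rewrite addrC.
- by move=> a; rewrite add0r.
- by move=> a; rewrite addNr.
move=> t ts /hf ->; elim: ts => [|u ts IH]; first by rewrite big_nil.
by rewrite big_cons IH.
Qed.

Definition plift (_ : respects) (x : pres) : A := feval (repr x).

Lemma plift_pi a : plift hf (pi_pres a) = feval a.
Proof. exact/feval_cong/fcong_repr. Qed.

Lemma plift_gen t : plift hf (pgen t) = f t.
Proof. exact: plift_pi. Qed.

Lemma plift_zmod : zmod_morphism (plift hf).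
Proof.
move=> x y; rewrite -(pi_presK x) -(pi_presK y) -pi_presN -pi_presD.
by rewrite !plift_pi.
Qed.

HB.instance Definition _ :=
  GRing.isZmodMorphism.Build pres A (plift hf) plift_zmod.

Lemma plift0 : plift hf 0 = 0.
Proof. exact: raddf0. Qed.

Lemma pliftD x y : plift hf (x + y) = plift hf x + plift hf y.
Proof. exact: raddfD. Qed.

Lemma pliftN x : plift hf (- x) = - plift hf x.
Proof. exact: raddfN. Qed.

End Lift.
End Presentation.
Arguments plift {T rel A} f _ _.

(* Library actions are right actions: the left G-set structure on X is
   a ** x = gact X x a^-1.  Carriers are the sets {0, ..., n-1}: every finite
   G-set is isomorphic to one of these (see mkgset), and the type gset G lives
   in the universe of the library's algebraic structures, so that groups
   generated by G-sets can be built inside zmodType; the type of all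
   finType-based G-sets would be too large for this. *)
Record gset (gT : finGroupType) (G : {group gT}) := GSet {
  gdeg : nat;
  gact : action G 'I_gdeg
}.
Arguments gact {gT G} _.
Definition gcar (gT : finGroupType) (G : {group gT}) (X : gset G) : finType :=
  'I_(gdeg X).
Coercion gcar : gset >-> finType.

Definition lmul (gT : finGroupType) (G : {group gT}) (X : gset G) (a : gT)
  (x : X) : X := gact X x a^-1%g.
Notation "a ** x" := (lmul a x) (at level 40, left associativity).

Section GsetTheory.
Variables (gT : finGroupType) (G : {group gT}).

Lemma lmul1 (X : gset G) (x : X) : 1%g ** x = x.
Proof. by rewrite /lmul invg1 (act1 (gact X)). Qed.

Lemma lmulM (X : gset G) a b (x : X) : a \in G -> b \in G ->
  (a * b)%g ** x = a ** (b ** x).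
Proof. by move=> aG bG; rewrite /lmul invMg (actMin (gact X)) ?groupV. Qed.

Lemma lmul_inj (X : gset G) a : injective (@lmul _ _ X a).
Proof. exact: act_inj. Qed.

Lemma stabP (X : gset G) (x : X) a :
  reflect (a \in G /\ a ** x = x) (a \in 'C_G[x | gact X]%g).
Proof.
rewrite !inE sub1set inE andbA andbb /lmul.
apply: (iffP andP) => -[aG].
  by move=> /eqP ax; split; rewrite // -{1}ax (actKin (gact X)).
by move=> ax; split; rewrite // -{1}ax (actKVin (gact X)).
Qed.

Section Mk.
Variables (X : finType) (f : gT -> X -> X).
Hypothesis f1 : forall x, f 1%g x = x.
Hypothesis fM : {in G &, forall a b x, f (a * b)%g x = f a (f b x)}.

Definition mkact (x : X) (a : gT) := if a \in G then f a^-1%g x else x.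

Lemma mkact_is_action : is_action G mkact.
Proof.
split=> [a x y|x a b aG bG].
  rewrite /mkact; case: ifP => // aG e.
  have /(congr1 (f a)) := e.
  by rewrite -!fM ?groupV // mulgV !f1.
by rewrite /mkact aG bG groupM // invMg fM ?groupV.
Qed.

Definition mkact_ord (i : 'I_#|X|) (a : gT) : 'I_#|X| :=
  enum_rank (mkact (enum_val i) a).

Lemma mkact_ord_is_action : is_action G mkact_ord.
Proof.
have [inj_a actM] := mkact_is_action; split=> [a i j|i a b aG bG].
  by move/enum_rank_inj/inj_a/enum_val_inj.
by rewrite /mkact_ord enum_rankK actM.
Qed.

(* The left G-set on an arbitrary finite X given by the action f; its points
   are the gin x, x : X. *)
Definition mkgset : gset G := GSet (Action mkact_ord_is_action).
Definition gin (x : X) : mkgset := enum_rank x.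
Definition gout (i : mkgset) : X := enum_val i.

Lemma ginK : cancel gin gout. Proof. exact: enum_rankK. Qed.
Lemma goutK : cancel gout gin. Proof. exact: enum_valK. Qed.

Lemma ginE a x : a \in G -> a ** gin x = gin (f a x).
Proof.
move=> aG; rewrite /lmul /= /mkact_ord /gin enum_rankK.
by rewrite /mkact groupV aG invgK.
Qed.

Lemma goutE a i : a \in G -> gout (a ** i) = f a (gout i).
Proof. by move=> aG; rewrite -{1}(goutK i) ginE // ginK. Qed.
End Mk.

Definition equivariant (X Y : gset G) (f : X -> Y) :=
  forall a x, a \in G -> f (a ** x) = a ** f x.

Definition giso (X Y : gset G) := exists2 f : X -> Y, bijective f & equivariant f.

Lemma giso_refl (X : gset G) : giso X X.
Proof. by exists id => //; exists id. Qed.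

Lemma giso_sym (X Y : gset G) : giso X Y -> giso Y X.
Proof.
move=> [f [g fK gK] fe]; exists g; first by exists f.
by move=> a y aG; rewrite -{1}(gK y) -fe // fK.
Qed.

Lemma giso_trans (Y X Z : gset G) : giso X Y -> giso Y Z -> giso X Z.
Proof.
move=> [f fb fe] [g gb ge]; exists (g \o f); first exact: bij_comp.
by move=> a x aG /=; rewrite fe // ge.
Qed.

Lemma inj_surj_bij (A B : finType) (f : A -> B) :
  injective f -> (forall y, exists x, f x = y) -> bijective f.
Proof.
move=> fi fs; apply: (inj_card_bij fi).
rewrite -(card_codom fi); apply: subset_leq_card; apply/subsetP=> y _.
by have [x <-] := fs y; apply: codom_f.
Qed.

Lemma mk_giso (X Y : finType) (f : gT -> X -> X) (g : gT -> Y -> Y)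
    (f1 : forall x, f 1%g x = x)
    (fM : {in G &, forall a b x, f (a * b)%g x = f a (f b x)})
    (g1 : forall y, g 1%g y = y)
    (gM : {in G &, forall a b y, g (a * b)%g y = g a (g b y)})
    (h : X -> Y) : bijective h ->
    (forall a x, a \in G -> h (f a x) = g a (h x)) ->
  giso (mkgset f1 fM) (mkgset g1 gM).
Proof.
move=> [h' hK h'K] he; exists (fun i => gin g1 gM (h (gout i))).
  by exists (fun i => gin f1 fM (h' (gout i))) => i;
    rewrite ginK ?hK ?h'K goutK.
by move=> a i aG; rewrite goutE // he // ginE.
Qed.

Section Union.
Variables X Y : gset G.

Definition union_act (a : gT) (z : X + Y) : X + Y :=
  match z with inl x => inl (a ** x) | inr y => inr (a ** y) end.

Lemma union_act1 z : union_act 1%g z = z.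
Proof. by case: z => z /=; rewrite lmul1. Qed.

Lemma union_actM :
  {in G &, forall a b z, union_act (a * b)%g z = union_act a (union_act b z)}.
Proof. by move=> a b aG bG [] z /=; rewrite lmulM. Qed.

Definition gunion : gset G := mkgset union_act1 union_actM.
End Union.

Section Product.
Variables X Y : gset G.

Definition prod_act (a : gT) (z : X * Y) : X * Y := (a ** z.1, a ** z.2).

Lemma prod_act1 z : prod_act 1%g z = z.
Proof. by case: z => x y; rewrite /prod_act !lmul1. Qed.

Lemma prod_actM :
  {in G &, forall a b z, prod_act (a * b)%g z = prod_act a (prod_act b z)}.
Proof. by move=> a b aG bG [x y]; rewrite /prod_act /= !lmulM. Qed.

Definition gprod : gset G := mkgset prod_act1 prod_actM.
End Product.

Definition point_act (a : gT) (z : unit) := z.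

Lemma point_act1 z : point_act 1%g z = z. Proof. by []. Qed.

Lemma point_actM :
  {in G &, forall a b z, point_act (a * b)%g z = point_act a (point_act b z)}.
Proof. by []. Qed.

Definition gpoint : gset G := mkgset point_act1 point_actM.

Section Cosets.
Variable D : {group gT}.

Definition coset_set := {A : {set gT} | A \in lcosets D G}.

Definition coset_act (a : gT) (A : coset_set) : coset_set :=
  insubd A (a *: val A)%g.

Lemma coset_actE a (A : coset_set) : a \in G ->
  val (coset_act a A) = (a *: val A)%g.
Proof.
move=> aG; rewrite val_insubd; case: ifPn => // /negP[].
have /lcosetsP[x xG ->] := valP A.
by rewrite -lcosetM; apply/lcosetsP; exists (a * x)%g; rewrite ?groupM.
Qed.

Lemma coset_act1 A : coset_act 1%g A = A.
Proof. by apply: val_inj; rewrite coset_actE ?group1 // lcoset1. Qed.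

Lemma coset_actM :
  {in G &, forall a b A, coset_act (a * b)%g A = coset_act a (coset_act b A)}.
Proof.
by move=> a b aG bG A; apply: val_inj; rewrite !coset_actE ?groupM // lcosetM.
Qed.

Definition gcosets : gset G := mkgset coset_act1 coset_actM.
End Cosets.

End GsetTheory.

(* The A-set L\T of L-orbits of an (A x L)-set T *)
Section OrbitSet.
Variables (aT lT : finGroupType) (A : {group aT}) (L : {group lT}).

Section OneSet.
Variable T : gset (setX_group A L).

Definition orbit_set :=
  {O : {set T} | O \in orbit (gact T) (setX 1%g L) @: [set: T]}.

Lemma orb_subproof (t : T) :
  orbit (gact T) (setX 1%g L) t \in orbit (gact T) (setX 1%g L) @: [set: T].
Proof. exact: imset_f. Qed.

Definition orb (t : T) : orbit_set :=
  exist (fun O => is_true (O \in _)) _ (orb_subproof t).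

Lemma in_orbP t t' :
  reflect (exists2 l, l \in L & t' = (1%g, l) ** t) (t' \in val (orb t)).
Proof.
apply: (iffP imsetP) => [[[a l]]|[l lL ->]].
  rewrite in_setX /= => /andP[/set1P -> lL] ->.
  exists l^-1%g; rewrite ?groupV // /lmul; congr (gact T t _).
  by apply: (canRL invgK); congr (_, _); rewrite invg1.
exists (1%g, l^-1%g); first by rewrite in_setX set11 groupV.
by congr (gact T t _); congr (_, _); rewrite invg1.
Qed.

Lemma in1L l : l \in L -> (1%g, l) \in setX_group A L.
Proof. by move=> lL; rewrite in_setX group1. Qed.

Lemma inA1 a : a \in A -> (a, 1%g) \in setX_group A L.
Proof. by move=> aA; rewrite in_setX aA /=. Qed.

Lemma orb_self t : t \in val (orb t).
Proof. by apply/in_orbP; exists 1%g; rewrite // (lmul1 (X := T)). Qed.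

Lemma orbP t t' :
  orb t = orb t' <-> exists2 l, l \in L & t' = (1%g, l) ** t.
Proof.
split=> [e|[l lL ->]].
  by apply/in_orbP; rewrite e orb_self.
apply: val_inj; apply/setP=> u; apply/in_orbP/in_orbP => -[k kL ->].
  exists (k * l^-1)%g; first by rewrite groupM ?groupV.
  rewrite -lmulM ?in1L ?groupM ?groupV //; congr lmul.
  by congr (_, _); rewrite ?mulg1 ?mulgKV.
exists (k * l)%g; first by rewrite groupM.
rewrite -lmulM ?in1L //; congr lmul.
by congr (_, _); rewrite ?mulg1.
Qed.

Lemma orb_surj (O : orbit_set) : exists t, orb t = O.
Proof.
have /imsetP[t _ e] := valP O; exists t; exact: val_inj.
Qed.

Definition orbit_act (a : aT) (O : orbit_set) : orbit_set :=
  insubd O [set (a, 1%g) ** t | t in val O].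

Lemma lmul_comm a l (t : T) : a \in A -> l \in L ->
  (a, 1%g) ** ((1%g, l) ** t) = (1%g, l) ** ((a, 1%g) ** t).
Proof.
move=> aA lL; rewrite -!lmulM ?in1L ?inA1 //; congr lmul.
by congr (_, _); rewrite !(mulg1, mul1g).
Qed.

Lemma orbit_actE a t : a \in A -> orbit_act a (orb t) = orb ((a, 1%g) ** t).
Proof.
move=> aA; apply: val_inj; rewrite val_insubd.
have -> : [set (a, 1%g) ** t0 | t0 in val (orb t)] =
          val (orb ((a, 1%g) ** t)).
  apply/setP=> u; apply/imsetP/in_orbP => [[t' /in_orbP[l lL ->] ->]|[l lL ->]].
    by exists l; rewrite ?lmul_comm.
  exists ((1%g, l) ** t); last by rewrite lmul_comm.
  by apply/in_orbP; exists l.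
by rewrite (valP (orb _)).
Qed.

Lemma orbit_act1 O : orbit_act 1%g O = O.
Proof. by have [t <-] := orb_surj O; rewrite orbit_actE // (lmul1 (X := T)). Qed.

Lemma orbit_actM :
  {in A &, forall a b O, orbit_act (a * b)%g O = orbit_act a (orbit_act b O)}.
Proof.
move=> a b aA bA O; have [t <-] := orb_surj O.
rewrite !orbit_actE ?groupM // -lmulM ?inA1 //; congr (orb (lmul _ _)).
by congr (_, _); rewrite mulg1.
Qed.

Definition gorbits : gset A := mkgset orbit_act1 orbit_actM.
End OneSet.

Section Map.
Variables (T T' : gset (setX_group A L)) (f : T -> T').
Hypothesis fe : equivariant f.

Definition orb_map (O : orbit_set T) : orbit_set T' :=
  orb (f (sval (cid (orb_surj O)))).

Lemma orb_mapE t : orb_map (orb t) = orb (f t).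
Proof.
have /orbP[l lL e] := svalP (cid (orb_surj (orb t))).
by apply/orbP; exists l; rewrite // -fe ?in1L // -e.
Qed.

Lemma orb_map_equiv a O : a \in A ->
  orb_map (orbit_act a O) = orbit_act a (orb_map O).
Proof.
move=> aA; have [t <-] := orb_surj O.
by rewrite orbit_actE // !orb_mapE fe ?inA1 // orbit_actE.
Qed.
End Map.

Lemma gorbits_iso (T T' : gset (setX_group A L)) :
  giso T T' -> giso (gorbits T) (gorbits T').
Proof.
move=> [f [g fK gK] fe]; apply: (@mk_giso _ _ _ _ _ _ _ _ _ _ (orb_map f));
  last by move=> a O aA; apply: orb_map_equiv.
apply: inj_surj_bij => [O O'|O'].
  have [t <-] := orb_surj O; have [t' <-] := orb_surj O'.
  rewrite !orb_mapE // => /orbP[l lL e]; apply/orbP; exists l => //.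
  by apply: (can_inj fK); rewrite e fe ?in1L.
have [t <-] := orb_surj O'; exists (orb (g t)).
by rewrite orb_mapE // gK.
Qed.

Lemma gorbits_union (T T' : gset (setX_group A L)) :
  giso (gorbits (gunion T T')) (gunion (gorbits T) (gorbits T')).
Proof.
apply: giso_sym; pose W := gunion T T'.
pose il (t : T) : W := gin _ _ (inl t).
pose ir (t : T') : W := gin _ _ (inr t).
have el : equivariant il by move=> a t aA; rewrite /il ginE.
have er : equivariant ir by move=> a t aA; rewrite /ir ginE.
pose f (z : gorbits T + gorbits T') : orbit_set W :=
  match z with inl o => orb_map il (gout o) | inr o => orb_map ir (gout o) end.
have key z z' : orb (gin _ _ z : W) = orb (gin _ _ z' : W) ->
    exists2 l, l \in L & z' = union_act (1%g, l) z.
  move=> /orbP[l lL e]; exists l => //.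
  by have := congr1 (fun w : W => gout w) e; rewrite goutE ?in1L // !ginK.
have oP (V : gset (setX_group A L)) (o : gorbits V) :
    exists t : V, o = gin _ _ (orb t).
  by have [t e] := orb_surj (gout o); exists t; rewrite e goutK.
apply: (@mk_giso _ _ _ _ _ _ _ _ _ _ f); first apply: inj_surj_bij.
- move=> [] o [] o'; have [t ->] := oP _ o; have [t' ->] := oP _ o';
    rewrite /f !ginK ?(orb_mapE el) ?(orb_mapE er);
    move=> /key[l lL] //= -[e].
    by congr (inl (gin _ _ _)); apply/(orbP (T := T)); exists l.
  by congr (inr (gin _ _ _)); apply/(orbP (T := T')); exists l.
- move=> O; have [t <-] := orb_surj O; rewrite -(goutK t).
  case: (gout t) => {}t.
    by exists (inl (gin _ _ (orb t))); rewrite /= ginK orb_mapE.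
  by exists (inr (gin _ _ (orb t))); rewrite /= ginK orb_mapE.
by move=> a [] O aA /=; rewrite goutE // orb_map_equiv.
Qed.

End OrbitSet.

(* A (G,H)-biset is encoded as the left G x H-set (g,h)u = g u h^-1. *)
Notation biset G H := (gset (setX_group G H)).

Section Tensor.
Variables (gT hT : finGroupType) (G : {group gT}) (H : {group hT}).

Section ActSet.
Variables (U : biset G H) (X : gset H).

Definition tensx_act (p : gT * hT) (z : U * X) : U * X :=
  (p ** z.1, p.2 ** z.2).

Lemma tensx_act1 z : tensx_act 1%g z = z.
Proof. by case: z => u x; rewrite /tensx_act !lmul1. Qed.

Lemma tensx_actM : {in setX_group G H &, forall p q z,
  tensx_act (p * q)%g z = tensx_act p (tensx_act q z)}.
Proof.
move=> p q pGH qGH [u x]; rewrite /tensx_act /= (lmulM (X := U)) //.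
congr (_, _); case: p q pGH qGH => [a b] [c d] /setXP[_ bH] /setXP[_ dH].
exact: lmulM.
Qed.

(* (g,h)(u,x) = (g u h^-1, h x) *)
Definition tensx_prod : gset (setX_group G H) := mkgset tensx_act1 tensx_actM.

Definition tensx : gset G := gorbits tensx_prod.
Definition tensx_cl (u : U) (x : X) : tensx :=
  gin _ _ (orb (gin tensx_act1 tensx_actM (u, x) : tensx_prod)).
End ActSet.

Variables (kT : finGroupType) (K : {group kT}).

Section ActBiset.
Variables (U : biset G H) (V : biset H K).

Definition tens_act (p : gT * kT * hT) (z : U * V) : U * V :=
  ((p.1.1, p.2) ** z.1, (p.2, p.1.2) ** z.2).

Lemma tens_act1 z : tens_act 1%g z = z.
Proof. by case: z => u v; rewrite /tens_act !lmul1. Qed.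

Lemma tens_actM : {in setX_group (setX_group G K) H &, forall p q z,
  tens_act (p * q)%g z = tens_act p (tens_act q z)}.
Proof.
move=> [[g k] h] [[g' k'] h']; rewrite !in_setX /=.
move=> /andP[/andP[gG kK] hH] /andP[/andP[gG' kK'] hH'] [u v].
by rewrite /tens_act /= -!lmulM //; apply/setXP.
Qed.

(* ((g,k),h)(u,v) = (g u h^-1, h v k^-1) *)
Definition tens_prod : gset (setX_group (setX_group G K) H) :=
  mkgset tens_act1 tens_actM.

Definition tens : biset G K := gorbits tens_prod.
End ActBiset.

Lemma tens_isol (U U' : biset G H) (V : biset H K) :
  giso U U' -> giso (tens U V) (tens U' V).
Proof.
move=> [f [g fK gK] fe]; apply: gorbits_iso.
apply: (@mk_giso _ _ _ _ _ _ _ _ _ _ (fun z => (f z.1, z.2))).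
  by exists (fun z => (g z.1, z.2)) => -[u v] /=; rewrite ?fK ?gK.
move=> [[a k] h] [u v] /setXP[/= /setXP[/= aG kK] hH].
by rewrite /tens_act /= fe //; apply/setXP.
Qed.

Lemma tens_isor (U : biset G H) (V V' : biset H K) :
  giso V V' -> giso (tens U V) (tens U V').
Proof.
move=> [f [g fK gK] fe]; apply: gorbits_iso.
apply: (@mk_giso _ _ _ _ _ _ _ _ _ _ (fun z => (z.1, f z.2))).
  by exists (fun z => (z.1, g z.2)) => -[u v] /=; rewrite ?fK ?gK.
move=> [[a k] h] [u v] /setXP[/= /setXP[/= aG kK] hH].
by rewrite /tens_act /= fe //; apply/setXP.
Qed.

Lemma tens_unionl (U U' : biset G H) (V : biset H K) :
  giso (tens (gunion U U') V) (gunion (tens U V) (tens U' V)).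
Proof.
apply: giso_trans (gorbits_union _ _); apply: gorbits_iso.
apply: (@mk_giso _ _ _ _ _ _ _ _ _ _
  (fun z : gunion U U' * V => match gout z.1 with
     | inl u => inl (gin _ _ (u, z.2) : tens_prod U V)
     | inr u => inr (gin _ _ (u, z.2) : tens_prod U' V) end)).
  exists (fun z => match z with
     | inl w => (gin _ _ (inl (gout w).1) : gunion U U', (gout w).2)
     | inr w => (gin _ _ (inr (gout w).1) : gunion U U', (gout w).2) end).
    by move=> [u v] /=; rewrite -{2}(goutK u); case: (gout u) => {}u;
      rewrite ginK.
  by move=> [w|w]; rewrite ginK /= -[RHS](congr1 _ (goutK w));
    case: (gout w).
move=> [[a k] h] [u v] i; case/setXP: (i) => /= /setXP[/= aG kK] hH.
rewrite goutE; last exact/setXP.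
by case: (gout u) => {}u /=; rewrite ginE.
Qed.

Lemma tens_unionr (U : biset G H) (V V' : biset H K) :
  giso (tens U (gunion V V')) (gunion (tens U V) (tens U V')).
Proof.
apply: giso_trans (gorbits_union _ _); apply: gorbits_iso.
apply: (@mk_giso _ _ _ _ _ _ _ _ _ _
  (fun z : U * gunion V V' => match gout z.2 with
     | inl v => inl (gin _ _ (z.1, v) : tens_prod U V)
     | inr v => inr (gin _ _ (z.1, v) : tens_prod U V') end)).
  exists (fun z => match z with
     | inl w => ((gout w).1, gin _ _ (inl (gout w).2) : gunion V V')
     | inr w => ((gout w).1, gin _ _ (inr (gout w).2) : gunion V V') end).
    by move=> [u v] /=; rewrite -{2}(goutK v); case: (gout v) => {}v;
      rewrite ginK.
  by move=> [w|w]; rewrite ginK /= -[RHS](congr1 _ (goutK w));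
    case: (gout w).
move=> [[a k] h] [u v] i; case/setXP: (i) => /= /setXP[/= aG kK] hH.
rewrite goutE; last exact/setXP.
by case: (gout v) => {}v /=; rewrite ginE.
Qed.

End Tensor.

Section RegularBiset.
Variables (gT : finGroupType) (G : {group gT}).

Definition reg_act (p : gT * gT) (z : subg_of G) : subg_of G :=
  subg G (p.1 * sgval z * p.2^-1)%g.

Lemma reg_act1 z : reg_act 1%g z = z.
Proof. by rewrite /reg_act /= invg1 mul1g mulg1 sgvalK. Qed.

Lemma reg_actM : {in setX_group G G &, forall p q z,
  reg_act (p * q)%g z = reg_act p (reg_act q z)}.
Proof.
move=> [a b] [c d]; rewrite !in_setX /= => /andP[aG bG] /andP[cG dG] z.
rewrite /reg_act /= subgK ?groupM ?groupV ?subgP //.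
by congr (subg G _); rewrite invMg !mulgA.
Qed.

Definition reg_biset : biset G G := mkgset reg_act1 reg_actM.
End RegularBiset.

Inductive brel (gT : finGroupType) (G : {group gT}) :
    gset G -> seq (gset G) -> Prop :=
  | brel_iso X Y : giso X Y -> brel X [:: Y]
  | brel_union X Y : brel (gunion X Y) [:: X; Y].

(* B(G,H) *)
Notation bgrp G H := (pres (@brel _ (setX_group G H))).
Definition bcls (gT hT : finGroupType) (G : {group gT}) (H : {group hT})
  (U : biset G H) : bgrp G H := pgen (@brel _ _) U.

(* [(G x H)/D] *)
Definition btrans (gT hT : finGroupType) (G : {group gT}) (H : {group hT})
  (D : {group gT * hT}) : bgrp G H := bcls (gcosets (setX_group G H) D).

Definition bid (gT : finGroupType) (G : {group gT}) : bgrp G G :=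
  bcls (reg_biset G).

Section BisetComposition.
Variables (gT hT kT : finGroupType).
Variables (G : {group gT}) (H : {group hT}) (K : {group kT}).

Lemma bcls_iso (U U' : biset G K) : giso U U' -> bcls U = bcls U'.
Proof.
by move=> i; rewrite /bcls (pgen_rel (brel_iso i)) big_seq1.
Qed.

Lemma bcls_union (U U' : biset G K) : bcls (gunion U U') = bcls U + bcls U'.
Proof. by rewrite /bcls (pgen_rel (brel_union U U')) big_cons big_seq1. Qed.

Lemma bcompl_respects (U : biset G H) :
  respects (@brel _ (setX_group H K)) (fun V => bcls (tens U V)).
Proof.
move=> _ _ [V V' i|V V'].
  by rewrite big_seq1; apply/bcls_iso/tens_isor.
by rewrite big_cons big_seq1 -bcls_union; apply/bcls_iso/tens_unionr.
Qed.

Definition bcompl (b : bgrp H K) (U : biset G H) : bgrp G K :=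
  plift (fun V => bcls (tens U V)) (bcompl_respects U) b.

Lemma bcomp_respects (b : bgrp H K) :
  respects (@brel _ (setX_group G H)) (bcompl b).
Proof.
move=> _ _ [U U' i|U U']; rewrite ?big_cons big_nil addr0 /bcompl;
  elim/pres_ind: b => [|V|x y|x].
- by rewrite !plift0.
- by rewrite !plift_gen; apply/bcls_iso/tens_isol.
- by rewrite !pliftD => -> ->.
- by rewrite !pliftN => ->.
- by rewrite !plift0 addr0.
- by rewrite !plift_gen -bcls_union; apply/bcls_iso/tens_unionl.
- by rewrite !pliftD => -> ->; rewrite addrACA.
- by rewrite !pliftN => ->; rewrite opprD.
Qed.

(* The bilinear extension of (U,V) |-> U x_H V *)
Definition bcomp (a : bgrp G H) (b : bgrp H K) : bgrp G K :=
  plift (bcompl b) (bcomp_respects b) a.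

Lemma bcompE U V : bcomp (bcls U) (bcls V) = bcls (tens U V).
Proof. by rewrite /bcomp /bcls plift_gen /bcompl plift_gen. Qed.

End BisetComposition.

Section Subgroups.
Variables (gT hT kT : finGroupType).
Implicit Types (G : {group gT}) (H : {group hT}).

Definition p1 (D : {group gT * hT}) : {group gT} :=
  [group of (fst_morphism gT hT @* D)%g].

Definition star (D : {set gT * hT}) (E : {set hT * kT}) : {set gT * kT} :=
  [set x | [exists h, ((x.1, h) \in D) && ((h, x.2) \in E)]].

Lemma star_group_set (D : {group gT * hT}) (E : {group hT * kT}) :
  group_set (star D E).
Proof.
apply/group_setP; split=> [|[g k] [g' k']].
  by rewrite inE; apply/existsP; exists 1%g; rewrite !group1.
rewrite !inE => /existsP[h /andP[gD hE]] /existsP[h' /andP[gD' hE']].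
apply/existsP; exists (h * h')%g; apply/andP; split.
  exact: groupM gD gD'.
exact: groupM hE hE'.
Qed.
Canonical star_group D E := Group (star_group_set D E).

Definition starl (D : {set gT * hT}) (K : {set hT}) : {set gT} :=
  [set g | [exists k in K, (g, k) \in D]].

Lemma starl_group_set (D : {group gT * hT}) (K : {group hT}) :
  group_set (starl D K).
Proof.
apply/group_setP; split=> [|g g'].
  by rewrite inE; apply/existsP; exists 1%g; rewrite !group1.
rewrite !inE => /existsP[h /andP[hK gD]] /existsP[h' /andP[hK' gD']].
apply/existsP; exists (h * h')%g; apply/andP; split; first exact: groupM.
exact: groupM gD gD'.
Qed.
Canonical starl_group D K := Group (starl_group_set D K).

Definition Delta G : {set gT * gT} := [set (g, g) | g in G].

Lemma Delta_group_set G : group_set (Delta G).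
Proof.
apply/group_setP; split=> [|_ _ /imsetP[g gG ->] /imsetP[g' gG' ->]].
  by apply/imsetP; exists 1%g.
by apply/imsetP; exists (g * g')%g; rewrite ?groupM.
Qed.
Canonical Delta_group G := Group (Delta_group_set G).

(* {(g h g^-1, h) | h in G} *)
Definition conjgraph (g : gT) G : {set gT * gT} :=
  [set ((h ^ g^-1)%g, h) | h in G].

Lemma conjgraph_group_set g G : group_set (conjgraph g G).
Proof.
apply/group_setP; split=> [|_ _ /imsetP[h hG ->] /imsetP[h' hG' ->]].
  by apply/imsetP; exists 1%g; rewrite ?conj1g.
by apply/imsetP; exists (h * h')%g; rewrite ?groupM // conjMg.
Qed.
Canonical conjgraph_group g G := Group (conjgraph_group_set g G).

Section Graphs.
Variables (G : {group gT}) (phi : {morphism G >-> hT}).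

Definition graphr : {set gT * hT} := [set (g, phi g) | g in G].
Definition graphl : {set hT * gT} := [set (phi g, g) | g in G].

Lemma graphr_group_set : group_set graphr.
Proof.
apply/group_setP; split=> [|_ _ /imsetP[h hG ->] /imsetP[h' hG' ->]].
  by apply/imsetP; exists 1%g; rewrite ?morph1.
by apply/imsetP; exists (h * h')%g; rewrite ?groupM // morphM.
Qed.
Canonical graphr_group := Group graphr_group_set.

Lemma graphl_group_set : group_set graphl.
Proof.
apply/group_setP; split=> [|_ _ /imsetP[h hG ->] /imsetP[h' hG' ->]].
  by apply/imsetP; exists 1%g; rewrite ?morph1.
by apply/imsetP; exists (h * h')%g; rewrite ?groupM // morphM.
Qed.
Canonical graphl_group := Group graphl_group_set.
End Graphs.

End Subgroups.

(* A class of finite groups: a finite group is a subgroup of some ambient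
   finGroupType, so that subgroups of members are again candidates. *)
Record gclass := Gclass {
  gmem : forall gT : finGroupType, {group gT} -> Prop
}.
Arguments gmem _ {gT} G.

Record obj (GG : gclass) := Obj {
  ogT : finGroupType;
  ogrp :> {group ogT};
  ogrpP : gmem GG ogrp
}.
Arguments ogT {GG} _.
Arguments ogrp {GG} _.

Lemma obj_eq (GG : gclass) (gT : finGroupType) (G H : {group gT})
  (pG : gmem GG G) (pH : gmem GG H) : G = H -> Obj pG = Obj pH.
Proof. by move=> e; subst H; congr Obj; apply: Prop_irrelevance. Qed.

Record sfam (GG : gclass) := Sfam {
  smem :> forall G H : obj GG, {group ogT G * ogT H} -> Prop;
  smem_sub : forall (G H : obj GG) (D : {group ogT G * ogT H}),
    smem D -> D \subset setX G H
}.
Arguments smem {GG} _ G H D.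

Record axioms (GG : gclass) (S : sfam GG) : Prop := {
  ax_i : forall G : obj GG, S G G (Delta_group G);
  ax_ii : forall (G H : obj GG) (D : {group ogT G * ogT H}) x,
    S G H D -> x \in setX G H -> S G H (D :^ x)%G;
  ax_iii : forall (G H K : obj GG) (D : {group ogT G * ogT H})
      (E : {group ogT H * ogT K}),
    S G H D -> S H K E -> S G K (star_group D E);
  ax_iv : forall (G H : obj GG) (D : {group ogT G * ogT H})
      (K : {group ogT H}) (pK : gmem GG K),
    S G H D -> K \subset H ->
    exists pDK : gmem GG (starl_group D K),
      S (Obj pDK) (Obj pK) (star_group D (Delta_group K));
  ax_vi : forall (G : obj GG) (H : {group ogT G}) (pH : gmem GG H),
    H \subset G -> S (Obj pH) G (Delta_group H)
}.

Section PlusMinus.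
Variables (GG : gclass) (S : sfam GG).

Definition Splus_mem (G H : obj GG) (D : {group ogT G * ogT H}) : Prop :=
  D \subset setX G H /\ exists p : gmem GG (p1 D), S (Obj p) H D.

Lemma Splus_sub (G H : obj GG) (D : {group ogT G * ogT H}) :
  Splus_mem D -> D \subset setX G H.
Proof. by case. Qed.

Definition Splus : sfam GG := Sfam Splus_sub.

Definition Sminus_mem (G H : obj GG) (D : {group ogT G * ogT H}) : Prop :=
  S G H D /\ p1 D = G.

Lemma Sminus_sub (G H : obj GG) (D : {group ogT G * ogT H}) :
  Sminus_mem D -> D \subset setX G H.
Proof. by case=> /smem_sub. Qed.

Definition Sminus : sfam GG := Sfam Sminus_sub.

Lemma Sminus_plus (G H : obj GG) (D : {group ogT G * ogT H}) :
  Sminus G H D -> Splus G H D.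
Proof.
case=> SD e; split; first exact: smem_sub SD.
have p : gmem GG (p1 D) by rewrite e; apply: ogrpP.
exists p; move: SD; move: p; case: G D e => gT G pG D /= e.
by rewrite e => p; rewrite (Prop_irrelevance p pG).
Qed.
End PlusMinus.

Record category := Category {
  cob :> Type;
  chom : cob -> cob -> Type;
  cid : forall x, chom x x;
  ccomp : forall x y z, chom y z -> chom x y -> chom x z;
  ccompA : forall x y z t (h : chom z t) (g : chom y z) (f : chom x y),
    ccomp h (ccomp g f) = ccomp (ccomp h g) f;
  ccomp1l : forall x y (f : chom x y), ccomp (cid y) f = f;
  ccomp1r : forall x y (f : chom x y), ccomp f (cid x) = f
}.
Arguments chom {_} _ _.
Arguments cid {_} _.
Arguments ccomp {_ x y z} _ _.

Record functor (C D : category) := Functor {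
  fob :> C -> D;
  fmap : forall x y, chom x y -> chom (fob x) (fob y);
  fmap_id : forall x, fmap (cid x) = cid (fob x);
  fmap_comp : forall x y z (g : chom y z) (f : chom x y),
    fmap (ccomp g f) = ccomp (fmap g) (fmap f)
}.
Arguments fmap {C D} _ {x y} _.

Definition is_adjunction (C D : category) (L : functor C D) (M : functor D C)
    (b : forall (x : C) (y : D), chom (L x) y -> chom x (M y)) : Prop :=
  [/\ forall x y, bijective (b x y),
      forall x x' y (f : chom x' x) (phi : chom (L x) y),
        b x' y (ccomp phi (fmap L f)) = ccomp (b x y phi) f
    & forall x y y' (g : chom y y') (phi : chom (L x) y),
        b x y' (ccomp g phi) = ccomp (fmap M g) (b x y phi)].

(* Unital associative R-algebra structures; the library's algType R excludes
   the zero algebra. *)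
Record alg_on (R : comPzRingType) (A : lmodType R) := AlgOn {
  amul : A -> A -> A;
  aone : A;
  amulA : associative amul;
  amul1l : left_id aone amul;
  amul1r : right_id aone amul;
  amulDl : left_distributive amul +%R;
  amulDr : right_distributive amul +%R;
  amulZl : forall r x y, amul (r *: x) y = r *: amul x y;
  amulZr : forall r x y, amul x (r *: y) = r *: amul x y
}.

Section Green.
Variables (GG : gclass) (T : sfam GG) (R : comPzRingType).

(* Hom(H,G) in C(GG,T), as a subgroup of B(G,H) *)
Inductive in_hom (G H : obj GG) : bgrp G H -> Prop :=
  | in_hom0 : in_hom 0
  | in_homB a b : in_hom a -> in_hom b -> in_hom (a - b)
  | in_hom_gen D : T G H D -> in_hom (btrans G H D).

(* bmor a is meaningful only for a in Hom(H,G); nothing below depends on its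
   other values. *)
Record bfun_on (A : obj GG -> lmodType R) := BfunOn {
  bmor : forall G H : obj GG, bgrp G H -> {linear A H -> A G};
  bmorD : forall (G H : obj GG) (a b : bgrp G H) x,
    in_hom a -> in_hom b -> bmor (a + b) x = bmor a x + bmor b x;
  bmor_id : forall (G : obj GG) x, bmor (bid G) x = x;
  bmor_comp : forall (G H K : obj GG) (a : bgrp G H) (b : bgrp H K) x,
    in_hom a -> in_hom b -> bmor (bcomp a b) x = bmor a (bmor b x)
}.

Record green_on (A : obj GG -> lmodType R) := GreenOn {
  green_bfun :> bfun_on A;
  green_alg : forall G, alg_on (A G);
  green_res1 : forall (H K : obj GG) (phi : {morphism H >-> ogT K}),
    (phi @* H \subset K)%g -> T H K (graphr_group phi) ->
    bmor green_bfun (btrans H K (graphr_group phi)) (aone (green_alg K))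
      = aone (green_alg H);
  green_resM : forall (H K : obj GG) (phi : {morphism H >-> ogT K}),
    (phi @* H \subset K)%g -> T H K (graphr_group phi) ->
    forall x y,
    let r := bmor green_bfun (btrans H K (graphr_group phi)) in
    r (amul (green_alg K) x y) = amul (green_alg H) (r x) (r y);
  green_frobl : forall (H K : obj GG) (phi : {morphism H >-> ogT K}),
    (phi @* H \subset K)%g -> T H K (graphr_group phi) ->
    T K H (graphl_group phi) ->
    forall a b,
    let r := bmor green_bfun (btrans H K (graphr_group phi)) in
    let i := bmor green_bfun (btrans K H (graphl_group phi)) in
    amul (green_alg K) (i a) b = i (amul (green_alg H) a (r b));
  green_frobr : forall (H K : obj GG) (phi : {morphism H >-> ogT K}),
    (phi @* H \subset K)%g -> T H K (graphr_group phi) ->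
    T K H (graphl_group phi) ->
    forall a b,
    let r := bmor green_bfun (btrans H K (graphr_group phi)) in
    let i := bmor green_bfun (btrans K H (graphl_group phi)) in
    amul (green_alg K) b (i a) = i (amul (green_alg H) (r b) a)
}.

Record green := Green {
  gmod :> obj GG -> lmodType R;
  gstr : green_on gmod
}.

Definition gmor (F : green) (G H : obj GG) (a : bgrp G H) :
  {linear F H -> F G} := bmor (gstr F) a.
Definition gmul (F : green) (G : obj GG) : F G -> F G -> F G :=
  amul (green_alg (gstr F) G).
Definition gone (F : green) (G : obj GG) : F G := aone (green_alg (gstr F) G).

Record ghom (F M : green) := Ghom {
  gapp :> forall G : obj GG, F G -> M G;
  gapp_linear : forall G, linear (@gapp G);
  gapp1 : forall G, gapp (gone F G) = gone M G;
  gappM : forall G (x y : F G), gapp (gmul (F := F) x y) = gmul (F := M) (gapp x) (gapp y);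
  gapp_nat : forall (G H : obj GG) (a : bgrp G H) x, in_hom a ->
    gapp (gmor F a x) = gmor M a (gapp x)
}.
Arguments gapp {F M} _ G _.

Lemma ghomP (F M : green) (f g : ghom F M) : (forall G x, f G x = g G x) -> f = g.
Proof.
case: f => f f1 f2 f3 f4; case: g => g g1 g2 g3 g4 /= e.
have {}e : f = g.
  by apply: functional_extensionality_dep => G;
     apply: functional_extensionality_dep => x; apply: e.
by subst g; congr Ghom; apply: Prop_irrelevance.
Qed.

Lemma ghom_id_linear (F : green) G : linear (fun x : F G => x).
Proof. by []. Qed.

Definition ghom_id (F : green) : ghom F F :=
  @Ghom F F (fun G x => x) (@ghom_id_linear F) (fun G => erefl)
    (fun G x y => erefl) (fun G H a x _ => erefl).

Section Comp.
Variables (F M N : green) (g : ghom M N) (f : ghom F M).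

Lemma ghom_comp_linear G : linear (fun x : F G => g G (f G x)).
Proof. by move=> r x y; rewrite !gapp_linear. Qed.

Lemma ghom_comp1 G : g G (f G (gone F G)) = gone N G.
Proof. by rewrite !gapp1. Qed.

Lemma ghom_compM G x y : g G (f G (gmul x y)) = gmul (g G (f G x)) (g G (f G y)).
Proof. by rewrite !gappM. Qed.

Lemma ghom_comp_nat (G H : obj GG) (a : bgrp G H) x : in_hom a ->
  g G (f G (gmor F a x)) = gmor N a (g H (f H x)).
Proof. by move=> ha; rewrite !gapp_nat. Qed.

Definition ghom_comp : ghom F N :=
  Ghom ghom_comp_linear ghom_comp1 ghom_compM ghom_comp_nat.
End Comp.

Lemma ghom_compA F M N P (h : ghom N P) (g : ghom M N) (f : ghom F M) :
  ghom_comp h (ghom_comp g f) = ghom_comp (ghom_comp h g) f.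
Proof. exact: ghomP. Qed.

Lemma ghom_comp1l F M (f : ghom F M) : ghom_comp (ghom_id M) f = f.
Proof. exact: ghomP. Qed.

Lemma ghom_comp1r F M (f : ghom F M) : ghom_comp f (ghom_id F) = f.
Proof. exact: ghomP. Qed.

(* F^mu_{C(GG,T),R} *)
Definition green_cat : category :=
  Category ghom_compA ghom_comp1l ghom_comp1r.

End Green.
Arguments gapp {GG T R F M} _ G _.
Arguments gmul {GG T R} F {G} _ _.
Arguments gmor {GG T R} F {G H} a.

Section Restriction.
Variables (GG : gclass) (S : sfam GG) (R : comPzRingType).

Lemma in_hom_minus_plus (G H : obj GG) (a : bgrp G H) :
  in_hom (Sminus S) a -> in_hom (Splus S) a.
Proof.
elim=> [|b c _ hb _ hc|D /Sminus_plus]; first exact: in_hom0.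
  exact: in_homB.
exact: in_hom_gen.
Qed.

Section Object.
Variable M : green (Splus S) R.
Let A : obj GG -> lmodType R := M.
Let B : green_on (Splus S) A := gstr M.

Lemma res_morD (G H : obj GG) (a b : bgrp G H) x :
  in_hom (Sminus S) a -> in_hom (Sminus S) b ->
  bmor B (a + b) x = bmor B a x + bmor B b x.
Proof. by move=> /in_hom_minus_plus ha /in_hom_minus_plus; apply: bmorD. Qed.

Lemma res_mor_comp (G H K : obj GG) (a : bgrp G H) (b : bgrp H K) x :
  in_hom (Sminus S) a -> in_hom (Sminus S) b ->
  bmor B (bcomp a b) x = bmor B a (bmor B b x).
Proof.
by move=> /in_hom_minus_plus ha /in_hom_minus_plus; apply: bmor_comp.
Qed.

Definition res_bfun : bfun_on (Sminus S) A :=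
  BfunOn res_morD (bmor_id B) res_mor_comp.

Definition res_green_on : green_on (Sminus S) A :=
  @GreenOn _ _ _ A res_bfun (green_alg B)
    (fun H K phi i h => green_res1 B i (Sminus_plus h))
    (fun H K phi i h => green_resM B i (Sminus_plus h))
    (fun H K phi i h h' => green_frobl B i (Sminus_plus h) (Sminus_plus h'))
    (fun H K phi i h h' => green_frobr B i (Sminus_plus h) (Sminus_plus h')).

Definition res_green : green (Sminus S) R := Green res_green_on.
End Object.

Definition res_hom (M N : green (Splus S) R) (f : ghom M N) :
    ghom (res_green M) (res_green N) :=
  @Ghom _ _ _ (res_green M) (res_green N) f (gapp_linear f) (gapp1 f)
    (gappM f) (fun G H a x ha => gapp_nat f x (in_hom_minus_plus ha)).

Lemma res_hom_id M : res_hom (ghom_id M) = ghom_id (res_green M).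
Proof. exact: ghomP. Qed.

Lemma res_hom_comp M N P (g : ghom N P) (f : ghom M N) :
  res_hom (ghom_comp g f) = ghom_comp (res_hom g) (res_hom f).
Proof. exact: ghomP. Qed.

Definition Res : functor (green_cat (Splus S) R) (green_cat (Sminus S) R) :=
  @Functor (green_cat (Splus S) R) (green_cat (Sminus S) R) res_green res_hom
    res_hom_id res_hom_comp.
End Restriction.

Record gset_in (GG : gclass) (G : obj GG) := GsetIn {
  gset_of :> gset G;
  gset_inP : forall x : gset_of, gmem GG [group of 'C_G[x | gact gset_of]%g]
}.

Definition stab (gT : finGroupType) (G : {group gT}) (X : gset G) (x : X) :
  {group gT} := [group of 'C_G[x | gact X]%g].

Definition stabo (GG : gclass) (G : obj GG) (X : gset_in G) (x : X) : obj GG :=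
  Obj (gset_inP x).

Section Plus.
Variables (GG : gclass) (T : sfam GG) (R : comPzRingType).

(* Equality of elements of F(A) and F(B), where the groups A and B are equal
   but possibly not convertible; it includes the equality A = B. *)
Definition same_value (F : green T R) (A B : obj GG) (a : F A) (b : F B) :
  Prop := existT (fun A => F A : Type) A a = existT (fun A => F A : Type) B b.

Section Sections.
Variables (F : green T R) (G : obj GG).

Section OneSet.
Variable X : gset_in G.

(* s(gx) = ^g s(x); note that G_{gx} = ^g G_x. *)
Definition is_section (s : forall x : X, F (stabo x)) : Prop :=
  forall g (x : X), g \in (G : {group _}) ->
    s (g ** x) = gmor F (btrans (stabo (g ** x)) (stabo x)
                           (conjgraph_group g (stab x))) (s x).

Record gsec := Gsec {
  sec :> forall x : X, F (stabo x);
  secP : is_section sec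
}.

Lemma gsecP (s t : gsec) : (forall x, s x = t x) -> s = t.
Proof.
case: s => s hs; case: t => t ht /= e.
have {}e : s = t by apply: functional_extensionality_dep.
by subst t; congr Gsec; apply: Prop_irrelevance.
Qed.

Lemma sec_add_subproof (s t : gsec) : is_section (fun x => s x + t x).
Proof. by move=> g x gG; rewrite !secP // raddfD. Qed.
Definition sec_add (s t : gsec) : gsec := Gsec (sec_add_subproof s t).

Lemma sec_scale_subproof (r : R) (s : gsec) : is_section (fun x => r *: s x).
Proof. by move=> g x gG; rewrite !secP // linearZ. Qed.
Definition sec_scale (r : R) (s : gsec) : gsec := Gsec (sec_scale_subproof r s).
End OneSet.

Record gpair := Gpair {
  gp_set :> gset_in G;
  gp_sec : gsec gp_set
}.

Definition gamma_mor (P Q : gpair) (alpha : P -> Q) : Prop :=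
  equivariant alpha /\
  (forall x : P, stab (alpha x) = stab x /\
     same_value (gp_sec Q (alpha x)) (gp_sec P x)).

Definition ginl (X Y : gset G) (x : X) : gunion X Y := gin _ _ (inl x).
Definition ginr (X Y : gset G) (y : Y) : gunion X Y := gin _ _ (inr y).
Definition gpt (X Y : gset G) (x : X) (y : Y) : gprod X Y := gin _ _ (x, y).

(* Isomorphisms in Gamma_F(G), whose objects are the pairs (X,s), are the
   bijective morphisms.  In prel_union the section w is s |_| t. *)
Inductive prel : gpair -> seq gpair -> Prop :=
  | prel_iso (P Q : gpair) (alpha : P -> Q) :
      bijective alpha -> gamma_mor alpha ->
      prel P [:: Q]
  | prel_union (X Y : gset_in G) (s : gsec X) (t : gsec Y)
      (i : forall z : gunion X Y, gmem GG (stab z)) (w : gsec (GsetIn i)) :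
      (forall x : X, same_value (w (ginl Y x)) (s x)) ->
      (forall y : Y, same_value (w (ginr X y)) (t y)) ->
      prel (Gpair w) [:: Gpair s; Gpair t]
  | prel_add (X : gset_in G) (s u : gsec X) :
      prel (Gpair (sec_add s u)) [:: Gpair s; Gpair u].

(* F_+(G) *)
Definition plus_car := pres prel.
HB.instance Definition _ := GRing.Zmodule.on plus_car.

(* [X,s] *)
Definition psym (X : gset_in G) (s : gsec X) : plus_car := pgen prel (Gpair s).

Definition pscale_gen (r : R) (P : gpair) : plus_car :=
  psym (sec_scale r (gp_sec P)).

Lemma same_value_scale r (A B : obj GG) (a : F A) (b : F B) :
  same_value a b -> same_value (r *: a) (r *: b).
Proof.
rewrite /same_value => e.
exact: (congr1 (fun z : {A : obj GG & F A : Type} =>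
  existT (fun A => F A : Type) (projT1 z) (r *: (projT2 z : F (projT1 z)))) e).
Qed.

Lemma pscale_respects r : respects prel (pscale_gen r).
Proof.
move=> _ _ [P Q al bal [ale alv]|X Y s t i w ws wt|X s u];
  rewrite ?big_cons big_nil addr0.
- rewrite /pscale_gen /psym.
  have h : prel (Gpair (sec_scale r (gp_sec P)))
                [:: Gpair (sec_scale r (gp_sec Q))].
    apply: (@prel_iso (Gpair _) (Gpair _) al bal); split=> // x.
    by have [? ?] := alv x; split=> //; apply: same_value_scale.
  by rewrite (pgen_rel h) big_seq1.
- have h : prel (Gpair (sec_scale r w))
      [:: Gpair (sec_scale r s); Gpair (sec_scale r t)].
    by apply: prel_union => x; apply: same_value_scale.
  by rewrite /pscale_gen /psym (pgen_rel h) big_cons big_seq1.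
have h := prel_add (sec_scale r s) (sec_scale r u).
rewrite /pscale_gen /psym /=.
have -> : sec_scale r (sec_add s u) = sec_add (sec_scale r s) (sec_scale r u).
  by apply: gsecP => x /=; rewrite scalerDr.
by rewrite (pgen_rel h) big_cons big_seq1.
Qed.

(* r [X,s] = [X, r s] *)
Definition pscale (r : R) (x : plus_car) : plus_car :=
  plift (pscale_gen r) (@pscale_respects r) x.

Lemma pscale_sym r (X : gset_in G) (s : gsec X) :
  pscale r (psym s) = psym (sec_scale r s).
Proof. exact: plift_gen. Qed.

Lemma pscaleD r x y : pscale r (x + y) = pscale r x + pscale r y.
Proof. exact: pliftD. Qed.

Lemma pscaleN r x : pscale r (- x) = - pscale r x.
Proof. exact: pliftN. Qed.

Lemma pscale0 r : pscale r 0 = 0.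
Proof. exact: plift0. Qed.

Lemma pscaleA a b x : pscale a (pscale b x) = pscale (a * b) x.
Proof.
elim/pres_ind: x => [|[X s]|x y|x]; rewrite ?pscale0 //.
- rewrite -/(psym s) !pscale_sym; congr psym; apply: gsecP => x /=.
  by rewrite scalerA.
- by rewrite !pscaleD => -> ->.
- by rewrite !pscaleN => ->.
Qed.

Lemma pscale1 x : pscale 1 x = x.
Proof.
elim/pres_ind: x => [|[X s]|x y|x]; rewrite ?pscale0 //.
- rewrite -/(psym s) pscale_sym; congr psym; apply: gsecP => x /=.
  by rewrite scale1r.
- by rewrite !pscaleD => -> ->.
- by rewrite !pscaleN => ->.
Qed.

Lemma pscaleDl x a b : pscale (a + b) x = pscale a x + pscale b x.
Proof.
elim/pres_ind: x => [|[X s]|x y|x]; rewrite ?pscale0 ?addr0 //.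
- rewrite -/(psym s) !pscale_sym.
  have -> : sec_scale (a + b) s = sec_add (sec_scale a s) (sec_scale b s).
    by apply: gsecP => x /=; rewrite scalerDl.
  by rewrite /psym (pgen_rel (prel_add _ _)) big_cons big_seq1.
- by rewrite !pscaleD => -> ->; rewrite addrACA.
- by rewrite !pscaleN => ->; rewrite opprD.
Qed.

HB.instance Definition _ := GRing.Zmodule_isLmodule.Build R plus_car
  pscaleA pscale1 pscaleD pscaleDl.

End Sections.

Definition plus_mod (F : green T R) : obj GG -> lmodType R :=
  fun G => plus_car F G.

End Plus.

Section PlusFunctor.
Variables (GG : gclass) (S : sfam GG) (R : comPzRingType).

Section Formulas.
Variable F : green (Sminus S) R.
Variable P : green_on (Splus S) (plus_mod F).

(* F_+([U])([X,s]) = [U x_H X, U(s)] *)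
Definition plus_morE : Prop :=
  forall (G H : obj GG) (U : biset G H), (forall u : U, Splus S G H (stab u)) ->
  forall (X : gset_in H) (s : gsec F X),
  exists (i : forall w : tensx U X, gmem GG (stab w))
         (t : gsec F (GsetIn i)),
    (forall (u : U) (x : X),
       t (tensx_cl u x) =
       gmor F (btrans (stabo (X := GsetIn i) (tensx_cl u x)) (stabo x)
                [group of stab u :&: setX G (stab x)]) (s x)) /\
    bmor P (bcls U) (psym s) = psym t.

(* [X,s] [Y,t] = [X x Y, s x t] *)
Definition plus_mulE : Prop :=
  forall (G : obj GG) (X Y : gset_in G) (s : gsec F X) (t : gsec F Y),
  exists (i : forall z : gprod X Y, gmem GG (stab z))
         (w : gsec F (GsetIn i)),
    (forall (x : X) (y : Y),
       let Gxy := stabo (X := GsetIn i) (gpt x y) in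
       w (gpt x y) =
       gmul F (gmor F (btrans Gxy (stabo x) (Delta_group Gxy)) (s x))
              (gmor F (btrans Gxy (stabo y) (Delta_group Gxy)) (t y))) /\
    amul (green_alg P G) (psym s) (psym t) = psym w.

(* eta_G(a) = [G,a]_G, the class of the one-point G-set with value a *)
Definition is_unit (eta : ghom F (Res S R (Green P))) : Prop :=
  forall (G : obj GG) (a : F G),
  exists (i : forall z : gpoint G, gmem GG (stab z))
         (s : gsec F (GsetIn i)),
    (forall z, same_value (s z) a) /\ eta G a = psym s.
End Formulas.

(* psi_+([X,s]) = [X, psi(s)] *)
Definition plus_mapE (F F' : green (Sminus S) R)
    (P : green_on (Splus S) (plus_mod F))
    (P' : green_on (Splus S) (plus_mod F'))
    (psi : ghom F F') (psip : ghom (Green P) (Green P')) : Prop :=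
  forall (G : obj GG) (X : gset_in G) (s : gsec F X),
  exists s' : gsec F' X,
    (forall x, s' x = psi (stabo x) (s x)) /\
    psip G (psym s) = psym s'.

(* The functor -_+: the modules F_+(G) are those constructed above, and the
   remaining structure is determined on the generators [X,s] by the formulas
   (up to the irrelevant values of bmor outside D_+). *)
Record plus_functor := PlusFunctor {
  pf_green : forall F : green (Sminus S) R, green_on (Splus S) (plus_mod F);
  pf_morE : forall F, plus_morE (pf_green F);
  pf_mulE : forall F, plus_mulE (pf_green F);
  pf_map : forall F F' : green (Sminus S) R, ghom F F' ->
    ghom (Green (pf_green F)) (Green (pf_green F'));
  pf_mapE : forall (F F' : green (Sminus S) R) (psi : ghom F F'),
    plus_mapE psi (pf_map psi)
}.

Section Functor.
Variable P : plus_functor.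

Lemma plus_hom_ext (F : green (Sminus S) R) (M : green (Splus S) R)
    (f g : ghom (Green (pf_green P F)) M) :
  (forall G (X : gset_in G) (s : gsec F X), f G (psym s) = g G (psym s)) ->
  f = g.
Proof.
move=> e; apply: ghomP => G x; rewrite /= in f g e x *.
have lf : zmod_morphism (f G) by move=> a b; rewrite -scaleN1r addrC
  (gapp_linear f) scaleN1r addrC.
have lg : zmod_morphism (g G) by move=> a b; rewrite -scaleN1r addrC
  (gapp_linear g) scaleN1r addrC.
pose f' : {additive plus_car F G -> M G} :=
  HB.pack (f G : plus_car F G -> M G) (GRing.isZmodMorphism.Build _ _ _ lf).
pose g' : {additive plus_car F G -> M G} :=
  HB.pack (g G : plus_car F G -> M G) (GRing.isZmodMorphism.Build _ _ _ lg).
change (f' x = g' x); elim/pres_ind: x => [|[X s]|x y ex ey|x ex].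
- by rewrite !raddf0.
- exact: e.
- by rewrite !raddfD ex ey.
- by rewrite !raddfN ex.
Qed.

Lemma pf_map_id F : pf_map P (ghom_id F) = ghom_id (Green (pf_green P F)).
Proof.
apply: plus_hom_ext => G X s; have [s' [e ->]] := pf_mapE P (ghom_id F) s.
by congr psym; apply: gsecP.
Qed.

Lemma pf_map_comp F F' F'' (g : ghom F' F'') (f : ghom F F') :
  pf_map P (ghom_comp g f) = ghom_comp (pf_map P g) (pf_map P f).
Proof.
apply: plus_hom_ext => G X s /=.
have [t [et ->]] := pf_mapE P (ghom_comp g f) s.
have [s' [es' ->]] := pf_mapE P f s.
have [s'' [es'' ->]] := pf_mapE P g s'.
by congr psym; apply: gsecP => x; rewrite et es'' es'.
Qed.

Definition Plus : functor (green_cat (Sminus S) R) (green_cat (Splus S) R) :=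
  @Functor (green_cat (Sminus S) R) (green_cat (Splus S) R)
    (fun F => Green (pf_green P F)) (@pf_map P) pf_map_id pf_map_comp.
End Functor.

End PlusFunctor.

(* Main.v *)
Require Import Defs.
From HB Require Import structures.
From mathcomp Require Import all_boot all_fingroup all_algebra.
From mathcomp Require Import boolp.

(* Existence of F_+.  On D_- every composite of transitive bisets is again
   transitive: [G x H / D] o [H x K / E] = [G x K / D * E] as p_1(E) = H.  Hence
   F is a system of maps F(D) with F(D) F(E) = F(D * E), and every identity
   between the classes [X, s] reduces to a bijection of G-sets together with
   equalities of subgroups of the form D * E.

   Adjunction.  F_+(G) is generated by the elements F_+(ind_K^G)([K, a]_K), so a
   morphism out of F_+ is determined by its composite with eta.  Conversely psi
   extends by [X, s] |-> sum over G\X of M(ind_{G_x}^G)(psi(s(x))).  Since every D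
   in S_+(G, H) factors as ind_{p_1(D)}^G followed by a morphism of D_-, this
   extension is natural; it is multiplicative by the Frobenius relations. *)

Set Implicit Arguments.
Unset Strict Implicit.
Unset Printing Implicit Defensive.

Import GRing.Theory.
Local Open Scope ring_scope.

(** * G-sets, embeddings and disjoint unions *)

(** The main obstacle is that section values live in the dependent types F(G_x), and stabilizers
    that are equal as groups are rarely convertible. Values over different points are therefore
    compared by [same_value], and the diagonal of a group serves as transport between equal groups.
    Symbols are compared by parametrizing both underlying G-sets by one type of representatives, so
    that only stabilizers and values at representatives matter. Subgroups are described by their
    elements, which turns the composition of two maps of F into an elementary statement about pairs.
    Maps out of F_+(G) are well defined as soon as they respect abstract disjoint decompositions and
    are additive in the section. The theorem speaks about every functor satisfying the formulas on
    generators. The construction is therefore complemented by uniqueness: any such structure agrees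
    on D_+ with the constructed one, including the unit element, which no formula prescribes. *)

Section GsetMaps.
Variables (gT : finGroupType) (G : {group gT}).
Implicit Types X Y W : gset G.

Lemma in_stab X (x : X) a : (a \in stab x) = (a \in G) && (a ** x == x).
Proof. by apply/stabP/andP => -[aG /eqP]. Qed.

Lemma stab_sub X (x : X) : stab x \subset G.
Proof. by apply/subsetP=> a; rewrite in_stab => /andP[]. Qed.

Lemma lmulVK X a (x : X) : a \in G -> a^-1%g ** (a ** x) = x.
Proof. by move=> aG; rewrite -lmulM ?groupV // mulVg lmul1. Qed.

Lemma lmulKV X a (x : X) : a \in G -> a ** (a^-1%g ** x) = x.
Proof. by move=> aG; rewrite -lmulM ?groupV // mulgV lmul1. Qed.

Lemma lmul_eq X a b (x : X) : a \in G -> b \in G ->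
  (a ** x == b ** x) = ((a^-1 * b)%g \in stab x).
Proof.
move=> aG bG; rewrite in_stab groupM ?groupV //= lmulM ?groupV //.
by rewrite -[RHS](inj_eq (@lmul_inj _ _ X a)) lmulKV // eq_sym.
Qed.

(** Conjugation [A :^ a] is the right action a^-1 A a, so [:^ a^-1] is the left conjugate of G_x by
    a. *)
Lemma stab_lmul X a (x : X) : a \in G -> stab (a ** x) = (stab x :^ a^-1)%G.
Proof.
move=> aG; apply/val_inj/setP=> b; rewrite mem_conjgV [LHS]in_stab [RHS]in_stab.
rewrite groupJr //; case bG: (b \in G) => //=.
by rewrite conjgE !lmulM ?groupM ?groupV // -[RHS](inj_eq (@lmul_inj _ _ X a))
  lmulKV ?lmulM ?groupM.
Qed.

(** Injectivity makes the stabilizers of x and p(x) agree ([stab_emb]), as morphisms of Gamma_F(G)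
    require. *)
Definition gemb X Y (p : X -> Y) := injective p /\ equivariant p.

Lemma stab_emb X Y (p : X -> Y) x : gemb p -> stab (p x) = stab x.
Proof.
move=> [pi pe]; apply/val_inj/setP=> a; rewrite [LHS]in_stab [RHS]in_stab.
by case aG: (a \in G) => //=; rewrite -pe // (inj_eq pi).
Qed.

(** W as an internal disjoint union. Unlike [gunion], this also covers invariant subsets and the
    decompositions induced on products and tensor products, whose pieces are not literally
    summands. *)
Record is_union W X Y (p : X -> W) (q : Y -> W) : Prop := IsUnion {
  union_embl : gemb p;
  union_embr : gemb q;
  union_disj : forall x y, p x <> q y;
  union_cover : forall w, (exists x, p x = w) \/ (exists y, q y = w)
}.

Lemma is_union_gunion X Y :
  is_union (fun x : X => gin _ _ (inl x) : gunion X Y)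
           (fun y : Y => gin _ _ (inr y) : gunion X Y).
Proof.
split.
- split=> [x x' /(can_inj (ginK _ _))[]//|a x aG]; by rewrite ginE.
- split=> [x x' /(can_inj (ginK _ _))[]//|a x aG]; by rewrite ginE.
- by move=> x y /(can_inj (ginK _ _)).
move=> w; rewrite -(goutK w); case: (gout w) => z; [left|right]; by exists z.
Qed.

Definition gempty : gset G := @mkgset _ G void (fun _ x => x)
  (fun=> erefl) (fun _ _ _ _ _ => erefl).

Lemma gemptyF (x : gempty) : False.
Proof. by case: (gout x). Qed.

Section EmbOf.
Variables (X Y : gset G) (T : Type) (p : T -> X) (q : T -> Y).
Hypothesis psurj : forall x, exists t, p t = x.
Hypothesis pqE : forall t t', p t = p t' <-> q t = q t'.
Hypothesis pqact : forall a t, a \in G ->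
  exists t', p t' = a ** p t /\ q t' = a ** q t.

(** The map sends p(t) to q(t); [pqE] gives both its well-definedness and its injectivity. Points of
    orbit sets can thus be handled through representatives t of an arbitrary type. *)
Lemma gemb_of : exists2 f : X -> Y, gemb f & forall t, f (p t) = q t.
Proof.
pose f x := q (sval (cid (psurj x))).
have fE t : f (p t) = q t.
  by apply/pqE; rewrite (svalP (cid (psurj (p t)))).
exists f => //; split=> [x y|a x aG].
  have [t <-] := psurj x; have [t' <-] := psurj y.
  by rewrite !fE => /pqE.
have [t <-] := psurj x; have [t' [<- et']] := pqact t aG.
by rewrite !fE.
Qed.
End EmbOf.

Definition gtrans X (x0 : X) := forall x, exists2 a, a \in G & x = a ** x0.

Lemma gtrans_iso X Y (x0 : X) (y0 : Y) : gtrans x0 -> gtrans y0 ->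
  stab x0 = stab y0 -> giso X Y.
Proof.
move=> tx ty e.
have [|||f [fi fe] fE] := @gemb_of X Y {a | a \in G}
  (fun a => sval a ** x0) (fun a => sval a ** y0).
- by move=> x; have [a aG ->] := tx x; exists (exist (fun c => is_true (c \in G)) a aG).
- move=> [a aG] [b bG] /=.
  by split=> /eqP; rewrite lmul_eq // ?e -?e => h; apply/eqP; rewrite lmul_eq // ?e -?e.
- move=> b [a aG] bG; have baG : (b * a)%g \in G by rewrite groupM.
  by exists (exist (fun c => is_true (c \in G)) _ baG); rewrite /= !lmulM.
exists f => //; apply: inj_surj_bij => // y; have [a aG ->] := ty y.
by exists (a ** x0); apply: (fE (exist (fun c => is_true (c \in G)) a aG)).
Qed.

Section Sub.
Variables (X : gset G) (P : X -> bool).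
Hypothesis Pinv : forall a x, a \in G -> P (a ** x) = P x.

(** The default of [insubd] can be reached only for a outside G. *)
Definition gsub_act (a : gT) (z : {x | P x}) : {x | P x} :=
  insubd z (a ** val z).

Lemma val_gsub_act a z : a \in G -> val (gsub_act a z) = a ** val z.
Proof. by move=> aG; rewrite val_insubd Pinv // (valP z). Qed.

Lemma gsub_act1 z : gsub_act 1%g z = z.
Proof. by apply: val_inj; rewrite val_gsub_act ?lmul1. Qed.

Lemma gsub_actM : {in G &, forall a b z,
  gsub_act (a * b)%g z = gsub_act a (gsub_act b z)}.
Proof.
by move=> a b aG bG z; apply: val_inj; rewrite !val_gsub_act ?groupM ?lmulM.
Qed.

Definition gsub : gset G := mkgset gsub_act1 gsub_actM.
Definition gsubv (z : gsub) : X := val (gout z).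

Lemma gsubv_emb : gemb gsubv.
Proof.
split=> [z z' /val_inj/(can_inj (@goutK _ _ _ _ _ _))//|a z aG].
by rewrite /gsubv goutE // val_gsub_act.
Qed.

Lemma gsubvP z : P (gsubv z). Proof. exact: valP. Qed.

Lemma gsubv_surj x : P x -> exists z, gsubv z = x.
Proof. by move=> px; exists (gin _ _ (exist _ x px)); rewrite /gsubv ginK. Qed.
End Sub.

Lemma gsub_union X (P : X -> bool)
    (Pi : forall a x, a \in G -> P (a ** x) = P x)
    (nPi : forall a x, a \in G -> ~~ P (a ** x) = ~~ P x) :
  is_union (@gsubv X P Pi) (@gsubv X (fun x => ~~ P x) nPi).
Proof.
split; try exact: gsubv_emb.
  by move=> z z' e; have := gsubvP z'; rewrite -e gsubvP.
move=> x; case px: (P x); [left|right].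
  exact: gsubv_surj.
by apply: gsubv_surj; rewrite px.
Qed.

(** Strong induction on the number of points: the orbit of a chosen point is split off, and its
    complement is smaller since it misses that point. *)
Lemma gset_orbit_ind (Q : gset G -> Prop) :
  (forall X, (X -> False) -> Q X) ->
  (forall X (x0 : X), gtrans x0 -> Q X) ->
  (forall W X Y (p : X -> W) (q : Y -> W), is_union p q -> Q X -> Q Y -> Q W) ->
  forall X, Q X.
Proof.
move=> Q0 Q1 QU X; move: {2}(#|X|).+1 (ltnSn #|X|) => n.
elim: n X => // n IH X leXn.
case: (pickP (predT : pred X)) => [x0 _|X0]; last by apply: Q0 => x; have := X0 x.
pose P x := x \in [set a ** x0 | a in G].
have Pi a x : a \in G -> P (a ** x) = P x.
  move=> aG; apply/imsetP/imsetP => -[b bG e].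
    by exists (a^-1 * b)%g; rewrite ?groupM ?groupV // lmulM ?groupV // -e lmulVK.
  by exists (a * b)%g; rewrite ?groupM // lmulM // e.
have nPi a x : a \in G -> ~~ P (a ** x) = ~~ P x by move=> aG; rewrite Pi.
have Px0 : P x0 by apply/imsetP; exists 1%g; rewrite ?lmul1.
have U := gsub_union Pi nPi; apply: QU U _ _.
  have [z0 ez0] := gsubv_surj Pi Px0.
  apply: (Q1 _ z0) => z; have /imsetP[a aG e] := gsubvP z.
  exists a => //; apply: (gsubv_emb Pi).1.
  by rewrite e (gsubv_emb Pi).2 // ez0.
apply: IH; rewrite -ltnS; apply: leq_trans leXn; rewrite ltnS.
have [pi _] := gsubv_emb nPi; rewrite -(card_codom pi).
apply: proper_card; apply/properP; split; first exact/subsetP.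
exists x0 => //; apply/negP => /codomP[z e].
by have := gsubvP z; rewrite -e Px0.
Qed.

Section Cosets.
Variable D : {group gT}.

Lemma gbase_subproof : (D : {set gT}) \in lcosets D G.
Proof. by apply/lcosetsP; exists 1%g; rewrite ?lcoset1. Qed.

Definition gbase : gcosets G D :=
  gin _ _ (exist (fun A => is_true (A \in lcosets D G)) _ gbase_subproof).

Lemma gbase_trans : gtrans gbase.
Proof.
move=> z; have /lcosetsP[a aG e] := valP (gout z).
exists a => //; rewrite -(goutK z) /gbase ginE //; congr gin.
by apply: val_inj; rewrite coset_actE.
Qed.

Lemma stab_gbase : D \subset G -> stab gbase = D.
Proof.
move=> /subsetP DG; apply/val_inj/setP=> a; rewrite [LHS]in_stab.
case aG: (a \in G) => /=; last by apply/esym/negP=> /DG; rewrite aG.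
rewrite ginE // (can_eq (ginK _ _)) -val_eqE /= coset_actE //.
by apply/eqP/idP => [e|/lcoset_id//]; rewrite -e; apply: lcoset_refl.
Qed.
End Cosets.

End GsetMaps.

(** * Points of tensor products and Burnside classes *)

Section BisetAction.
Variables (gT hT : finGroupType) (G : {group gT}) (H : {group hT}).
Variables (U : biset G H) (u : U) (g : gT) (h : hT).
Hypotheses (gG : g \in G) (hH : h \in H).

Lemma lmul_pair : (g, h) ** u = (1%g, h) ** ((g, 1%g) ** u).
Proof.
rewrite -lmulM ?in_setX ?group1 ?gG ?hH //; congr lmul.
by congr (_, _); rewrite ?mulg1 ?mul1g.
Qed.

Lemma lmul_pair' : (g, h) ** u = (g, 1%g) ** ((1%g, h) ** u).
Proof.
rewrite -lmulM ?in_setX ?group1 ?gG ?hH //; congr lmul.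
by congr (_, _); rewrite ?mulg1 ?mul1g.
Qed.
End BisetAction.

Section TensorPoints.
Variables (gT hT kT : finGroupType).
Variables (G : {group gT}) (H : {group hT}) (K : {group kT}).

Section GSet.
Variables (U : biset G H) (X : gset H).

Lemma tensx_clP (u u' : U) (x x' : X) :
  tensx_cl u x = tensx_cl u' x' <->
  exists2 h, h \in H & u' = (1%g, h) ** u /\ x' = h ** x.
Proof.
split=> [/(can_inj (ginK _ _))/orbP[h hH]|[h hH [-> ->]]].
  by rewrite ginE ?in1L // => /(can_inj (ginK _ _))[-> ->]; exists h.
by congr gin; apply/orbP; exists h => //; rewrite ginE ?in1L.
Qed.

Lemma tensx_clE (u : U) (x : X) h : h \in H ->
  tensx_cl ((1%g, h) ** u) (h ** x) = tensx_cl u x.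
Proof. by move=> hH; apply/esym/tensx_clP; exists h. Qed.

Lemma tensx_cl_lmul g (u : U) (x : X) : g \in G ->
  g ** tensx_cl u x = tensx_cl ((g, 1%g) ** u) x.
Proof.
move=> gG; rewrite /tensx_cl ginE // orbit_actE // ginE ?inA1 //.
by rewrite /tensx_act /= lmul1.
Qed.

Lemma tensx_cl_surj (w : tensx U X) : exists u, exists x, tensx_cl u x = w :> tensx U X.
Proof.
have [t et] := orb_surj (gout w); exists (gout t).1, (gout t).2.
by rewrite -[RHS]goutK -et -[t in RHS]goutK; case: (gout t).
Qed.

(** An element g fixes [u,x] exactly when [gu,x] = [u,x], that is, when some h in H_x satisfies
    (g,h)u = u. *)
Lemma stab_tensx (u : U) (x : X) :
  stab (tensx_cl u x) = [group of starl (stab u) (stab x)].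
Proof.
apply/val_inj/setP=> g; rewrite [LHS]in_stab [RHS]inE.
apply/andP/existsP => [[gG]|[h /andP[]]].
  rewrite tensx_cl_lmul // => /eqP/tensx_clP[h hH [e e']].
  exists h; rewrite !in_stab in_setX gG hH /= -e' eqxx /=.
  by rewrite lmul_pair // -e.
rewrite !in_stab in_setX => /andP[hH /eqP hx] /andP[/andP[gG _] /eqP e].
by split=> //; rewrite tensx_cl_lmul // -(tensx_clE _ _ hH) hx -lmul_pair // e.
Qed.
End GSet.

Section Biset.
Variables (U : biset G H) (V : biset H K).

Definition tens_cl (u : U) (v : V) : tens U V :=
  gin _ _ (orb (gin _ _ (u, v) : tens_prod U V)).

Lemma tens_clP (u u' : U) (v v' : V) :
  tens_cl u v = tens_cl u' v' <->
  exists2 h, h \in H & u' = (1%g, h) ** u /\ v' = (h, 1%g) ** v.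
Proof.
split=> [/(can_inj (ginK _ _))/orbP[h hH]|[h hH [-> ->]]].
  by rewrite ginE ?in1L // => /(can_inj (ginK _ _))[-> ->]; exists h.
by congr gin; apply/orbP; exists h => //; rewrite ginE ?in1L.
Qed.

Lemma tens_clE (u : U) (v : V) h : h \in H ->
  tens_cl ((1%g, h) ** u) ((h, 1%g) ** v) = tens_cl u v.
Proof. by move=> hH; apply/esym/tens_clP; exists h. Qed.

Lemma tens_cl_lmul g k (u : U) (v : V) : g \in G -> k \in K ->
  (g, k) ** tens_cl u v = tens_cl ((g, 1%g) ** u) ((1%g, k) ** v).
Proof.
move=> gG kK; have gk : (g, k) \in setX_group G K by rewrite in_setX gG.
by rewrite /tens_cl ginE // orbit_actE // ginE // in_setX group1 gk.
Qed.

Lemma tens_cl_surj (w : tens U V) : exists u, exists v, tens_cl u v = w :> tens U V.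
Proof.
have [t et] := orb_surj (gout w); exists (gout t).1, (gout t).2.
by rewrite -[RHS]goutK -et -[t in RHS]goutK; case: (gout t).
Qed.

Lemma stab_tens (u : U) (v : V) :
  stab (tens_cl u v) = [group of star (stab u) (stab v)].
Proof.
apply/val_inj/setP=> -[g k]; rewrite [LHS]in_stab [RHS]inE in_setX /=.
apply/andP/existsP => [[/andP[gG kK]]|[h /andP[]]].
  rewrite tens_cl_lmul // => /eqP/tens_clP[h hH [e e']].
  exists h; rewrite !in_stab !in_setX gG hH kK /= lmul_pair // -e.
  by rewrite lmul_pair' // -e' !eqxx.
rewrite !in_stab !in_setX /= => /andP[/andP[gG hH] /eqP e] /andP[/andP[_ kK] /eqP e'].
split; first exact/andP.
by rewrite tens_cl_lmul // -(tens_clE _ _ hH) -lmul_pair // -lmul_pair' // e e'.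
Qed.
End Biset.
End TensorPoints.

(* An isomorphism X -> W is the case of an empty Y in [is_union], so additivity
   under [is_union] implies both kinds of relations. *)
Section AdditiveBurnside.
Variables (gT : finGroupType) (G : {group gT}) (A : zmodType) (f : gset G -> A).
Hypothesis fU : forall (W X Y : gset G) (p : X -> W) (q : Y -> W),
  is_union p q -> f W = f X + f Y.

(** An empty X is the disjoint union of two copies of itself, so f(X) = f(X) + f(X). *)
Lemma union_additive_empty (X : gset G) : (X -> False) -> f X = 0.
Proof.
move=> X0; have /fU/eqP : @is_union _ _ X X X id id; last first.
  by rewrite addrC -subr_eq subrr eq_sym => /eqP.
by split; try split; do ?move=> ?; case: X0.
Qed.

Lemma union_additive_iso (X Y : gset G) : giso X Y -> f X = f Y.
Proof.
move=> [h [h' hK h'K] he]; rewrite -[RHS]addr0.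
rewrite -(@union_additive_empty (gempty G)); last exact: gemptyF.
apply/esym; rewrite -(@fU X Y (gempty G) h' (fun z => False_rect _ (gemptyF z))) //.
have [e' ei] : equivariant h' /\ injective h'.
  split; last exact: can_inj h'K.
  by move=> a x aG; rewrite -{1}(h'K x) -he // hK.
split=> //; first by split=> [z|a z]; case: (gemptyF z).
- by move=> x y; case: (gemptyF y).
- by move=> w; left; exists (h w).
Qed.

Lemma brel_union_respects : respects (@brel _ G) f.
Proof.
move=> _ _ [X Y /union_additive_iso|X Y]; first by rewrite big_seq1.
by rewrite big_cons big_seq1; apply: fU; apply: is_union_gunion.
Qed.
End AdditiveBurnside.

Section BurnsideClasses.
Variables (gT hT : finGroupType) (G : {group gT}) (H : {group hT}).

Lemma bcls_is_union (W X Y : biset G H) (p : X -> W) (q : Y -> W) :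
  is_union p q -> bcls W = bcls X + bcls Y.
Proof.
move=> [[pi pe] [qi qe] dis cov]; rewrite -bcls_union; apply/bcls_iso/giso_sym.
pose f (z : gunion X Y) := match gout z with inl x => p x | inr y => q y end.
exists f.
  apply: inj_surj_bij => [z z'|w].
    rewrite /f => e; apply: (can_inj (@goutK _ _ _ _ _ _)); move: e.
    case: (gout z) (gout z') => [x|x] [y|y].
    + by move=> /pi ->.
    + by move=> /dis.
    + by move=> /esym /dis.
    + by move=> /qi ->.
  case: (cov w) => -[x <-].
    by exists (gin _ _ (inl x)); rewrite /f ginK.
  by exists (gin _ _ (inr x)); rewrite /f ginK.
by move=> a z aG; rewrite /f goutE //; case: (gout z) => x /=; rewrite ?pe ?qe.
Qed.

Lemma bcls_trans (X : biset G H) (x0 : X) : gtrans x0 ->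
  bcls X = btrans G H (stab x0).
Proof.
move=> tx; apply: bcls_iso.
apply: (gtrans_iso tx (@gbase_trans _ (setX_group G H) (stab x0))).
by rewrite stab_gbase // stab_sub.
Qed.

(** The point x^-1 D of the coset set has stabilizer [D :^ x], and any point of a transitive set can
    serve as base point. *)
Lemma btrans_conj (D : {group gT * hT}) x : D \subset setX G H ->
  x \in setX G H -> btrans G H (D :^ x)%G = btrans G H D.
Proof.
move=> sD xGH; have xV : (x^-1)%g \in setX_group G H by rewrite groupV.
pose y := x^-1%g ** gbase (setX_group G H) D.
have e : stab y = (D :^ x)%G.
  by rewrite /y stab_lmul // stab_gbase // invgK.
rewrite -e -(@bcls_trans _ y) // => z.
have [a aG ->] := gbase_trans z.
exists (a * x)%g; first by rewrite groupM.
by rewrite lmulM // /y lmulKV.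
Qed.

End BurnsideClasses.

(** The regular biset is transitive, and (a,b) fixes 1 exactly when a = b. *)
Lemma bid_Delta (gT : finGroupType) (G : {group gT}) :
  bid G = btrans G G (Delta_group G).
Proof.
pose o : reg_biset G := gin _ _ (1%g : subg_of G).
have to : gtrans o.
  move=> z; exists (sgval (gout z), 1%g); first by rewrite in_setX subgP group1.
  rewrite -[LHS]goutK /o ginE; last by rewrite in_setX subgP group1.
  by congr gin; rewrite /reg_act /= invg1 !mulg1 sgvalK.
rewrite /bid (bcls_trans to); congr btrans; apply/val_inj/setP=> -[a b].
rewrite [LHS]in_stab; apply/andP/imsetP => [[ab /eqP]|[c cG [-> ->]]].
  rewrite ginE // => /(can_inj (ginK _ _)) /(congr1 val) /=.
  case/setXP: ab => aG bG.
  rewrite /reg_act /= mulg1 subgK ?groupM ?groupV // => e; exists b => //.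
  by congr (_, _); rewrite -(mulgKV b a) e mul1g.
have cc : (c, c) \in setX_group G G by rewrite in_setX cG.
split=> //; rewrite ginE //; apply/eqP; congr gin; apply: val_inj => /=.
by rewrite /reg_act /= mulg1 mulgV subgK.
Qed.

Section Star.
Variables (gT hT kT : finGroupType).
Variables (G : {group gT}) (H : {group hT}) (K : {group kT}).
Variables (D : {group gT * hT}) (E : {group hT * kT}).

Lemma mem_p1 (a : gT) : reflect (exists b, (a, b) \in D) (a \in p1 D).
Proof.
apply: (iffP morphimP) => [[[x y] _ xyD /= ->]|[b abD]]; first by exists y.
by exists (a, b); rewrite ?inE.
Qed.

Lemma bcomp_btrans : D \subset setX G H -> E \subset setX H K ->
  (forall h, h \in H -> exists k, (h, k) \in E) ->
  bcomp (btrans G H D) (btrans H K E) = btrans G K (star_group D E).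
Proof.
move=> sD sE pE; rewrite bcompE.
pose u0 := gbase (setX_group G H) D; pose v0 := gbase (setX_group H K) E.
have t : gtrans (tens_cl u0 v0).
  move=> w; have [u [v <-]] := tens_cl_surj w.
  have [[g h] /setXP[gG hH] ->] := gbase_trans u.
  have [[h' k] /setXP[hH' kK] ->] := gbase_trans v.
  (* As (h'^-1 h, k') fixes [v0], moving h across the tensor product turns (h',k) v0 into (h^-1 h',
     k) v0 = (1, k k') v0. The surjectivity of E onto H enters here. *)
  have [k' hkE] := pE _ (groupM (groupVr hH') hH).
  have /setXP[_ kK'] := subsetP sE _ hkE.
  exists (g, k * k')%g; first by rewrite in_setX gG groupM.
  rewrite tens_cl_lmul ?groupM //; apply/tens_clP.
  exists h^-1%g; first by rewrite groupV.
  split.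
    rewrite -/u0 -lmulM ?in_setX ?group1 ?groupV ?gG ?hH //.
    by congr lmul; congr (_, _); rewrite ?mul1g ?mulVg.
  have m1 : (1, k * k')%g \in setX_group H K by rewrite in_setX group1 groupM.
  have m2 : (h^-1, 1)%g \in setX_group H K by rewrite in_setX group1 groupV hH.
  have m3 : (h', k) \in setX_group H K by rewrite in_setX hH' kK.
  rewrite -/v0 -lmulM //; apply/eqP; rewrite lmul_eq // ?(groupM m2 m3) //.
  rewrite stab_gbase //.
  set z := (_ * _)%g; have -> : z = (h'^-1 * h, k')^-1%g; last by rewrite groupV.
  by congr (_, _); rewrite /= ?invMg ?invgK ?invg1 ?mul1g ?mulgK ?mulgA ?mulgKV.
by rewrite (bcls_trans t) stab_tens !stab_gbase.
Qed.

End Star.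

(** * Closure properties of the families of subgroups *)

Section BilinearLift.
Variables (T1 T2 : Type) (rel1 : T1 -> seq T1 -> Prop).
Variables (rel2 : T2 -> seq T2 -> Prop) (A : zmodType) (f : T1 -> T2 -> A).
Hypothesis fl : forall t2, respects rel1 (f^~ t2).
Hypothesis fr : forall t1, respects rel2 (f t1).

Lemma plift2_respects (y : pres rel2) : respects rel1 (fun t => plift (f t) (fr t) y).
Proof.
move=> t ts r; elim/pres_ind: y => [|u|x y ex ey|x ex].
- by rewrite plift0 big1 // => u _; rewrite plift0.
- by rewrite plift_gen (fl u r); apply: eq_bigr => v _; rewrite plift_gen.
- by rewrite pliftD ex ey -big_split /=; apply: eq_bigr => v _; rewrite pliftD.
- by rewrite pliftN ex -sumrN; apply: eq_bigr => v _; rewrite pliftN.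
Qed.

Definition plift2 (x : pres rel1) (y : pres rel2) : A :=
  plift _ (plift2_respects y) x.

Lemma plift2_gen t u : plift2 (pgen _ t) (pgen _ u) = f t u.
Proof. by rewrite /plift2 !plift_gen. Qed.

Lemma plift2Dl x x' y : plift2 (x + x') y = plift2 x y + plift2 x' y.
Proof. exact: pliftD. Qed.

Lemma plift2Nl x y : plift2 (- x) y = - plift2 x y.
Proof. exact: pliftN. Qed.

Lemma plift20l y : plift2 0 y = 0.
Proof. exact: plift0. Qed.

(** The lift is taken in the first variable for fixed y, so additivity in y requires an induction on
    x. *)
Lemma plift2Dr x y y' : plift2 x (y + y') = plift2 x y + plift2 x y'.
Proof.
elim/pres_ind: x => [|t|x x' ex ex'|x ex].
- by rewrite !plift20l addr0.
- by rewrite /plift2 !plift_gen pliftD.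
- by rewrite !plift2Dl ex ex' addrACA.
- by rewrite !plift2Nl ex opprD.
Qed.

Lemma plift20r x : plift2 x 0 = 0.
Proof. by apply: (addrI (plift2 x 0)); rewrite -plift2Dr !addr0. Qed.

Lemma plift2Nr x y : plift2 x (- y) = - plift2 x y.
Proof. by apply/eqP; rewrite -addr_eq0 -plift2Dr addNr plift20r. Qed.
End BilinearLift.

Section BisetCompositionAdditive.
Variables (gT hT kT : finGroupType).
Variables (G : {group gT}) (H : {group hT}) (K : {group kT}).
Implicit Types (a : bgrp G H) (b : bgrp H K).

Lemma bcompDl a a' b : bcomp (a + a') b = bcomp a b + bcomp a' b.
Proof. exact: pliftD. Qed.

Lemma bcompNl a b : bcomp (- a) b = - bcomp a b.
Proof. exact: pliftN. Qed.

Lemma bcomp0l b : bcomp (0 : bgrp G H) b = 0.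
Proof. exact: plift0. Qed.

Lemma bcompDr a b b' : bcomp a (b + b') = bcomp a b + bcomp a b'.
Proof.
elim/pres_ind: a => [|U|x y ex ey|x ex].
- by rewrite !bcomp0l addr0.
- by rewrite /bcomp !plift_gen /bcompl pliftD.
- by rewrite !bcompDl ex ey addrACA.
- by rewrite !bcompNl ex opprD.
Qed.

Lemma bcomp0r a : bcomp a (0 : bgrp H K) = 0.
Proof. by apply: (addrI (bcomp a 0)); rewrite -bcompDr !addr0. Qed.

Lemma bcompNr a b : bcomp a (- b) = - bcomp a b.
Proof. by apply/eqP; rewrite -addr_eq0 -bcompDr addNr bcomp0r. Qed.
End BisetCompositionAdditive.

(** * Morphism groups of the subcategories *)

Section HomGroup.
Variables (GG : gclass) (T : sfam GG) (G H : obj GG).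
Implicit Types a b : bgrp G H.

Lemma in_homN a : in_hom T a -> in_hom T (- a).
Proof. by move=> ha; rewrite -sub0r; apply: in_homB => //; apply: in_hom0. Qed.

Lemma in_homD a b : in_hom T a -> in_hom T b -> in_hom T (a + b).
Proof. by move=> ha /in_homN; rewrite -{2}[b]opprK; apply: in_homB. Qed.

(** Orbit by orbit, [U] is a sum of classes of the form [(G x H)/(G x H)_u]. *)
Lemma in_hom_bcls (U : biset G H) :
  (forall u : U, T G H (stab u)) -> in_hom T (bcls U).
Proof.
elim/gset_orbit_ind: U => [X X0 _|X x0 tx hX|W X Y p q u hX hY hW].
- rewrite (_ : bcls X = 0); first exact: in_hom0.
  apply: (union_additive_empty _ X0) => W X' Y p q.
  exact: bcls_is_union.
- by rewrite (bcls_trans tx); apply: in_hom_gen.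
rewrite (bcls_is_union u); have [pe qe _ _] := u; apply: in_homD.
  by apply: hX => x; rewrite -(stab_emb x pe).
by apply: hY => y; rewrite -(stab_emb y qe).
Qed.
End HomGroup.

(** No double coset formula is involved: the stabilizer of a point of the tensor product is a star
    of conjugates of D and E, and [in_hom_bcls] asks for nothing else. *)
Lemma in_hom_bcomp (GG : gclass) (T : sfam GG) (G H K : obj GG) (a : bgrp G H)
    (b : bgrp H K) :
  (forall (D : {group ogT G * ogT H}) (x : ogT G * ogT H),
     T G H D -> x \in setX G H -> T G H (D :^ x)%G) ->
  (forall (D : {group ogT H * ogT K}) (x : ogT H * ogT K),
     T H K D -> x \in setX H K -> T H K (D :^ x)%G) ->
  (forall (D : {group ogT G * ogT H}) (E : {group ogT H * ogT K}),
     T G H D -> T H K E -> T G K (star_group D E)) ->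
  in_hom T a -> in_hom T b -> in_hom T (bcomp a b).
Proof.
move=> cl1 cl2 st ha; elim: ha b => [|a1 a2 _ IH1 _ IH2|D TD] b hb.
- by rewrite bcomp0l; apply: in_hom0.
- by rewrite bcompDl bcompNl; apply: in_homB; [apply: IH1|apply: IH2].
elim: hb => [|b1 b2 _ IH1 _ IH2|E TE].
- by rewrite bcomp0r; apply: in_hom0.
- by rewrite bcompDr bcompNr; apply: in_homB.
rewrite bcompE; apply: in_hom_bcls => w.
have [u [v <-]] := tens_cl_surj w; rewrite stab_tens.
have [x xGH ->] := gbase_trans u; have [y yHK ->] := gbase_trans v.
rewrite !stab_lmul // !stab_gbase ?(smem_sub TD) ?(smem_sub TE) //.
by apply: st; [apply: cl1|apply: cl2]; rewrite // groupV.
Qed.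

(** * Consequences of the axioms for S, S_- and S_+ *)

Section Closure.
Variables (GG : gclass) (S : sfam GG).
Hypothesis hS : axioms S.

Lemma mem_Delta (gT : finGroupType) (K : {group gT}) a b :
  (a, b) \in Delta K = (a == b) && (a \in K).
Proof.
apply/imsetP/andP => [[c cK [-> ->]]|[/eqP <- aK]]; first by [].
by exists a.
Qed.

Lemma mem_conjgraph (gT : finGroupType) (g : gT) (K : {group gT}) a b :
  (a, b) \in conjgraph g K = (b \in K) && (a == b ^ g^-1)%g.
Proof.
apply/imsetP/andP => [[c cK [-> ->]]|[aK /eqP ->]]; first by [].
by exists b.
Qed.

Lemma mem_conj_pair (gT hT : finGroupType) (D : {set gT * hT}) g h a b :
  ((a, b) \in D :^ (g, h))%g = ((a ^ g^-1, b ^ h^-1)%g \in D).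
Proof. by rewrite mem_conjg !conjgE. Qed.

Lemma mem_stab_lmul (gT hT : finGroupType) (G : {group gT}) (H : {group hT})
    (U : biset G H) (u : U) g h a b : g \in G -> h \in H ->
  ((a, b) \in stab ((g, h) ** u)) = ((a ^ g, b ^ h)%g \in stab u).
Proof.
move=> gG hH; rewrite stab_lmul; last by rewrite in_setX gG.
by rewrite mem_conjgV !conjgE.
Qed.

Lemma mem_starl (gT hT : finGroupType) (D : {set gT * hT}) (K : {set hT}) a :
  reflect (exists2 k, k \in K & (a, k) \in D) (a \in starl D K).
Proof. by rewrite inE; apply: (iffP (exists_inP)). Qed.

Lemma mem_star (gT hT kT : finGroupType) (D : {set gT * hT})
    (E : {set hT * kT}) a c :
  reflect (exists2 b, (a, b) \in D & (b, c) \in E) ((a, c) \in star D E).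
Proof.
rewrite inE /=; apply: (iffP existsP) => [[b /andP[]]|[b d e]]; exists b => //.
exact/andP.
Qed.

Lemma Obj_S (gT : finGroupType) (K L : {group gT}) pK pL (H : obj GG)
    (D : {group gT * ogT H}) :
  K = L -> S (@Obj GG gT K pK) H D -> S (@Obj GG gT L pL) H D.
Proof. by move=> e; subst L; rewrite (Prop_irrelevance pK pL). Qed.

Lemma gmem_set (gT : finGroupType) (K L : {group gT}) :
  gmem GG K -> (K : {set gT}) = L -> gmem GG L.
Proof. by move=> pK /val_inj <-. Qed.

Lemma S_set (G H : obj GG) (D E : {group ogT G * ogT H}) :
  S G H D -> (D : {set _}) = E -> S G H E.
Proof. by move=> SD /val_inj <-. Qed.

Lemma Splus_gmem (G H : obj GG) (D : {group ogT G * ogT H}) (K : {group ogT H}) :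
  Splus S G H D -> K \subset H -> gmem GG K -> gmem GG [group of starl D K].
Proof. by move=> [_ [p SD]] sK pK; have [] := ax_iv hS pK SD sK. Qed.

(** The intersection E of D with L x K equals Delta(L) * (D * Delta(K)): axiom (iv) supplies the
    right factor, axiom (vi) the left one, axiom (iii) the composite. Since L lies in D * K, the
    projection p_1(E) is all of L. *)
Lemma Sminus_sub_restr (G H : obj GG) (D E : {group ogT G * ogT H})
    (L : {group ogT G}) (K : {group ogT H}) pL pK :
  S G H D -> K \subset H -> L \subset starl D K ->
  (forall a b, (a, b) \in E = [&& a \in L, b \in K & (a, b) \in D]) ->
  Sminus S (@Obj GG _ L pL) (@Obj GG _ K pK) E.
Proof.
move=> SD sK sL EE; split.
  have [pDK SDK] := ax_iv hS pK SD sK.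
  have SL := ax_vi hS (G := Obj pDK) pL sL.
  have := ax_iii hS SL SDK; move/S_set; apply.
  apply/setP=> -[a b]; apply/mem_star/idP => [[c] | ].
    rewrite mem_Delta => /andP[/eqP <- aL] /mem_star[k aD].
    by rewrite mem_Delta EE aL => /andP[/eqP <- ->].
  rewrite EE => /and3P[aL bK abD]; exists a; first by rewrite mem_Delta eqxx.
  by apply/mem_star; exists b; rewrite // mem_Delta eqxx.
apply/val_inj/setP=> a; apply/mem_p1/idP => [[b]|aL].
  by rewrite EE => /and3P[].
by have /mem_starl[b bK abD] := subsetP sL _ aL; exists b; rewrite EE aL bK.
Qed.

Lemma Splus_restr (G H : obj GG) (D E : {group ogT G * ogT H})
    (L : {group ogT G}) (K : {group ogT H}) pL pK :
  Splus S G H D -> K \subset H -> L \subset starl D K ->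
  (forall a b, (a, b) \in E = [&& a \in L, b \in K & (a, b) \in D]) ->
  Sminus S (@Obj GG _ L pL) (@Obj GG _ K pK) E.
Proof. by move=> [_ [p SD]]; apply: (Sminus_sub_restr (G := Obj p)). Qed.

Lemma Sminus_Delta (gT : finGroupType) (L K : {group gT}) pL pK :
  L \subset K -> Sminus S (@Obj GG gT L pL) (@Obj GG gT K pK) (Delta_group L).
Proof.
move=> sL; split; first exact: (ax_vi hS (G := Obj pK)).
apply/val_inj/setP=> a; apply/mem_p1/idP => [[b]|aL].
  by rewrite mem_Delta => /andP[].
by exists a; rewrite mem_Delta eqxx.
Qed.

Lemma Sminus_id (G : obj GG) : Sminus S G G (Delta_group G).
Proof.
split; first exact: (ax_i hS).
apply/val_inj/setP=> a; apply/mem_p1/idP => [[b]|aG].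
  by rewrite mem_Delta => /andP[].
by exists a; rewrite mem_Delta eqxx.
Qed.

Lemma Delta_conj (gT : finGroupType) (G : {group gT}) g :
  (Delta_group G :^ (g^-1, 1))%g = conjgraph g G.
Proof.
apply/setP=> -[a b]; rewrite mem_conj_pair mem_conjgraph.
rewrite invgK invg1 conjg1 mem_Delta; apply/andP/andP => [[/eqP <- h]|[bG /eqP ->]].
  by rewrite h -conjgM mulgV conjg1.
by rewrite -conjgM mulVg conjg1.
Qed.

(** By [Delta_conj] the graph of conjugation by g is a G x G-conjugate of Delta(G), so axioms (i)
    and (ii) apply. *)
Lemma S_conjgraph (G : obj GG) g : g \in (G : {group _}) ->
  S G G (conjgraph_group g G).
Proof.
move=> gG; have := ax_ii hS (ax_i hS G) (x := (g^-1, 1)%g).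
rewrite in_setX groupV gG group1 => /(_ isT). move/S_set; apply.
exact: Delta_conj.
Qed.

(** E is prescribed only as a set: below it is [Delta_group G], with K the stabilizer of the point
    of a one-point G-set. *)
Lemma Sminus_DeltaG (G : obj GG) (K : {group ogT G}) (pK : gmem GG K)
    (E : {group ogT G * ogT G}) :
  K \subset G -> (E : {set _}) = Delta K -> Sminus S (Obj pK) G E.
Proof.
move=> sK /(@val_inj _ _ _ E (Delta_group K)) ->; split; first exact: ax_vi.
apply/val_inj/setP=> a; apply/mem_p1/idP => [[b]|aG].
  by rewrite mem_Delta => /andP[].
by exists a; rewrite mem_Delta eqxx.
Qed.

(** The conjugate of K by g is the star of the conjugation graph with K, and axiom (iv) puts it in
    the class. *)
Lemma gmem_conj (G : obj GG) g (K : {group ogT G}) : g \in (G : {group _}) ->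
  K \subset G -> gmem GG K -> gmem GG (K :^ g^-1)%G.
Proof.
move=> gG sK pK; have [p _] := ax_iv hS pK (S_conjgraph gG) sK.
apply: (gmem_set p); apply/setP=> a; rewrite mem_conjgV.
apply/mem_starl/idP => [[k kK]|aK].
  by rewrite mem_conjgraph => /andP[_ /eqP ->]; rewrite -conjgM mulVg conjg1.
exists (a ^ g)%g; rewrite // mem_conjgraph (subsetP sK) //=.
by rewrite -conjgM mulgV conjg1.
Qed.

Lemma Sminus_conjgraph (G : obj GG) g (L K : {group ogT G}) pL pK :
  g \in (G : {group _}) -> K \subset G -> L = (K :^ g^-1)%G ->
  Sminus S (@Obj GG _ L pL) (@Obj GG _ K pK) (conjgraph_group g K).
Proof.
move=> gG sK eL; apply: (Sminus_sub_restr _ _ (S_conjgraph gG) sK).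
  apply/subsetP=> a; rewrite eL mem_conjgV => aK; apply/mem_starl.
  exists (a ^ g)%g; rewrite // mem_conjgraph (subsetP sK) //=.
  by rewrite -conjgM mulgV conjg1.
move=> a b; rewrite !mem_conjgraph eL mem_conjgV.
apply/andP/and3P => [[bK /eqP ->]|[_ -> /andP[]//]].
by rewrite eqxx (subsetP sK) // -conjgM mulVg conjg1.
Qed.

(** The intersection is Delta(K) * L, where Delta(K) lies in S(K,G) by axiom (vi); axiom (iv)
    applies. Stabilizers in product sets are such intersections. *)
Lemma gmem_setI (G : obj GG) (K L : {group ogT G}) : K \subset G -> L \subset G ->
  gmem GG K -> gmem GG L -> gmem GG (K :&: L)%G.
Proof.
move=> sK sL pK pL; have [p _] := ax_iv hS pL (ax_vi hS pK sK) sL.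
apply: (gmem_set p); apply/setP=> a; rewrite in_setI.
apply/mem_starl/andP => [[k kL]|[aK aL]].
  by rewrite mem_Delta => /andP[/eqP -> ->].
by exists a; rewrite // mem_Delta eqxx.
Qed.

Lemma Splus_Delta (G : obj GG) (K : {group ogT G}) (pK : gmem GG K) :
  K \subset G -> Splus S G (Obj pK) (Delta_group K).
Proof.
move=> sK; have [SD e] := Sminus_Delta pK pK (subxx K).
split; last by rewrite e; exists pK.
by apply: (subset_trans (smem_sub SD)); apply/subsetP=> -[a b];
  rewrite !in_setX /= => /andP[/(subsetP sK) -> ->].
Qed.

(** Put Q = p_1(E). Then p_1(D * E) = D * Q is in the class by axiom (iv), and D * E is the
    composite of D * Delta(Q) and E, both of which belong to S. *)
Lemma Splus_star (G H K : obj GG) (D : {group ogT G * ogT H})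
    (E : {group ogT H * ogT K}) :
  Splus S G H D -> Splus S H K E -> Splus S G K (star_group D E).
Proof.
move=> PD PE; have [sD [p SD]] := PD; have [sE [q SE]] := PE; split.
  apply/subsetP=> -[a c] /mem_star[b /(subsetP sD) + /(subsetP sE)].
  by rewrite !in_setX /= => /andP[-> _] /andP[_ ->].
have sq : p1 E \subset H.
  by apply/subsetP=> b /mem_p1[c /(subsetP sE)]; rewrite in_setX => /andP[].
have [r Sr] := ax_iv hS q SD sq.
have e : p1 (star_group D E) = [group of starl D (p1 E)].
  apply/val_inj/setP=> a; apply/mem_p1/mem_starl.
    by move=> [c /mem_star[b abD bcE]]; exists b => //; apply/mem_p1; exists c.
  by move=> [b /mem_p1[c bcE] abD]; exists c; apply/mem_star; exists b.
have r' : gmem GG (p1 (star_group D E)) by rewrite e.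
exists r'; apply: (Obj_S (pK := r) _ (esym e)).
have := ax_iii hS Sr SE; move/S_set; apply.
apply/setP=> -[a c]; apply/mem_star/mem_star => -[b].
  by move=> /mem_star[b' abD]; rewrite mem_Delta => /andP[/eqP <- _]; exists b'.
move=> abD bcE; exists b => //; apply/mem_star; exists b => //.
by rewrite mem_Delta eqxx; apply/mem_p1; exists c.
Qed.

(** Axiom (ii) covers conjugation by elements of p_1(D) x H, while g may move p_1(D). Conjugation on
    the left is instead a composition with a conjugation graph, which replaces p_1(D) by its
    conjugate. *)
Lemma Splus_conj (G H : obj GG) (D : {group ogT G * ogT H}) x :
  Splus S G H D -> x \in setX G H -> Splus S G H (D :^ x)%G.
Proof.
case: x => g h [sD [p SD]] xGH; have /setXP[/= gG hH] := xGH; split.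
  by rewrite -(conjSg _ _ (g, h)) in sD *; rewrite (conjGid xGH) in sD.
have sp : p1 D \subset G.
  by apply/subsetP=> a /mem_p1[b /(subsetP sD)]; rewrite in_setX => /andP[].
have gV : (g^-1)%g \in (G : {group _}) by rewrite groupV.
have q := gmem_conj gV sp p.
have [S1 _] := Sminus_conjgraph q p gV sp erefl.
have S2 := ax_ii hS SD (x := (1, h)%g).
rewrite in_setX group1 hH in S2; have {}S2 := S2 isT.
have S3 := ax_iii hS S1 S2.
have e2 : star_group (conjgraph_group g^-1%g (p1 D)) (D :^ (1%g, h))%G = (D :^ (g, h))%G.
  apply/val_inj/setP=> -[a b]; rewrite mem_conj_pair.
  apply/mem_star/idP => [[c]|abD].
    rewrite mem_conjgraph invgK mem_conj_pair invg1 conjg1 => /andP[cD /eqP ->].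
    by rewrite -conjgM mulgV conjg1.
  exists (a ^ g^-1)%g.
    rewrite mem_conjgraph invgK -conjgM mulVg conjg1 eqxx andbT.
    by apply/mem_p1; exists (b ^ h^-1)%g.
  by rewrite mem_conj_pair invg1 conjg1.
have e : p1 (D :^ (g, h))%G = (p1 D :^ g^-1^-1)%G.
  apply/val_inj/setP=> a; rewrite mem_conjgV; apply/mem_p1/mem_p1 => -[b].
    by rewrite mem_conj_pair; exists (b ^ h^-1)%g.
  move=> abD; exists (b ^ h)%g; rewrite mem_conj_pair.
  by rewrite -[b in (_, b)]conjg1 -(mulgV h) conjgM in abD.
have r : gmem GG (p1 (D :^ (g, h))%G) by rewrite e.
exists r; apply: (Obj_S (pK := q) _ (esym e)).
by rewrite -e2.
Qed.

Lemma Sminus_mem1 (G H : obj GG) (D : {group ogT G * ogT H}) a :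
  Sminus S G H D -> a \in (G : {group _}) -> exists b, (a, b) \in D.
Proof. by move=> [_ e]; rewrite -e => /mem_p1. Qed.
End Closure.

(** * Values, sections and symbols *)

Section Values.
Variables (GG : gclass) (T : sfam GG) (R : comPzRingType) (F : green T R).

Lemma gmor_eq (A B : obj GG) (D E : {group ogT A * ogT B}) x :
  (forall a b, ((a, b) \in D) = ((a, b) \in E)) ->
  gmor F (btrans A B D) x = gmor F (btrans A B E) x.
Proof. by move=> e; have -> : D = E by apply/val_inj/setP=> -[a b]. Qed.

(** [D'] is D * E, specified by its elements; the third hypothesis says p_1(E) = B, which makes the
    composite transitive. *)
Lemma gmor_star (A B C : obj GG) (D : {group ogT A * ogT B})
    (E : {group ogT B * ogT C}) (D' : {group ogT A * ogT C}) x :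
  T A B D -> T B C E ->
  (forall b, b \in (B : {group _}) -> exists c, (b, c) \in E) ->
  (forall a c, (a, c) \in D' <-> exists2 b, (a, b) \in D & (b, c) \in E) ->
  gmor F (btrans A B D) (gmor F (btrans B C E) x) = gmor F (btrans A C D') x.
Proof.
move=> TD TE pE DE.
rewrite /gmor -bmor_comp; try exact: in_hom_gen.
rewrite bcomp_btrans ?(smem_sub TD) ?(smem_sub TE) //.
by apply: gmor_eq => a c; apply/mem_star/idP => /DE.
Qed.

Lemma gmor_Delta (A : obj GG) (D : {group ogT A * ogT A}) x :
  (forall a b, ((a, b) \in D) = (a == b) && (a \in (A : {group _}))) ->
  gmor F (btrans A A D) x = x.
Proof.
move=> DE; rewrite -[RHS](bmor_id (gstr F)) bid_Delta; apply: gmor_eq => a b.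
by rewrite DE mem_Delta.
Qed.

Lemma sv_inj (A : obj GG) (a b : F A) : same_value a b -> a = b.
Proof.
rewrite /same_value => e.
(* The second component is cast to F(A) whenever the first one equals A; otherwise the default a is
   returned. *)
pose f (z : {A : obj GG & F A : Type}) :=
  if pselect (projT1 z = A) is left h
  then eq_rect _ (fun A => F A : Type) (projT2 z) _ h else a.
have {}e : f (existT _ A a) = f (existT _ A b) by rewrite e.
move: e; rewrite /f; case: pselect => //= h.
by rewrite (Prop_irrelevance h erefl).
Qed.

Lemma sv_elim (gT : finGroupType) (K L : {group gT}) pK pL
    (a : F (Obj pK)) (b : F (Obj pL))
    (Q : forall (L : {group gT}) (pL : gmem GG L), F (Obj pL) -> Prop) :
  K = L -> same_value a b -> Q K pK a -> Q L pL b.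
Proof.
move=> e; subst L; rewrite (Prop_irrelevance pL pK) in b * => e.
by rewrite (sv_inj e).
Qed.

Lemma sv_gmor (gT hT : finGroupType) (K L : {group gT}) pK pL
    (K' L' : {group hT}) pK' pL' (D E : {group gT * hT})
    (a : F (@Obj GG _ K' pK')) (b : F (@Obj GG _ L' pL')) :
  K = L -> K' = L' -> (forall x y, ((x, y) \in D) = ((x, y) \in E)) ->
  same_value a b ->
  same_value (gmor F (btrans (@Obj GG _ K pK) (Obj pK') D) a)
             (gmor F (btrans (@Obj GG _ L pL) (Obj pL') E) b).
Proof.
move=> e e' eD; subst L L'; rewrite (Prop_irrelevance pL pK).
rewrite (Prop_irrelevance pL' pK') in b * => /sv_inj ->.
by have -> : D = E by apply/val_inj/setP=> -[x y].
Qed.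

(** On a single group the diagonal acts as the identity; between two equal groups it therefore
    transports values. *)
Lemma sv_cast (gT : finGroupType) (K L : {group gT}) pK pL (D : {group gT * gT})
    (a : F (@Obj GG _ K pK)) :
  K = L -> (forall x y, ((x, y) \in D) = (x == y) && (x \in K)) ->
  same_value (gmor F (btrans (@Obj GG _ L pL) (Obj pK) D) a) a.
Proof.
move=> e eD; subst L; rewrite (Prop_irrelevance pL pK).
by rewrite gmor_Delta.
Qed.

Lemma sv_gmul (gT : finGroupType) (K L : {group gT}) pK pL
    (a a' : F (@Obj GG _ K pK)) (b b' : F (@Obj GG _ L pL)) :
  K = L -> same_value a b -> same_value a' b' ->
  same_value (gmul F a a') (gmul F b b').
Proof.
move=> e; subst L; rewrite (Prop_irrelevance pL pK) in b b' *.
by move=> /sv_inj -> /sv_inj ->.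
Qed.

Section StabValues.
Variables (G : obj GG) (X Y : gset_in G) (x : X) (y : Y).
Hypothesis exy : stab x = stab y.

Lemma sv_stab_cast (D : {group ogT G * ogT G}) (a : F (stabo x)) :
  (forall b c, ((b, c) \in D) = (b == c) && (b \in stab x)) ->
  same_value (gmor F (btrans (stabo y) (stabo x) D) a) a.
Proof. by move=> DE; apply: sv_cast. Qed.

Lemma sv_stab_gmul (a a' : F (stabo x)) (b b' : F (stabo y)) :
  same_value a b -> same_value a' b' -> same_value (gmul F a a') (gmul F b b').
Proof. exact: sv_gmul. Qed.

Lemma sv_stab_gmor (H : obj GG) (X' Y' : gset_in H) (x' : X') (y' : Y')
    (D E : {group ogT G * ogT H}) (a : F (stabo x')) (b : F (stabo y')) :
  stab x' = stab y' ->
  (forall c d, ((c, d) \in D) = ((c, d) \in E)) -> same_value a b ->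
  same_value (gmor F (btrans (stabo x) (stabo x') D) a)
             (gmor F (btrans (stabo y) (stabo y') E) b).
Proof. by move=> e' eD; apply: sv_gmor. Qed.
End StabValues.
End Values.

(** Membership of E in S_- provides the surjectivity asked for by [gmor_star]. Naming the groups
    instead of the objects lets the statement unify with [stabo x]. *)
Lemma gmor_Sminus (GG : gclass) (S : sfam GG) (R : comPzRingType)
    (F : green (Sminus S) R) (gT hT kT : finGroupType) (K : {group gT})
    (L : {group hT}) (M : {group kT}) pK pL pM
    (D : {group gT * hT}) (E : {group hT * kT}) (D' : {group gT * kT}) x :
  Sminus S (@Obj GG gT K pK) (@Obj GG hT L pL) D ->
  Sminus S (@Obj GG hT L pL) (@Obj GG kT M pM) E ->
  (forall a c, (a, c) \in D' <-> exists2 b, (a, b) \in D & (b, c) \in E) ->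
  gmor F (btrans (@Obj GG gT K pK) (Obj pL) D)
    (gmor F (btrans (Obj pL) (@Obj GG kT M pM) E) x) =
  gmor F (btrans (Obj pK) (Obj pM) D') x.
Proof.
move=> SD SE DE; apply: gmor_star => // b.
exact: (Sminus_mem1 SE).
Qed.

Section Symbols.
Variables (GG : gclass) (S : sfam GG) (hS : axioms S) (R : comPzRingType).
Variables (F : green (Sminus S) R) (G : obj GG).

Lemma gempty_in (x : gempty G) : gmem GG (stab x).
Proof. by case: (gemptyF x). Qed.

Definition gset_empty : gset_in G := GsetIn gempty_in.

Lemma sec_empty_subproof :
  is_section (F := F) (fun x : gset_empty => False_rect _ (gemptyF x)).
Proof. by move=> g x; case: (gemptyF x). Qed.

Definition sec_empty : gsec F gset_empty := Gsec sec_empty_subproof.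

Lemma gmem_emb (X Y : gset G) (p : X -> Y) :
  gemb p -> (forall y : Y, gmem GG (stab y)) -> forall x : X, gmem GG (stab x).
Proof. by move=> pe i x; rewrite -(stab_emb x pe). Qed.



Lemma Sminus_stab_Delta (X Y : gset_in G) (x : X) (y : Y) :
  stab x \subset stab y -> Sminus S (stabo x) (stabo y) (Delta_group (stab x)).
Proof. exact: (Sminus_Delta hS). Qed.

Lemma Sminus_stab_conj (X : gset_in G) (x : X) g : g \in (G : {group _}) ->
  Sminus S (stabo (g ** x)) (stabo x) (conjgraph_group g (stab x)).
Proof.
move=> gG; have e : stab (g ** x) = (stab x :^ g^-1)%G by exact: stab_lmul.
exact: (Sminus_conjgraph hS (gset_inP (g ** x)) (gset_inP x) gG (stab_sub x) e).
Qed.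

(** Both composites are given by the graph of conjugation by g on G_x. *)
Lemma gmor_Delta_conj (X Y : gset_in G) (x : X) (y : Y) g a :
  g \in (G : {group _}) -> stab x \subset stab y ->
  gmor F (btrans (stabo (g ** x)) (stabo (g ** y)) (Delta_group (stab (g ** x))))
    (gmor F (btrans (stabo (g ** y)) (stabo y) (conjgraph_group g (stab y))) a) =
  gmor F (btrans (stabo (g ** x)) (stabo x) (conjgraph_group g (stab x)))
    (gmor F (btrans (stabo x) (stabo y) (Delta_group (stab x))) a).
Proof.
move=> gG sxy; have sgxy : stab (g ** x) \subset stab (g ** y).
  by rewrite !stab_lmul // conjSg.
rewrite (gmor_Sminus _ (Sminus_stab_Delta sgxy) (Sminus_stab_conj y gG)
  (D' := conjgraph_group g (stab x))).
  apply/esym/(gmor_Sminus _ (Sminus_stab_conj x gG) (Sminus_stab_Delta sxy)) => b c.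
  rewrite mem_conjgraph; split=> [/andP[cx /eqP ->]|[b']].
    by exists c; rewrite ?mem_conjgraph ?mem_Delta ?cx eqxx.
  by rewrite mem_conjgraph => h; rewrite mem_Delta => /andP[/eqP <- _].
move=> b c; rewrite mem_conjgraph; split=> [/andP[cx /eqP ->]|[b']].
  exists (c ^ g^-1)%g; last by rewrite mem_conjgraph (subsetP sxy) ?eqxx.
  by rewrite mem_Delta eqxx stab_lmul // memJ_conjg.
rewrite mem_Delta => /andP[/eqP <-]; rewrite stab_lmul // mem_conjgV mem_conjgraph.
by move=> + /andP[_ /eqP e]; rewrite e -conjgM mulVg conjg1 eqxx andbT.
Qed.

Section Pullback.
Variables (X Y : gset_in G) (p : X -> Y) (pe : gemb p) (t : gsec F Y).

(** As p(x) and x have the same stabilizer, the diagonal merely transports t(p(x)) to the type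
    F(G_x). *)
Lemma sec_pull_subproof : is_section (fun x : X =>
  gmor F (btrans (stabo x) (stabo (p x)) (Delta_group (stab x))) (t (p x))).
Proof.
move=> g x gG; rewrite pe.2 // secP //; apply: gmor_Delta_conj => //.
by rewrite (stab_emb x pe).
Qed.

Definition sec_pull : gsec F X := Gsec sec_pull_subproof.

Lemma sec_pullE x : same_value (sec_pull x) (t (p x)).
Proof.
have ex : stab (p x) = stab x by exact: stab_emb.
by apply: sv_stab_cast => // a b; rewrite mem_Delta ex.
Qed.
End Pullback.

Definition union_additive (A : zmodType) (f : gpair F G -> A) :=
  forall (W X Y : gset_in G) (w : gsec F W) (s : gsec F X) (t : gsec F Y)
    (p : X -> W) (q : Y -> W), is_union p q ->
    (forall x, same_value (w (p x)) (s x)) ->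
    (forall y, same_value (w (q y)) (t y)) ->
  f (Gpair w) = f (Gpair s) + f (Gpair t).

Definition section_additive (A : zmodType) (f : gpair F G -> A) :=
  forall (X : gset_in G) (s u : gsec F X),
  f (Gpair (sec_add s u)) = f (Gpair s) + f (Gpair u).

Section Respects.
Variables (A : zmodType) (f : gpair F G -> A).
Hypotheses (fU : union_additive f) (fA : section_additive f).

Lemma union_additive_gset0 (X : gset_in G) (s : gsec F X) : (X -> False) ->
  f (Gpair s) = 0.
Proof.
move=> X0; apply: (addrI (f (Gpair s))); rewrite addr0; apply/esym.
apply: (@fU X X X s s s id id) => //.
by split; try split; do ?move=> ?; case: X0.
Qed.

(** As for bisets, an isomorphism is a decomposition whose second piece is empty. *)
Lemma union_additive_respects : respects (@prel _ _ _ F G) f.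
Proof.
move=> _ _ [[X s] [Y t] al [al' alK al'K] [ale alv]|X Y s t i w ws wt|X s u];
  rewrite ?big_cons big_nil addr0 //=.
- rewrite /= in al al' alK al'K ale alv *.
  rewrite -[RHS]addr0 -(@union_additive_gset0 gset_empty sec_empty (@gemptyF _ G)).
  have e' : equivariant al' by move=> a y aG; rewrite -{1}(al'K y) -ale // alK.
  apply: (@fU X Y gset_empty s t sec_empty al' (fun z => False_rect _ (gemptyF z))).
  + split=> //; first by split=> //; apply: can_inj al'K.
    * by split=> [z|a z]; case: (gemptyF z).
    * by move=> x z; case: (gemptyF z).
    * by move=> x; left; exists (al x).
  + by move=> y; have [_] := alv (al' y); rewrite al'K.
  + by move=> z; case: (gemptyF z).
exact: (@fU (GsetIn i) X Y w s t _ _ (is_union_gunion X Y)).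
Qed.
End Respects.


(** The pullback of w to [gunion X Y] is isomorphic to w and restricts to s and t, so one
    isomorphism relation and one union relation suffice. *)
Lemma psym_union : union_additive (fun P : gpair F G => psym (gp_sec P)).
Proof.
move=> W X Y w s t p q U ws wt.
have [pe qe dis cov] := U.
have iW : forall z : gunion X Y, gmem GG (stab z).
  have [le re _ cv] := is_union_gunion X Y.
  move=> z; case: (cv z) => -[x <-].
    by rewrite (stab_emb _ le); apply: gset_inP.
  by rewrite (stab_emb _ re); apply: gset_inP.
pose f (z : gunion X Y) := match gout z with inl x => p x | inr y => q y end.
have fe : gemb (f : GsetIn iW -> W).
  split=> [z z' e|a z aG].
    apply: (can_inj (@goutK _ _ _ _ _ _)); move: e; rewrite /f.
    case: (gout z) (gout z') => [x|x] [y|y].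
    + by move=> /pe.1 ->.
    + by move=> /dis.
    + by move=> /esym /dis.
    + by move=> /qe.1 ->.
  by rewrite /f goutE //; case: (gout z) => x /=; rewrite ?pe.2 ?qe.2.
have fs w' : exists z, f z = w'.
  case: (cov w') => -[x <-].
    by exists (gin _ _ (inl x)); rewrite /f ginK.
  by exists (gin _ _ (inr x)); rewrite /f ginK.
pose v := sec_pull fe w; rewrite /psym.
have r1 : prel (Gpair v) [:: Gpair w].
  apply: (@prel_iso _ _ _ _ _ (Gpair v) (Gpair w) f).
    by apply: inj_surj_bij => //; apply: fe.1.
  split; first exact: fe.2.
  move=> z; split; first exact: (stab_emb z fe).
  exact/esym/(sec_pullE fe w).
have r2 : prel (Gpair v) [:: Gpair s; Gpair t].
  apply: prel_union => z.
    have ef : f (ginl Y z) = p z by rewrite /f /ginl ginK.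
    by have := sec_pullE fe w (ginl Y z); rewrite ef => e; apply: etrans e (ws z).
  have ef : f (ginr X z) = q z by rewrite /f /ginr ginK.
  by have := sec_pullE fe w (ginr X z); rewrite ef => e; apply: etrans e (wt z).
have := pgen_rel r1; rewrite big_seq1 => <-.
by rewrite (pgen_rel r2) big_cons big_seq1.
Qed.

Lemma psym_add : section_additive (fun P : gpair F G => psym (gp_sec P)).
Proof.
by move=> X s u; rewrite /psym (pgen_rel (prel_add s u)) big_cons big_seq1.
Qed.

(** The usual form of an identity between symbols: T consists of representatives, such as tuples of
    points, and p and q name the corresponding points of X and Y. Since sending p(z) to q(z) is an
    embedding, the equality of their stabilizers may be assumed when values are compared. *)
Lemma psym_eq (X Y : gset_in G) (s : gsec F X) (t : gsec F Y)
    (T : Type) (p : T -> X) (q : T -> Y) :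
  (forall x, exists t, p t = x) -> (forall y, exists t, q t = y) ->
  (forall t t', p t = p t' <-> q t = q t') ->
  (forall a t, a \in (G : {group _}) ->
     exists t', p t' = a ** p t /\ q t' = a ** q t) ->
  (forall z, stab (p z) = stab (q z) -> same_value (s (p z)) (t (q z))) ->
  psym s = psym t.
Proof.
move=> ps qs pq pqa st; have [f fe fE] := gemb_of ps pq pqa.
have fb : bijective f.
  apply: inj_surj_bij; first exact: fe.1.
  by move=> y; have [z <-] := qs y; exists (p z).
have r : prel (Gpair s) [:: Gpair t].
  apply: (@prel_iso _ _ _ _ _ (Gpair s) (Gpair t) f fb).
  split=> [|x]; first exact: fe.2.
  have e := stab_emb x fe; split; first exact: e.
  have [z ez] := ps x; subst x; rewrite fE in e *.
  by apply/esym/st.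
by rewrite /psym (pgen_rel r) big_seq1.
Qed.

(* As sections are equivariant, it suffices to compare them on orbit
   representatives. *)
Lemma psym_eq_orbit (X Y : gset_in G) (s : gsec F X) (t : gsec F Y)
    (T : Type) (p : T -> X) (q : T -> Y) :
  (forall x, exists2 a, a \in (G : {group _}) & exists z, x = a ** p z) ->
  (forall y, exists2 a, a \in (G : {group _}) & exists z, y = a ** q z) ->
  (forall a z z', a \in (G : {group _}) -> a ** p z = p z' <-> a ** q z = q z') ->
  (forall z, stab (p z) = stab (q z) -> same_value (s (p z)) (t (q z))) ->
  psym s = psym t.
Proof.
move=> ps qs pq st.
have eV a b z z' : a \in (G : {group _}) -> b \in (G : {group _}) ->
    a ** p z = b ** p z' <-> a ** q z = b ** q z'.
  move=> aG bG; have baG : (b^-1 * a)%g \in (G : {group _}).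
    by rewrite groupM ?groupV.
  have [pq1 pq2] := pq _ z z' baG; rewrite !lmulM ?groupV // in pq1 pq2.
  split=> e; apply: (@lmul_inj _ _ _ b^-1%g); rewrite lmulVK //.
    by apply: pq1; rewrite e lmulVK.
  by apply: pq2; rewrite e lmulVK.
apply: (psym_eq (T := {a | a \in (G : {group _})} * T)
  (p := fun z => sval z.1 ** p z.2) (q := fun z => sval z.1 ** q z.2)).
- by move=> x; have [a aG [z ->]] := ps x; exists (exist _ a aG, z).
- by move=> y; have [a aG [z ->]] := qs y; exists (exist _ a aG, z).
- by move=> [[a aG] z] [[b bG] z']; apply: eV.
- move=> b [[a aG] z] bG; have baG : (b * a)%g \in (G : {group _}) by rewrite groupM.
  by exists (exist (fun c => is_true (c \in (G : {group _}))) _ baG, z);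
    rewrite /= !lmulM.
move=> [[a aG] z]; rewrite !stab_lmul // => e.
have {}e : stab (p z) = stab (q z).
  by apply: val_inj; apply: (@conjsg_inj _ a^-1%g); apply: (congr1 val e).
change (same_value (s (a ** p z)) (t (a ** q z))).
rewrite !secP //; apply: sv_stab_gmor; last exact: st.
- by rewrite !stab_lmul // e.
- by [].
by move=> c d; rewrite !mem_conjgraph e.
Qed.

Lemma plus_car_gen (Q : plus_car F G -> Prop) :
  Q 0 -> (forall X (s : gsec F X), Q (psym s)) ->
  (forall x y, Q x -> Q y -> Q (x + y)) -> (forall x, Q x -> Q (- x)) ->
  forall x, Q x.
Proof.
move=> Q0 Qg QD QN x; apply: (pres_ind Q0 _ QD QN) => -[X s].
exact: (Qg X s).
Qed.

Lemma scale_psym r (X : gset_in G) (s : gsec F X) :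
  r *: (psym s : plus_car F G) = psym (sec_scale r s).
Proof. exact: pscale_sym. Qed.

Lemma plus_car_ind (Q : plus_car F G -> Prop) :
  Q 0 -> (forall x y, Q x -> Q y -> Q (x + y)) -> (forall x, Q x -> Q (- x)) ->
  (forall (X : gset_in G) (s : gsec F X) (x0 : X), gtrans x0 -> Q (psym s)) ->
  forall x, Q x.
Proof.
move=> Q0 QD QN Qt x; elim/pres_ind: x => [|[X s]|x y|x] //; try by eauto.
change (Q (psym s)); case: X s => X i s.
elim/gset_orbit_ind: X i s => [X X0 i s|X x0 tx i s|W X Y p q U hX hY i s].
- by have -> : psym s = 0 by apply: (union_additive_gset0 psym_union s X0).
- exact: (Qt _ s x0 tx).
have [pe qe _ _] := U.
have iX := gmem_emb pe i; have iY := gmem_emb qe i.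
pose sX := sec_pull (X := GsetIn iX) (Y := GsetIn i) pe s.
pose sY := sec_pull (X := GsetIn iY) (Y := GsetIn i) qe s.
have -> : psym s = psym sX + psym sY.
  apply: (psym_union (W := GsetIn i) (X := GsetIn iX) (Y := GsetIn iY) U) => z.
    exact/esym/(sec_pullE (X := GsetIn iX) (Y := GsetIn i) pe).
  exact/esym/(sec_pullE (X := GsetIn iY) (Y := GsetIn i) qe).
by apply: QD.
Qed.

End Symbols.

(** * The action of a biset on symbols *)

Section TensorRepresentatives.
Variables (gT hT : finGroupType) (G : {group gT}) (H : {group hT}).

Section Reps.
Variables (U : biset G H) (X : gset H).
Definition tens_u (w : tensx U X) : U := sval (cid (tensx_cl_surj w)).
Definition tens_x (w : tensx U X) : X :=
  sval (cid (svalP (cid (tensx_cl_surj w)))).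
Lemma tens_uxK w : tensx_cl (tens_u w) (tens_x w) = w.
Proof. exact: (svalP (cid (svalP (cid (tensx_cl_surj w))))). Qed.
End Reps.

Variables (U U' : biset G H) (X X' : gset H) (f : U -> U') (g : X -> X').

Definition tensx_map (w : tensx U X) : tensx U' X' :=
  tensx_cl (f (tens_u w)) (g (tens_x w)).

Lemma tensx_mapE u x : equivariant f -> equivariant g ->
  tensx_map (tensx_cl u x) = tensx_cl (f u) (g x).
Proof.
move=> fe ge; have /tensx_clP[h hH [eu ex]] := tens_uxK (tensx_cl u x).
by apply/tensx_clP; exists h => //; rewrite -ge // -fe ?in1L // -eu -ex.
Qed.

Lemma tensx_map_emb : gemb f -> gemb g -> gemb tensx_map.
Proof.
move=> [fi fe] [gi ge]; split=> [w w'|a w aG].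
  have [u [x <-]] := tensx_cl_surj w; have [u' [x' <-]] := tensx_cl_surj w'.
  rewrite !tensx_mapE // => /tensx_clP[h hH]; rewrite -ge // -fe ?in1L //.
  by move=> [/fi -> /gi ->]; apply/esym/tensx_clE.
have [u [x <-]] := tensx_cl_surj w.
by rewrite tensx_cl_lmul // !tensx_mapE // tensx_cl_lmul // fe // inA1.
Qed.
End TensorRepresentatives.

Lemma gemb_id (gT : finGroupType) (G : {group gT}) (X : gset G) : gemb (fun x : X => x).
Proof. by split. Qed.

Section TensorUnion.
Variables (gT hT : finGroupType) (G : {group gT}) (H : {group hT}).

Lemma tensx_union_r (U : biset G H) (W X Y : gset H) (p : X -> W) (q : Y -> W) :
  is_union p q ->
  is_union (tensx_map (fun u : U => u) p) (tensx_map (fun u : U => u) q).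
Proof.
move=> [pe qe dis cov]; have [iU eU] := gemb_id U; split.
- by apply: tensx_map_emb.
- by apply: tensx_map_emb.
- move=> w w'; have [u [x <-]] := tensx_cl_surj w.
  have [u' [x' <-]] := tensx_cl_surj w'.
  rewrite !tensx_mapE ?(pe.2, qe.2) //; try exact: pe.2; try exact: qe.2.
  by move=> /tensx_clP[h hH [_]]; rewrite -pe.2 // => /esym/dis.
move=> w; have [u [z <-]] := tensx_cl_surj w.
by case: (cov z) => -[x <-]; [left|right]; exists (tensx_cl u x);
  rewrite tensx_mapE //; [exact: pe.2|exact: qe.2].
Qed.

Lemma tensx_union_l (W U V : biset G H) (X : gset H) (p : U -> W) (q : V -> W) :
  is_union p q ->
  is_union (tensx_map p (fun x : X => x)) (tensx_map q (fun x : X => x)).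
Proof.
move=> [pe qe dis cov]; have iX := gemb_id X.
split.
- by apply: tensx_map_emb.
- by apply: tensx_map_emb.
- move=> w w'; have [u [x <-]] := tensx_cl_surj w.
  have [u' [x' <-]] := tensx_cl_surj w'.
  rewrite !tensx_mapE //; try exact: pe.2; try exact: qe.2.
  by move=> /tensx_clP[h hH []]; rewrite -pe.2 ?in1L // => /esym/dis.
move=> w; have [u [x <-]] := tensx_cl_surj w.
by case: (cov u) => -[z <-]; [left|right]; exists (tensx_cl z x);
  rewrite tensx_mapE //; [exact: pe.2|exact: qe.2].
Qed.
End TensorUnion.

Section TensorAction.
Variables (GG : gclass) (S : sfam GG) (hS : axioms S) (R : comPzRingType).
Variables (F : green (Sminus S) R).

Definition splus_set (G H : obj GG) (U : biset G H) :=
  forall u : U, Splus S G H (stab u).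

(** This is (G x H_x)_u, the subgroup through which U(s) is defined. *)
Definition stab_cut (G H : obj GG) (U : biset G H) (X : gset H) (u : U) (x : X) :
    {group ogT G * ogT H} := [group of stab u :&: setX G (stab x)].

Lemma mem_stab_cut (G H : obj GG) (U : biset G H) (X : gset H) (u : U) (x : X) a b :
  ((a, b) \in stab_cut u x) = ((a, b) \in stab u) && (b \in stab x).
Proof.
rewrite in_setI in_setX /= in_stab in_setX /=.
by case: (a \in _) => //=; rewrite ?andbF.
Qed.

Section OneBiset.
Variables (G H : obj GG) (U : biset G H) (hU : splus_set U).

Section OneSet.
Variable X : gset_in H.

Lemma tens_in (w : tensx U X) : gmem GG (stab w).
Proof.
have [u [x <-]] := tensx_cl_surj w; rewrite stab_tensx.
exact: (Splus_gmem hS (hU u) (stab_sub x) (gset_inP x)).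
Qed.

Definition tens_set : gset_in G := GsetIn tens_in.

(** Since the stabilizer of [u,x] is the star of (G x H)_u with H_x, the group (G x H_x)_u projects
    onto it. So although the stabilizers in U lie only in S_+, the value of U(s) at [u,x] involves F
    on D_- alone. *)
Lemma Sminus_stab_cut (w : tens_set) u x : w = tensx_cl u x ->
  Sminus S (stabo w) (stabo x) (stab_cut u x).
Proof.
move=> ew; have e : stab w = [group of starl (stab u) (stab x)].
  by rewrite ew stab_tensx.
have sw : stab w \subset starl (stab u) (stab x) by rewrite e.
apply: (Splus_restr hS (gset_inP w) (gset_inP x) (hU u) (stab_sub x) sw) => a b.
rewrite mem_stab_cut; apply/andP/and3P => [[abu bx]|[]//]; split=> //.
by rewrite -/(stab w) e; apply/mem_starl; exists b.
Qed.

Section OneSection.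
Variable s : gsec F X.

(** The point w is kept apart from the representative (u,x), so that the values for different
    representatives of w lie in one type. *)
Definition tens_val (w : tens_set) (u : U) (x : X) : F (stabo w) :=
  gmor F (btrans (stabo w) (stabo x) (stab_cut u x)) (s x).

(** Passing to (u h^-1, h x) conjugates (G x H_x)_u by (1,h), and the conjugation graph coming from
    s(hx) undoes this. *)
Lemma tens_val_indep (w : tens_set) u x h : w = tensx_cl u x -> h \in (H : {group _}) ->
  tens_val w ((1%g, h) ** u) (h ** x) = tens_val w u x.
Proof.
move=> ew hH; rewrite /tens_val secP //.
have hV : (1%g, h) \in setX_group G H by rewrite in1L.
have ew' : w = tensx_cl ((1%g, h) ** u) (h ** x) by rewrite tensx_clE.
apply: (gmor_Sminus _ (Sminus_stab_cut ew') (Sminus_stab_conj hS x hH)) => a c.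
rewrite mem_stab_cut.
have cutE b : (a, b) \in stab_cut ((1%g, h) ** u) (h ** x) =
    ((a, b ^ h)%g \in stab u) && (b ^ h \in stab x)%g.
  by rewrite mem_stab_cut mem_stab_lmul // conjg1 stab_lmul // mem_conjgV.
split=> [/andP[acu cx]|[b]].
  exists (c ^ h^-1)%g; last by rewrite mem_conjgraph cx eqxx.
  by rewrite cutE -conjgM mulVg conjg1 acu.
by rewrite cutE mem_conjgraph => /andP[abu _] /andP[cx /eqP e]; move: abu;
  rewrite e -conjgM mulVg conjg1 => ->.
Qed.

Lemma tens_val_eq (w : tens_set) u x u' x' :
  w = tensx_cl u x -> w = tensx_cl u' x' -> tens_val w u x = tens_val w u' x'.
Proof.
move=> ew ew'; have /tensx_clP[h hH [-> ->]] : tensx_cl u x = tensx_cl u' x'.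
  by rewrite -ew.
by rewrite tens_val_indep.
Qed.

Definition tens_fun (w : tens_set) : F (stabo w) :=
  tens_val w (tens_u w) (tens_x w).

Lemma tens_funE (w : tens_set) u x : w = tensx_cl u x -> tens_fun w = tens_val w u x.
Proof. by apply: tens_val_eq; rewrite tens_uxK. Qed.

(** Composing the graph of conjugation by g with (G x H_x)_u gives (G x H_x)_{gu}. *)
Lemma tens_fun_section : is_section tens_fun.
Proof.
move=> g w gG; have [u [x ew]] := tensx_cl_surj w.
rewrite (tens_funE (esym ew)).
have egw : g ** w = tensx_cl ((g, 1%g) ** u) x by rewrite -tensx_cl_lmul // ew.
have gV : (g, 1%g) \in setX_group G H by rewrite inA1.
rewrite (tens_funE egw) /tens_val; apply/esym.
apply: (gmor_Sminus _ (Sminus_stab_conj hS w gG) (Sminus_stab_cut (esym ew))) => a c.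
rewrite mem_stab_cut mem_stab_lmul // conjg1.
split=> [/andP[acu cx]|[b]].
  have bc : (a ^ g, c)%g \in stab_cut u x by rewrite mem_stab_cut acu.
  exists (a ^ g)%g => //; rewrite mem_conjgraph -conjgM mulgV conjg1 eqxx andbT.
  by rewrite -ew stab_tensx; apply/mem_starl; exists c.
rewrite mem_conjgraph mem_stab_cut => /andP[_ /eqP ->].
by rewrite -conjgM mulVg conjg1.
Qed.

Definition tens_sec : gsec F tens_set := Gsec tens_fun_section.

Lemma tens_secE u x : tens_sec (tensx_cl u x) = tens_val (tensx_cl u x) u x.
Proof. exact: tens_funE. Qed.
End OneSection.
End OneSet.

Definition tens_sym (P : gpair F H) : plus_car F G := psym (tens_sec (gp_sec P)).

Lemma tens_sym_add : section_additive tens_sym.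
Proof.
move=> X s u; rewrite /tens_sym /= -(psym_add (tens_sec s)) /=; congr psym.
by apply: gsecP => w; exact: (raddfD (gmor F _)).
Qed.

Lemma tens_sym_scale r (X : gset_in H) (s : gsec F X) :
  tens_sym (Gpair (sec_scale r s)) = r *: tens_sym (Gpair s).
Proof.
rewrite /tens_sym /=; apply: etrans (esym (pscale_sym r _)); congr psym.
by apply: gsecP => w; exact: (linearZ_LR (gmor F _)).
Qed.

Lemma tens_sym_union : union_additive tens_sym.
Proof.
move=> W X Y w s t p q U1 ws wt.
have [pe qe _ _] := U1.
have key (Z : gset_in H) (z : gsec F Z) (f : Z -> W) : gemb f ->
    (forall x, same_value (w (f x)) (z x)) -> forall v : tens_set Z,
  same_value (tens_sec w (tensx_map (fun u : U => u) f v : tens_set W))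
             (tens_sec z v).
  move=> fe wz v; have [u [x <-]] := tensx_cl_surj v.
  have e := stab_emb (tensx_cl u x) (tensx_map_emb (gemb_id U) fe).
  have em : tensx_map (fun u : U => u) f (tensx_cl u x) = tensx_cl u (f x).
    by apply: tensx_mapE => //; exact: fe.2.
  rewrite em in e *; rewrite !tens_secE; apply: sv_stab_gmor => //.
  - by apply: stab_emb.
  - by move=> a b; rewrite !mem_stab_cut (stab_emb x fe).
exact: (@psym_union _ _ hS _ F G (tens_set W) (tens_set X) (tens_set Y) (tens_sec w)
  (tens_sec s) (tens_sec t) _ _ (tensx_union_r U U1) (key _ _ _ pe ws)
  (key _ _ _ qe wt)).
Qed.
End OneBiset.

Lemma tens_sym_union_l (G H : obj GG) (W U V : biset G H) (hW : splus_set W)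
   (hU : splus_set U) (hV : splus_set V) (p : U -> W) (q : V -> W) P :
  is_union p q -> tens_sym hW P = tens_sym hU P + tens_sym hV P.
Proof.
case: P => X s U1; have [pe qe _ _] := U1.
have key (Z : biset G H) (hZ : splus_set Z) (f : Z -> W) : gemb f ->
  forall v : tens_set hZ X,
  same_value (tens_sec hW s (tensx_map f (fun x : X => x) v : tens_set hW X))
             (tens_sec hZ s v).
  move=> fe v; have [u [x <-]] := tensx_cl_surj v.
  have e := stab_emb (tensx_cl u x) (tensx_map_emb fe (gemb_id X)).
  have em : tensx_map f (fun x : X => x) (tensx_cl u x) = tensx_cl (f u) x.
    by apply: tensx_mapE => //; exact: fe.2.
  rewrite em in e *; rewrite !tens_secE; apply: sv_stab_gmor => //.
  by move=> a b; rewrite !mem_stab_cut (stab_emb u fe).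
exact: (@psym_union _ _ hS _ F G (tens_set hW X) (tens_set hU X) (tens_set hV X)
  (tens_sec hW s) (tens_sec hU s) (tens_sec hV s) _ _ (tensx_union_l X U1)
  (key _ _ _ pe) (key _ _ _ qe)).
Qed.

(** Its use is in [plus_mor_bcls]: if all stabilizers are admissible, cutting U down to its
    admissible points gives an isomorphic biset. *)
Lemma tens_sym_iso (G H : obj GG) (W U : biset G H) (hW : splus_set W)
   (hU : splus_set U) (p : U -> W) P :
  gemb p -> (forall w, exists u, p u = w) -> tens_sym hW P = tens_sym hU P.
Proof.
move=> pe ps; case: P => X s.
have pu x u : tensx_cl (p u) x = tensx_map p (fun x : X => x) (tensx_cl u x).
  by rewrite tensx_mapE //; apply: pe.2.
have pm := tensx_map_emb pe (gemb_id X).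
apply/esym; apply: (psym_eq (X := tens_set hU X) (Y := tens_set hW X)
  (p := fun z : U * X => tensx_cl z.1 z.2)
  (q := fun z : U * X => tensx_cl (p z.1) z.2)).
- by move=> w; have [u [x <-]] := tensx_cl_surj w; exists (u, x).
- move=> w; have [u [x <-]] := tensx_cl_surj w.
  by have [v <-] := ps u; exists (v, x).
- by move=> z z'; rewrite !pu; split=> [->//|/pm.1].
- move=> a [u x] aG; exists ((a, 1%g) ** u, x).
  by rewrite !tensx_cl_lmul // pe.2 ?inA1.
move=> [u x] e; rewrite !tens_secE; apply: sv_stab_gmor => //= a b.
by rewrite !mem_stab_cut (stab_emb u pe).
Qed.

End TensorAction.

(** * Functoriality *)

Lemma mem_stab_gbase (hT kT : finGroupType) (H : {group hT}) (K : {group kT})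
    (D : {group hT * kT}) a b : D \subset setX H K ->
  ((a, b) \in stab (gbase (setX_group H K) D)) = ((a, b) \in D).
Proof. by move=> sD; rewrite stab_gbase. Qed.

(** * Bisets given by graphs of functions *)

Section GraphCosets.
Variables (hT kT : finGroupType) (H : {group hT}) (K : {group kT}).

Section Graph.
Variables (D : {group hT * kT}) (phi : hT -> kT).
Hypothesis sD : D \subset setX H K.
Hypothesis DE : forall a b, ((a, b) \in D) = (a \in H) && (b == phi a).
Let o := gbase (setX_group H K) D.
Variable X : gset K.
Implicit Types x y : X.

Lemma graph_in h : h \in H -> phi h \in K.
Proof.
move=> hH; have : (h, phi h) \in D by rewrite DE hH eqxx.
by move/(subsetP sD)/setXP=> [].
Qed.

Lemma graph1 : phi 1%g = 1%g.
Proof.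
have := group1 D; rewrite [X in X \in _](_ : _ = (1, 1)%g) // DE.
by move=> /andP[_ /eqP].
Qed.

Lemma graph_base_fix h : h \in H -> (h, phi h) ** o = o.
Proof.
move=> hH; have : (h, phi h) \in stab o by rewrite mem_stab_gbase // DE hH eqxx.
by rewrite in_stab => /andP[_ /eqP].
Qed.

(** This and the next two lemmas identify the tensor product of (H x K)/D with X over K with X
    itself: x corresponds to [o,x], and H acts through phi. *)
Lemma graph_base_inj x y : tensx_cl o x = tensx_cl o y -> x = y.
Proof.
move=> /tensx_clP[k kK [e ->]].
have : (1%g, k) \in stab o by rewrite in_stab in_setX group1 kK -e eqxx.
by rewrite mem_stab_gbase // DE graph1 => /andP[_ /eqP ->]; rewrite lmul1.
Qed.

Lemma graph_base_lmul h x : h \in H ->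
  h ** tensx_cl o x = tensx_cl o (phi h ** x).
Proof.
move=> hH; have pK := graph_in hH.
rewrite tensx_cl_lmul // -[in LHS](tensx_clE _ _ pK) -lmul_pair //.
by rewrite graph_base_fix.
Qed.

Lemma graph_base_surj (w : tensx (gcosets (setX_group H K) D) X) :
  exists x, tensx_cl o x = w.
Proof.
have [u [x <-]] := tensx_cl_surj w.
have [[h k] /setXP[hH kK] ->] := gbase_trans u; have pK := graph_in hH.
have k'K : (k * (phi h)^-1)%g \in K by rewrite groupM ?groupV.
exists ((k * (phi h)^-1)^-1 ** x)%g.
apply/tensx_clP; exists (k * (phi h)^-1)%g => //; split; last by rewrite lmulKV.
rewrite -/o -{2}(graph_base_fix hH) -lmulM ?in_setX ?group1 ?hH ?pK ?k'K //.
by congr lmul; congr (_, _); rewrite ?mul1g ?mulgKV.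
Qed.
End Graph.

Section Cograph.
Variables (E : {group kT * hT}) (phi : hT -> kT).
Hypothesis sE : E \subset setX K H.
Hypothesis EE : forall a b, ((b, a) \in E) = (a \in H) && (b == phi a).
Let o := gbase (setX_group K H) E.
Variable X : gset H.
Implicit Types x y : X.

(** For the opposite graph the tensor product is the K-set induced along phi, because (k,h) fixes o
    exactly when k = phi(h). *)
Lemma cograph_baseP k x y : k \in K ->
  k ** tensx_cl o x = tensx_cl o y <->
  exists2 h, h \in H & k = phi h /\ y = h ** x.
Proof.
move=> kK; rewrite tensx_cl_lmul //; split=> [/tensx_clP[h hH [e ->]]|[h hH [ek ->]]].
  exists h => //; split=> //; apply/eqP.
  have : (k, h) \in stab o by rewrite in_stab in_setX kK hH /= lmul_pair // -e.
  by rewrite mem_stab_gbase // EE => /andP[].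
apply/tensx_clP; exists h => //; split=> //; rewrite -lmul_pair //.
have : (k, h) \in stab o by rewrite mem_stab_gbase // EE hH ek eqxx.
by rewrite in_stab => /andP[_ /eqP].
Qed.
End Cograph.

Lemma base_surj (E : {group kT * hT}) (X : gset H)
    (w : tensx (gcosets (setX_group K H) E) X) :
  exists2 k, k \in K & exists x, w = k ** tensx_cl (gbase (setX_group K H) E) x.
Proof.
have [u [x <-]] := tensx_cl_surj w.
have [[k h] /setXP[kK hH] ->] := gbase_trans u; exists k => //.
exists (h^-1%g ** x); rewrite tensx_cl_lmul //.
apply/tensx_clP; exists h^-1%g; rewrite ?groupV //; split=> //.
rewrite -lmulM ?in_setX ?group1 ?groupV ?kK ?hH //.
by congr lmul; congr (_, _); rewrite ?mul1g ?mulVg.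
Qed.
End GraphCosets.

Section PlusMor.
Variables (GG : gclass) (S : sfam GG) (hS : axioms S) (R : comPzRingType).

Section SplusPart.
Variables G H : obj GG.
Implicit Types U V W : biset G H.

Definition splus_pred U (u : U) : bool := `[< Splus S G H (stab u) >].

Lemma splus_predJ U a (u : U) : a \in setX_group G H ->
  splus_pred (a ** u) = splus_pred u.
Proof.
move=> aGH; apply/asboolP/asboolP => h.
  rewrite -(lmulVK u aGH) stab_lmul ?groupV //.
  by apply: Splus_conj; rewrite // groupV groupV.
by rewrite stab_lmul //; apply: Splus_conj; rewrite // groupV.
Qed.

(* [bmor] has to be defined on all of B(G,H): bisets are cut down to the
   points whose stabilizer belongs to [Splus]. *)
Definition splus_part U : biset G H := gsub (@splus_predJ U).
Definition splus_val U : splus_part U -> U := @gsubv _ _ U _ (@splus_predJ U).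

Lemma splus_val_emb U : gemb (@splus_val U).
Proof. exact: gsubv_emb. Qed.

Lemma splus_part_set U : splus_set S (splus_part U).
Proof.
move=> z; rewrite -(stab_emb z (splus_val_emb U)).
have zP : splus_pred (splus_val z) by exact: (gsubvP (z : gsub (@splus_predJ U))).
exact/asboolP.
Qed.

Lemma splus_val_surj U (u : U) : Splus S G H (stab u) ->
  exists z : splus_part U, splus_val z = u.
Proof. by move=> h; apply: gsubv_surj; apply/asboolP. Qed.

Lemma splus_map U V (p : U -> V) : gemb p ->
  exists2 f : splus_part U -> splus_part V, gemb f &
    forall z, splus_val (f z) = p (splus_val z).
Proof.
move=> pe; have h (z : splus_part U) :
    exists v : splus_part V, splus_val v = p (splus_val z).
  apply: splus_val_surj; rewrite (stab_emb _ pe) (stab_emb z (splus_val_emb U)).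
  exact: splus_part_set.
have fE z : splus_val (sval (cid (h z))) = p (splus_val z) := svalP (cid (h z)).
exists (fun z => sval (cid (h z))) => //; split=> [z z' e|a z aG].
  by apply: (splus_val_emb U).1; apply: pe.1; rewrite -!fE e.
apply: (splus_val_emb V).1.
by rewrite fE !(splus_val_emb _).2 // pe.2 // fE.
Qed.

(** Embeddings preserve stabilizers, so cutting down to admissible points respects disjoint unions.
    This makes the action additive on all of B(G,H). *)
Lemma splus_part_union W U V (p : U -> W) (q : V -> W) : is_union p q ->
  exists (p' : splus_part U -> splus_part W) (q' : splus_part V -> splus_part W),
    is_union p' q'.
Proof.
move=> [pe qe dis cov]; have [p' pe' p'E] := splus_map pe.
have [q' qe' q'E] := splus_map qe; exists p', q'; split=> //.
  by move=> x y e; apply: (dis (splus_val x) (splus_val y)); rewrite -p'E e q'E.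
move=> w; have Sw := splus_part_set w; have [vi _] := splus_val_emb W.
rewrite -(stab_emb w (splus_val_emb W)) in Sw.
case: (cov (splus_val w)) => -[x ex]; rewrite -ex in Sw; [left|right].
  rewrite (stab_emb x pe) in Sw; have [z ez] := splus_val_surj Sw.
  by exists z; apply: vi; rewrite p'E ez.
rewrite (stab_emb x qe) in Sw; have [z ez] := splus_val_surj Sw.
by exists z; apply: vi; rewrite q'E ez.
Qed.
End SplusPart.

Section Additive.
Variables (F : green (Sminus S) R) (G H : obj GG).

Definition plus_mor_gen (U : biset G H) (P : gpair F H) : plus_car F G :=
  tens_sym hS (@splus_part_set G H U) P.

Lemma plus_mor_gen_l P :
  respects (@brel _ (setX_group G H)) (fun U => plus_mor_gen U P).
Proof.
apply: brel_union_respects => W X Y p q /splus_part_union[p' [q' U]].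
exact: tens_sym_union_l U.
Qed.

Lemma plus_mor_gen_r U : respects (@prel _ _ _ F H) (plus_mor_gen U).
Proof.
apply: union_additive_respects; first exact: tens_sym_union.
exact: tens_sym_add.
Qed.

Definition plus_mor (a : bgrp G H) (x : plus_car F H) : plus_car F G :=
  plift2 plus_mor_gen_l plus_mor_gen_r a x.

Lemma plus_mor_zmod a : zmod_morphism (plus_mor a).
Proof. by move=> x y; rewrite /plus_mor plift2Dr plift2Nr. Qed.

Lemma plus_mor_scalable a : scalable (plus_mor a).
Proof.
move=> r x; rewrite /plus_mor; elim/pres_ind: a => [|U|a b ea eb|a ea].
- by rewrite !plift20l scaler0.
- elim/plus_car_gen: x => [|X s|x y ex ey|x ex].
  + by rewrite scaler0 !plift20r scaler0.
  + by rewrite scale_psym !plift2_gen; exact: tens_sym_scale.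
  + by rewrite scalerDr !plift2Dr ex ey scalerDr.
  + by rewrite scalerN !plift2Nr ex scalerN.
- by rewrite !plift2Dl ea eb scalerDr.
- by rewrite !plift2Nl ea scalerN.
Qed.

HB.instance Definition _ a := GRing.isZmodMorphism.Build
  (plus_car F H) (plus_car F G) (plus_mor a) (plus_mor_zmod a).
HB.instance Definition _ a := GRing.isScalable.Build R
  (plus_car F H) (plus_car F G) *:%R (plus_mor a) (plus_mor_scalable a).

Lemma plus_morD a b x : plus_mor (a + b) x = plus_mor a x + plus_mor b x.
Proof. exact: plift2Dl. Qed.

Lemma plus_morN a x : plus_mor (- a) x = - plus_mor a x.
Proof. exact: plift2Nl. Qed.

Lemma plus_mor0 x : plus_mor 0 x = 0.
Proof. exact: plift20l. Qed.

Lemma plus_mor_bcls (U : biset G H) (hU : splus_set S U) (X : gset_in H)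
    (s : gsec F X) :
  plus_mor (bcls U) (psym s) = psym (tens_sec hS hU s).
Proof.
rewrite /plus_mor plift2_gen /plus_mor_gen; apply/esym.
apply: (tens_sym_iso hS hU _ (Gpair s) (splus_val_emb U)) => u.
exact: splus_val_surj.
Qed.
End Additive.

Lemma splus_gcosets (G H : obj GG) (D : {group ogT G * ogT H}) :
  Splus S G H D -> splus_set S (gcosets (setX_group G H) D).
Proof.
move=> PD u; have [x xGH ->] := gbase_trans u.
rewrite stab_lmul // stab_gbase; last exact: (smem_sub PD).
by apply: (Splus_conj hS PD); rewrite groupV.
Qed.

Section Functoriality.
Variable F : green (Sminus S) R.

Lemma plus_mor_id (G : obj GG) (x : plus_car F G) : plus_mor (bid G) x = x.
Proof.
elim/plus_car_gen: x => [|X s|x y ex ey|x ex];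
  [exact: raddf0| |by rewrite raddfD /= ex ey|by rewrite raddfN /= ex].
rewrite bid_Delta; have SD := Sminus_plus (Sminus_id hS G).
have DE a b : ((a, b) \in Delta_group G) = (a \in (G : {group _})) && (b == id a).
  by rewrite mem_Delta andbC eq_sym.
have sD := smem_sub SD.
rewrite /btrans (plus_mor_bcls (splus_gcosets SD)).
apply: (psym_eq (X := tens_set hS (splus_gcosets SD) X) (Y := X)
  (p := tensx_cl (gbase (setX_group G G) (Delta_group G))) (q := fun x : X => x)).
- exact: (graph_base_surj sD DE).
- by move=> y; exists y.
- by move=> x x'; split=> [/(graph_base_inj sD DE)|->].
- by move=> a x aG; exists (a ** x); rewrite (graph_base_lmul sD DE).
move=> x e; rewrite tens_secE; apply: sv_stab_cast => // a b.
rewrite mem_stab_cut mem_stab_gbase // mem_Delta -andbA.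
case: eqP => [->|//]; rewrite !andTb; apply/andP/idP => [[]//|bx]; split=> //.
exact: (subsetP (stab_sub x) _ bx).
Qed.

Lemma splus_tens (G H K : obj GG) (U : biset G H) (V : biset H K) :
  splus_set S U -> splus_set S V -> splus_set S (tens U V).
Proof.
move=> hU hV w; have [u [v <-]] := tens_cl_surj w.
by rewrite stab_tens; apply: Splus_star.
Qed.

Lemma tensx_assocP (G H K : obj GG) (U : biset G H) (V : biset H K) (X : gset K)
    (u u' : U) (v v' : V) (x x' : X) :
  tensx_cl (tens_cl u v) x = tensx_cl (tens_cl u' v') x' <->
  tensx_cl u (tensx_cl v x) = tensx_cl u' (tensx_cl v' x').
Proof.
split=> [/tensx_clP[k kK [/esym + ->]]|/tensx_clP[h hH [-> /esym]]].
  rewrite tens_cl_lmul // lmul1 => /tens_clP[h hH [-> ->]].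
  rewrite -lmul_pair' // lmul_pair // tensx_clE // -tensx_cl_lmul //.
  by rewrite tensx_clE.
rewrite tensx_cl_lmul // => /tensx_clP[k kK [-> ->]].
rewrite -lmul_pair // lmul_pair' // tens_clE //.
have -> : tens_cl u ((1%g, k) ** v) = (1%g, k) ** tens_cl u v.
  by rewrite tens_cl_lmul // lmul1.
by rewrite tensx_clE.
Qed.

(** At representatives the values agree because (G x K_x)_{[u,v]} is the star of (G x H_{[v,x]})_u
    with (H x K_x)_v. *)
Lemma tens_sym_comp (G H K : obj GG) (U : biset G H) (V : biset H K)
    (hU : splus_set S U) (hV : splus_set S V) (hUV : splus_set S (tens U V))
    (X : gset_in K) (s : gsec F X) :
  psym (tens_sec hS hUV s) = psym (tens_sec hS hU (tens_sec hS hV s)).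
Proof.
apply: (psym_eq (X := tens_set hS hUV X)
  (Y := tens_set hS hU (tens_set hS hV X))
  (p := fun z : U * V * X => tensx_cl (tens_cl z.1.1 z.1.2) z.2)
  (q := fun z : U * V * X => tensx_cl z.1.1 (tensx_cl z.1.2 z.2))).
- move=> w; have [t [x <-]] := tensx_cl_surj w.
  by have [u [v <-]] := tens_cl_surj t; exists (u, v, x).
- move=> w; have [u [t <-]] := tensx_cl_surj w.
  by have [v [x <-]] := tensx_cl_surj t; exists (u, v, x).
- by move=> z z'; apply: tensx_assocP.
- move=> a [[u v] x] aG; exists ((a, 1%g) ** u, v, x); split.
    rewrite tensx_cl_lmul // tens_cl_lmul //.
    by rewrite lmul1.
  by rewrite tensx_cl_lmul.
case=> -[u v] x e; rewrite !tens_secE {2}/tens_val tens_secE.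
have S1 := @Sminus_stab_cut _ _ hS _ _ U hU (tens_set hS hV X)
  (tensx_cl u (tensx_cl v x)) u (tensx_cl v x) erefl.
have S2 := @Sminus_stab_cut _ _ hS _ _ V hV X (tensx_cl v x) v x erefl.
rewrite (gmor_Sminus _ S1 S2 (D' := stab_cut (tens_cl u v) x)); last first.
  move=> a c; rewrite mem_stab_cut stab_tens; split.
    move=> /andP[/mem_star[b abu bcv] cx]; exists b; rewrite mem_stab_cut ?bcv //.
    rewrite abu stab_tensx; apply/mem_starl; exists c => //.
  move=> [b]; rewrite !mem_stab_cut => /andP[abu _] /andP[bcv ->].
  by rewrite andbT; apply/mem_star; exists b.
exact: sv_stab_gmor.
Qed.

Lemma in_hom_plus_comp (G H K : obj GG) (a : bgrp G H) (b : bgrp H K) :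
  in_hom (Splus S) a -> in_hom (Splus S) b -> in_hom (Splus S) (bcomp a b).
Proof.
apply: in_hom_bcomp; [exact: Splus_conj|exact: Splus_conj|exact: Splus_star].
Qed.

Lemma plus_mor_comp (G H K : obj GG) (a : bgrp G H) (b : bgrp H K)
    (x : plus_car F K) :
  in_hom (Splus S) a -> in_hom (Splus S) b ->
  plus_mor (bcomp a b) x = plus_mor a (plus_mor b x).
Proof.
move=> ha hb; elim/plus_car_gen: x => [|X s|x y ex ey|x ex].
- by rewrite !raddf0.
- elim: ha => [|a1 a2 _ e1 _ e2|D PD]; first by rewrite bcomp0l !plus_mor0.
    by rewrite bcompDl bcompNl !plus_morD !plus_morN e1 e2.
  elim: hb => [|b1 b2 _ e1 _ e2|E PE].
  - by rewrite bcomp0r !plus_mor0 raddf0.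
  - by rewrite bcompDr bcompNr !plus_morD !plus_morN e1 e2 raddfB.
  have hD := splus_gcosets PD; have hE := splus_gcosets PE.
  rewrite bcompE (plus_mor_bcls (splus_tens hD hE)) (plus_mor_bcls hE).
  by rewrite (plus_mor_bcls hD) tens_sym_comp.
- by rewrite !raddfD /= ex ey.
- by rewrite !raddfN /= ex.
Qed.

Definition plus_bfun : bfun_on (Splus S) (plus_mod F) :=
  @BfunOn GG (Splus S) R (plus_mod F)
    (fun G H a => plus_mor a : {linear plus_car F H -> plus_car F G})
    (fun G H a b x _ _ => plus_morD a b x) plus_mor_id
    (fun G H K a b x => @plus_mor_comp G H K a b x).

Lemma plus_bfun_morE (G H : obj GG) (U : biset G H) (X : gset_in H) (s : gsec F X) :
  (forall u : U, Splus S G H (stab u)) ->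
  exists (i : forall w : tensx U X, gmem GG (stab w)) (t : gsec F (GsetIn i)),
    (forall (u : U) (x : X),
       t (tensx_cl u x) =
       gmor F (btrans (stabo (X := GsetIn i) (tensx_cl u x)) (stabo x)
                [group of stab u :&: setX G (stab x)]) (s x)) /\
    bmor plus_bfun (bcls U) (psym s) = psym t.
Proof.
move=> hU; exists (tens_in hS hU (X := X)), (tens_sec hS hU s); split=> [u x|].
  exact: tens_secE.
exact: plus_mor_bcls.
Qed.

End Functoriality.
End PlusMor.

(** * The product of symbols *)

Section GreenMul.
Variables (GG : gclass) (T : sfam GG) (R : comPzRingType) (F : green T R).
Variable G : obj GG.

Lemma gmulA : associative (@gmul _ _ _ F G).
Proof. exact: amulA. Qed.

Lemma gmul1l : left_id (gone F G) (gmul F).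
Proof. exact: amul1l. Qed.

Lemma gmul1r : right_id (gone F G) (gmul F).
Proof. exact: amul1r. Qed.

Lemma sv_stab_Delta (X Y Z : gset_in G) (x : X) (y : Y) (z : Z) (a : F (stabo z)) :
  stab x = stab y ->
  same_value (gmor F (btrans (stabo x) (stabo z) (Delta_group (stab x))) a)
             (gmor F (btrans (stabo y) (stabo z) (Delta_group (stab y))) a).
Proof. by move=> e; apply: sv_stab_gmor => // b c; rewrite e. Qed.

Lemma sv_stab_gone (X Y : gset_in G) (x : X) (y : Y) : stab x = stab y ->
  same_value (gone F (stabo x)) (gone F (stabo y)).
Proof.
move=> e; rewrite /stabo; move: (gset_inP x) (gset_inP y).
rewrite -!/(stab _) e => p q; by rewrite (Prop_irrelevance p q).
Qed.

Lemma sv_whole (K : {group ogT G}) (pK : gmem GG K) (D : {group ogT G * ogT G})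
    (a : F G) :
  (K : {set _}) = G ->
  (forall b c, ((b, c) \in D) = (b == c) && (b \in (G : {group _}))) ->
  same_value (gmor F (btrans (@Obj GG _ K pK) G D) a) a.
Proof.
case: G K pK D a => gT H pH K pK D a /= /val_inj e DE; apply: sv_cast => //.
Qed.
End GreenMul.

Section GraphAlgebra.
Variables (GG : gclass) (T : sfam GG) (R : comPzRingType) (F : green T R).
Variables (A B : obj GG) (D : {group ogT A * ogT B}) (phi : ogT A -> ogT B).
Hypothesis TD : T A B D.
Hypothesis DE : forall a b,
  ((a, b) \in D) = (a \in (A : {group _})) && (b == phi a).

(** As D is closed under products, a bare function with graph D is multiplicative on A. The Green
    axioms thereby apply to any such D described by its elements. *)
Lemma graph_morphic : {in (A : {group _}) &, {morph phi : x y / (x * y)%g}}.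
Proof.
move=> a b aA bA; have h c : c \in (A : {group _}) -> (c, phi c) \in D.
  by move=> cA; rewrite DE cA eqxx.
have := groupM (h a aA) (h b bA).
rewrite [X in X \in _](_ : _ = (a * b, phi a * phi b)%g) //.
by rewrite DE => /andP[_ /eqP].
Qed.

Definition graph_morphism := Morphism graph_morphic.

Lemma graph_morphism_sub : (graph_morphism @* A \subset B)%g.
Proof.
apply/subsetP=> _ /morphimP[a _ aA ->] /=.
have : (a, phi a) \in D by rewrite DE aA eqxx.
by move/(subsetP (smem_sub TD)); rewrite in_setX => /andP[].
Qed.

Lemma graphr_morphism : graphr_group graph_morphism = D.
Proof.
apply/val_inj/setP=> -[a b]; rewrite [RHS]DE.
apply/imsetP/andP => [[c cA [-> ->]]|[aA /eqP ->]]; first by [].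
by exists a.
Qed.

Lemma gmor_graph1 : gmor F (btrans A B D) (gone F B) = gone F A.
Proof.
have := @green_res1 _ _ _ _ (gstr F) A B graph_morphism graph_morphism_sub.
by rewrite graphr_morphism; apply.
Qed.

Lemma gmor_graphM x y : gmor F (btrans A B D) (gmul F x y) =
  gmul F (gmor F (btrans A B D) x) (gmor F (btrans A B D) y).
Proof.
have := @green_resM _ _ _ _ (gstr F) A B graph_morphism graph_morphism_sub.
by rewrite graphr_morphism; apply.
Qed.

Variable E : {group ogT B * ogT A}.
Hypothesis TE : T B A E.
Hypothesis EE : forall a b, ((b, a) \in E) = ((a, b) \in D).

Lemma graphl_morphism : graphl_group graph_morphism = E.
Proof.
apply/val_inj/setP=> -[b a]; rewrite [RHS]EE DE.
apply/imsetP/andP => [[c cA [-> ->]]|[aA /eqP ->]]; first by [].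
by exists a.
Qed.

Lemma gmor_frobl a b : gmul F (gmor F (btrans B A E) a) b =
  gmor F (btrans B A E) (gmul F a (gmor F (btrans A B D) b)).
Proof.
have := @green_frobl _ _ _ _ (gstr F) A B graph_morphism graph_morphism_sub.
by rewrite graphr_morphism graphl_morphism; apply.
Qed.

Lemma gmor_frobr a b : gmul F b (gmor F (btrans B A E) a) =
  gmor F (btrans B A E) (gmul F (gmor F (btrans A B D) b) a).
Proof.
have := @green_frobr _ _ _ _ (gstr F) A B graph_morphism graph_morphism_sub.
by rewrite graphr_morphism graphl_morphism; apply.
Qed.
End GraphAlgebra.

(* The same statements in a form that unifies with [stabo x]. *)
Section SubgroupGraphAlgebra.
Variables (GG : gclass) (T : sfam GG) (R : comPzRingType) (F : green T R).
Variables (gT hT : finGroupType) (K : {group gT}) (L : {group hT}).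
Variables (pK : gmem GG K) (pL : gmem GG L).
Variables (D : {group gT * hT}) (phi : gT -> hT).
Hypothesis TD : T (Obj pK) (Obj pL) D.
Hypothesis DE : forall a b, ((a, b) \in D) = (a \in K) && (b == phi a).

Lemma gmor_sub1 : gmor F (btrans (Obj pK) (Obj pL) D) (gone F (Obj pL)) =
  gone F (Obj pK).
Proof. exact: (gmor_graph1 F TD DE). Qed.

Lemma gmor_subM x y : gmor F (btrans (Obj pK) (Obj pL) D) (gmul F x y) =
  gmul F (gmor F (btrans (Obj pK) (Obj pL) D) x)
         (gmor F (btrans (Obj pK) (Obj pL) D) y).
Proof. exact: (@gmor_graphM _ _ _ F (Obj pK) (Obj pL) D phi TD DE x y). Qed.

Variable E : {group hT * gT}.
Hypothesis TE : T (Obj pL) (Obj pK) E.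
Hypothesis EE : forall a b, ((b, a) \in E) = ((a, b) \in D).

Lemma gmor_sub_frobl a b : gmul F (gmor F (btrans (Obj pL) (Obj pK) E) a) b =
  gmor F (btrans (Obj pL) (Obj pK) E)
    (gmul F a (gmor F (btrans (Obj pK) (Obj pL) D) b)).
Proof. exact: (@gmor_frobl _ _ _ F (Obj pK) (Obj pL) D phi TD DE E TE EE a b). Qed.

Lemma gmor_sub_frobr a b : gmul F b (gmor F (btrans (Obj pL) (Obj pK) E) a) =
  gmor F (btrans (Obj pL) (Obj pK) E)
    (gmul F (gmor F (btrans (Obj pK) (Obj pL) D) b) a).
Proof. exact: (@gmor_frobr _ _ _ F (Obj pK) (Obj pL) D phi TD DE E TE EE a b). Qed.
End SubgroupGraphAlgebra.

Section Product.
Variables (GG : gclass) (S : sfam GG) (hS : axioms S) (R : comPzRingType).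
Variables (F : green (Sminus S) R).

Section OneGroup.
Variable G : obj GG.

Section StabMaps.
Variables (X Y : gset_in G) (x : X) (y : Y).

Lemma gmor_Delta1 : stab x \subset stab y ->
  gmor F (btrans (stabo x) (stabo y) (Delta_group (stab x))) (gone F (stabo y)) =
  gone F (stabo x).
Proof.
move=> sxy; apply: (@gmor_graph1 _ _ _ F (stabo x) (stabo y) _ id);
  first exact: Sminus_stab_Delta.
by move=> a b; rewrite [LHS]mem_Delta andbC eq_sym.
Qed.

Lemma gmor_DeltaM a b : stab x \subset stab y ->
  gmor F (btrans (stabo x) (stabo y) (Delta_group (stab x))) (gmul F a b) =
  gmul F (gmor F (btrans (stabo x) (stabo y) (Delta_group (stab x))) a)
         (gmor F (btrans (stabo x) (stabo y) (Delta_group (stab x))) b).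
Proof.
move=> sxy; apply: (@gmor_graphM _ _ _ F (stabo x) (stabo y) _ id);
  first exact: Sminus_stab_Delta.
by move=> c d; rewrite [LHS]mem_Delta andbC eq_sym.
Qed.

Lemma conjgraphE g c d : stab y = (stab x :^ g^-1)%G ->
  ((c, d) \in conjgraph_group g (stab x)) = (c \in stab y) && (d == c ^ g)%g.
Proof.
move=> e; rewrite mem_conjgraph e mem_conjgV.
apply/andP/andP => -[h /eqP e']; rewrite e' -conjgM ?mulVg ?mulgV conjg1 eqxx //.
Qed.

Lemma gmor_DeltaD (Z : gset_in G) (z : Z) a :
  stab x \subset stab y -> stab y \subset stab z ->
  gmor F (btrans (stabo x) (stabo y) (Delta_group (stab x)))
    (gmor F (btrans (stabo y) (stabo z) (Delta_group (stab y))) a) =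
  gmor F (btrans (stabo x) (stabo z) (Delta_group (stab x))) a.
Proof.
move=> sxy syz.
apply: (gmor_Sminus _ (Sminus_stab_Delta hS sxy) (Sminus_stab_Delta hS syz)).
move=> b c; rewrite mem_Delta; split=> [/andP[/eqP <- bx]|[d]].
  by exists b; rewrite !mem_Delta eqxx // (subsetP sxy).
by rewrite !mem_Delta => /andP[/eqP <- ->] /andP[-> _].
Qed.
End StabMaps.

(** By [conjgraphE] the conjugation graph is D^phi for phi(c) = g^-1 c g, from the stabilizer of gx
    to that of x, so condition (1) for Green functors applies. *)
Lemma gmor_conjM (X : gset_in G) (x : X) g a b : g \in (G : {group _}) ->
  gmor F (btrans (stabo (g ** x)) (stabo x) (conjgraph_group g (stab x))) (gmul F a b) =
  gmul F (gmor F (btrans (stabo (g ** x)) (stabo x) (conjgraph_group g (stab x))) a)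
   (gmor F (btrans (stabo (g ** x)) (stabo x) (conjgraph_group g (stab x))) b).
Proof.
move=> gG; apply: (@gmor_graphM _ _ _ F (stabo (g ** x)) (stabo x) _ (conjg^~ g));
  first exact: Sminus_stab_conj.
by move=> c d; apply: (conjgraphE (x := x) (y := g ** x)); rewrite stab_lmul.
Qed.

Lemma gptE (X Y : gset G) (x : X) (y : Y) a : a \in (G : {group _}) ->
  a ** gpt x y = gpt (a ** x) (a ** y).
Proof. by move=> aG; rewrite /gpt ginE. Qed.

Lemma gpt_inj (X Y : gset G) (x x' : X) (y y' : Y) :
  gpt x y = gpt x' y' <-> x = x' /\ y = y'.
Proof. by split=> [/(can_inj (ginK _ _))[-> ->]|[-> ->]]. Qed.

Lemma gpt_surj (X Y : gset G) (z : gprod X Y) : exists x, exists y, gpt x y = z.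
Proof.
by exists (gout z).1, (gout z).2; rewrite /gpt -[RHS]goutK; case: (gout z).
Qed.

Lemma stab_gpt (X Y : gset G) (x : X) (y : Y) :
  stab (gpt x y) = (stab x :&: stab y)%G.
Proof.
apply/val_inj/setP=> a; rewrite [LHS]in_stab in_setI [in RHS]in_stab [in RHS]in_stab.
case aG: (a \in _) => //=; rewrite gptE //.
apply/eqP/andP => [/gpt_inj[/eqP -> /eqP ->]//|[/eqP ex /eqP ey]].
exact/gpt_inj.
Qed.

Lemma stab_gptl (X Y : gset G) (x : X) (y : Y) : stab (gpt x y) \subset stab x.
Proof. by rewrite stab_gpt subsetIl. Qed.

Lemma stab_gptr (X Y : gset G) (x : X) (y : Y) : stab (gpt x y) \subset stab y.
Proof. by rewrite stab_gpt subsetIr. Qed.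

Section ProductSection.
Variables X Y : gset_in G.

Lemma gprod_in (z : gprod X Y) : gmem GG (stab z).
Proof.
have [x [y <-]] := gpt_surj z; rewrite stab_gpt.
apply: (gmem_setI hS (stab_sub x) (stab_sub y)); exact: gset_inP.
Qed.

Definition prod_set : gset_in G := GsetIn gprod_in.

Definition gfst (z : prod_set) : X := (gout z).1.
Definition gsnd (z : prod_set) : Y := (gout z).2.

Lemma gfstE x y : gfst (gpt x y) = x. Proof. by rewrite /gfst ginK. Qed.
Lemma gsndE x y : gsnd (gpt x y) = y. Proof. by rewrite /gsnd ginK. Qed.

Lemma gfst_lmul a z : a \in (G : {group _}) -> gfst (a ** z) = a ** gfst z.
Proof. by move=> aG; rewrite /gfst goutE. Qed.

Lemma gsnd_lmul a z : a \in (G : {group _}) -> gsnd (a ** z) = a ** gsnd z.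
Proof. by move=> aG; rewrite /gsnd goutE. Qed.

Lemma stab_gfst z : stab z \subset stab (gfst z).
Proof.
apply/subsetP=> a; rewrite !in_stab => /andP[aG /eqP e].
by rewrite aG -gfst_lmul // e eqxx.
Qed.

Lemma stab_gsnd z : stab z \subset stab (gsnd z).
Proof.
apply/subsetP=> a; rewrite !in_stab => /andP[aG /eqP e].
by rewrite aG -gsnd_lmul // e eqxx.
Qed.

Variables (s : gsec F X) (t : gsec F Y).

Definition prod_val (z : prod_set) (x : X) (y : Y) : F (stabo z) :=
  gmul F (gmor F (btrans (stabo z) (stabo x) (Delta_group (stab z))) (s x))
         (gmor F (btrans (stabo z) (stabo y) (Delta_group (stab z))) (t y)).

(** Conjugation commutes with restriction and is multiplicative. *)
Lemma prod_is_section : is_section (fun z => prod_val z (gfst z) (gsnd z)).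
Proof.
move=> g z gG; rewrite gfst_lmul // gsnd_lmul // /prod_val !secP //.
rewrite (gmor_Delta_conj hS _ gG (stab_gfst z)).
rewrite (gmor_Delta_conj hS _ gG (stab_gsnd z)).
exact/esym/gmor_conjM.
Qed.

Definition prod_sec : gsec F prod_set := Gsec prod_is_section.

Lemma prod_secE x y : prod_sec (gpt x y) = prod_val (gpt x y) x y.
Proof. by rewrite /= gfstE gsndE. Qed.
End ProductSection.

Definition mul_gen (P Q : gpair F G) : plus_car F G :=
  psym (prod_sec (gp_sec P) (gp_sec Q)).

Section ProductMap.
Variables (X X' Y Y' : gset_in G) (p : X -> X') (q : Y -> Y').
Hypotheses (pe : gemb p) (qe : gemb q).

Definition gprod_map (z : gprod X Y) : gprod X' Y' :=
  gpt (p (gout z).1) (q (gout z).2).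

Lemma gprod_mapE x y : gprod_map (gpt x y) = gpt (p x) (q y).
Proof. by rewrite /gprod_map ginK. Qed.

Lemma gprod_map_emb : gemb gprod_map.
Proof.
split=> [z z'|a z aG].
  have [x [y <-]] := gpt_surj z; have [x' [y' <-]] := gpt_surj z'.
  by rewrite !gprod_mapE => /gpt_inj[/pe.1 -> /qe.1 ->].
have [x [y <-]] := gpt_surj z.
by rewrite gptE // !gprod_mapE gptE // pe.2 // qe.2.
Qed.

Lemma prod_sec_map (s : gsec F X) (t : gsec F Y) (s' : gsec F X') (t' : gsec F Y') :
  (forall x, same_value (s' (p x)) (s x)) ->
  (forall y, same_value (t' (q y)) (t y)) -> forall z : prod_set X Y,
  same_value (prod_sec s' t' (gprod_map z : prod_set X' Y')) (prod_sec s t z).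
Proof.
move=> ss tt z; have [x [y <-]] := gpt_surj z.
have e := stab_emb (gpt x y) gprod_map_emb; rewrite gprod_mapE in e *.
rewrite !prod_secE; apply: sv_stab_gmul; first exact: e.
  by apply: sv_stab_gmor; rewrite ?(stab_emb x pe) // => a b; rewrite e.
by apply: sv_stab_gmor; rewrite ?(stab_emb y qe) // => a b; rewrite e.
Qed.
End ProductMap.

Lemma mul_gen_union_l Q : union_additive (fun P => mul_gen P Q).
Proof.
case: Q => Z u W X Y w s t p q [pe qe dis cov] ws wt.
have ie := gemb_id Z.
apply: (@psym_union _ _ hS _ F G (prod_set W Z) (prod_set X Z) (prod_set Y Z)
  (prod_sec w u) (prod_sec s u) (prod_sec t u)
  (gprod_map p (fun z : Z => z)) (gprod_map q (fun z : Z => z))).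
- split; first exact: gprod_map_emb.
  + exact: gprod_map_emb.
  + by move=> z z' /gpt_inj[/dis].
  move=> z; have [a [b <-]] := gpt_surj z.
  by case: (cov a) => -[x <-]; [left|right]; exists (gpt x b); rewrite gprod_mapE.
- exact: prod_sec_map.
exact: prod_sec_map.
Qed.

Lemma mul_gen_union_r P : union_additive (mul_gen P).
Proof.
case: P => Z u W X Y w s t p q [pe qe dis cov] ws wt.
have ie := gemb_id Z.
apply: (@psym_union _ _ hS _ F G (prod_set Z W) (prod_set Z X) (prod_set Z Y)
  (prod_sec u w) (prod_sec u s) (prod_sec u t)
  (gprod_map (fun z : Z => z) p) (gprod_map (fun z : Z => z) q)).
- split; first exact: gprod_map_emb.
  + exact: gprod_map_emb.
  + by move=> z z' /gpt_inj[_ /dis].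
  move=> z; have [a [b <-]] := gpt_surj z.
  by case: (cov b) => -[x <-]; [left|right]; exists (gpt a x); rewrite gprod_mapE.
- exact: prod_sec_map.
exact: prod_sec_map.
Qed.

Lemma mul_gen_add_l Q : section_additive (fun P => mul_gen P Q).
Proof.
move=> X s u; rewrite -(psym_add (prod_sec s (gp_sec Q))); congr psym.
apply: gsecP => z; rewrite -[RHS]amulDl; congr (amul _ _ _).
exact: (raddfD (gmor F _)).
Qed.

Lemma mul_gen_add_r P : section_additive (mul_gen P).
Proof.
move=> X s u; rewrite -(psym_add (prod_sec (gp_sec P) s)); congr psym.
apply: gsecP => z; rewrite -[RHS]amulDr; congr (amul _ _ _).
exact: (raddfD (gmor F _)).
Qed.

Definition plus_mul (x y : plus_car F G) : plus_car F G :=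
  plift2 (fun Q => union_additive_respects (mul_gen_union_l Q) (mul_gen_add_l Q))
         (fun P => union_additive_respects (mul_gen_union_r P) (mul_gen_add_r P))
    x y.

Lemma plus_mul_sym (X Y : gset_in G) (s : gsec F X) (t : gsec F Y) :
  plus_mul (psym s) (psym t) = psym (prod_sec s t).
Proof. exact: plift2_gen. Qed.

Lemma plus_mulDl : left_distributive plus_mul +%R.
Proof. by move=> x y z; apply: plift2Dl. Qed.

Lemma plus_mulDr : right_distributive plus_mul +%R.
Proof. by move=> x y z; apply: plift2Dr. Qed.

Lemma plus_mulNl x y : plus_mul (- x) y = - plus_mul x y.
Proof. exact: plift2Nl. Qed.

Lemma plus_mulNr x y : plus_mul x (- y) = - plus_mul x y.
Proof. exact: plift2Nr. Qed.

Lemma plus_mul0l y : plus_mul 0 y = 0.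
Proof. exact: plift20l. Qed.

Lemma plus_mul0r x : plus_mul x 0 = 0.
Proof. exact: plift20r. Qed.

Lemma plus_mulA : associative plus_mul.
Proof.
move=> x y z; elim/plus_car_gen: x => [|X s|x x' e e'|x e].
- by rewrite !plus_mul0l.
- elim/plus_car_gen: y => [|Y t|y y' e e'|y e].
  + by rewrite !(plus_mul0l, plus_mul0r).
  + elim/plus_car_gen: z => [|Z u|z z' e e'|z e].
    * by rewrite !plus_mul0r.
    * rewrite !plus_mul_sym; apply: (psym_eq (X := prod_set X (prod_set Y Z))
        (Y := prod_set (prod_set X Y) Z)
        (p := fun v : X * Y * Z => gpt v.1.1 (gpt v.1.2 v.2))
        (q := fun v : X * Y * Z => gpt (gpt v.1.1 v.1.2) v.2)).
      - move=> v; have [a [w <-]] := gpt_surj v; have [b [c <-]] := gpt_surj w.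
        by exists (a, b, c).
      - move=> v; have [w [c <-]] := gpt_surj v; have [a [b <-]] := gpt_surj w.
        by exists (a, b, c).
      - move=> [[a b] c] [[a' b'] c']; split.
          by move=> /gpt_inj[/= -> /gpt_inj[-> ->]].
        by move=> /gpt_inj[/= /gpt_inj[-> ->] ->].
      - by move=> g [[a b] c] gG; exists (g ** a, g ** b, g ** c); rewrite !gptE.
      move=> [[a b] c] e; rewrite !prod_secE /prod_val !prod_secE /prod_val.
      have sr := stab_gptr (X := X) (Y := gprod Y Z).
      have sl := stab_gptl (X := gprod X Y) (Y := Z).
      have [tl tr] := (stab_gptl (X := X) (Y := Y), stab_gptr (X := X) (Y := Y)).
      have [ul ur] := (stab_gptl (X := Y) (Y := Z), stab_gptr (X := Y) (Y := Z)).
      (* Restriction is multiplicative and transitive, so each side becomes the product of the three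
         values restricted directly to the stabilizer of the triple. *)
      rewrite (gmor_DeltaM (X := prod_set X (prod_set Y Z)) (Y := prod_set Y Z)) //.
      rewrite (gmor_DeltaM (X := prod_set (prod_set X Y) Z) (Y := prod_set X Y)) //.
      rewrite (gmor_DeltaD (X := prod_set X (prod_set Y Z)) (Y := prod_set Y Z)) //.
      rewrite (gmor_DeltaD (X := prod_set X (prod_set Y Z)) (Y := prod_set Y Z)) //.
      rewrite (gmor_DeltaD (X := prod_set (prod_set X Y) Z) (Y := prod_set X Y)) //.
      rewrite (gmor_DeltaD (X := prod_set (prod_set X Y) Z) (Y := prod_set X Y)) //.
      rewrite gmulA; apply: sv_stab_gmul => //; last exact: sv_stab_Delta.
      by apply: sv_stab_gmul => //; apply: sv_stab_Delta.
    * by rewrite !plus_mulDr e e'.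
    * by rewrite !plus_mulNr e.
  + by rewrite !(plus_mulDl, plus_mulDr) e e'.
  + by rewrite !(plus_mulNl, plus_mulNr) e.
- by rewrite !plus_mulDl e e'.
- by rewrite !plus_mulNl e.
Qed.

Definition gstar : gpoint G := gin _ _ tt.

Lemma gstarP (z : gpoint G) : z = gstar.
Proof. by rewrite -(goutK z) /gstar; case: (gout z). Qed.

Lemma stab_point (z : gpoint G) : stab z = G.
Proof.
apply/val_inj/setP=> a; rewrite [LHS]in_stab.
by rewrite [a ** z]gstarP [z in _ == z]gstarP eqxx andbT.
Qed.

Lemma point_in (z : gpoint G) : gmem GG (stab z).
Proof. by rewrite stab_point; apply: ogrpP. Qed.

Definition point_set : gset_in G := GsetIn point_in.

Section Point.
Variable a : F G.

(** Inner conjugation acts trivially on F(G): its graph is conjugate to Delta(G) in G x G, so both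
    define the same class. The diagonal transports a to F of the stabilizer, which equals G. *)
Lemma point_is_section : is_section (fun z : point_set =>
  gmor F (btrans (stabo z) G (Delta_group G)) a).
Proof.
move=> g z gG.
have Sz (y : point_set) : Sminus S (stabo y) G (Delta_group G).
  have sy : stab y \subset G by apply: stab_sub.
  have e : (Delta_group G : {set _}) = Delta (stab y) by rewrite stab_point.
  exact: (Sminus_DeltaG hS (gset_inP y) sy e).
rewrite (@gmor_star _ _ _ F (stabo (g ** z)) (stabo z) G _ _ (conjgraph_group g G)).
- have e : conjgraph_group g G = (Delta_group G :^ (g^-1%g, 1%g))%G.
    exact/val_inj/esym/Delta_conj.
  rewrite e btrans_conj //; first exact: smem_sub (Sz _).
  have : (g^-1, 1)%g \in setX (stab (g ** z)) G.
    by rewrite stab_point in_setX group1 groupV gG.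
  exact.
- exact: Sminus_stab_conj.
- exact: Sz.
- move=> b bz; have bG : b \in stab z by exact: bz.
  by rewrite stab_point in bG; exists b; rewrite mem_Delta eqxx.
move=> b c; rewrite mem_conjgraph; split=> [/andP[cG /eqP ->]|[d]].
  exists c; last by rewrite mem_Delta eqxx.
  by rewrite mem_conjgraph stab_point cG eqxx.
rewrite mem_conjgraph stab_point => /andP[dG e].
by rewrite mem_Delta => /andP[/eqP <- _]; rewrite dG.
Qed.

Definition point_sec : gsec F point_set := Gsec point_is_section.

Lemma point_secE z : same_value (point_sec z) a.
Proof.
by apply: sv_whole => [|b c]; [exact: (congr1 val (stab_point z))|rewrite mem_Delta].
Qed.
End Point.

Lemma point_sec1 z : point_sec (gone F G) z = gone F (stabo z).
Proof.
have sz : stab z \subset G by rewrite stab_sub.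
have e : (Delta_group G : {set _}) = Delta (stab z) by rewrite stab_point.
have SD := Sminus_DeltaG hS (gset_inP z) sz e.
apply: (@gmor_graph1 _ _ _ F (stabo z) G _ id SD) => b c.
have -> : (b \in (stabo z : {group _})) = (b \in stab z) by [].
by rewrite mem_Delta andbC eq_sym stab_point.
Qed.

Definition plus_one : plus_car F G := psym (point_sec (gone F G)).

Lemma plus_mul1l : left_id plus_one plus_mul.
Proof.
move=> x; elim/plus_car_gen: x => [|X s|x x' e e'|x e].
- by rewrite plus_mul0r.
- rewrite plus_mul_sym; apply: (psym_eq (X := prod_set point_set X) (Y := X)
    (p := fun x : X => gpt gstar x) (q := fun x : X => x)).
  + by move=> z; have [y [x <-]] := gpt_surj z; exists x; rewrite (gstarP y).
  + by move=> x; exists x.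
  + by move=> x x'; split=> [/gpt_inj[_ ->]|->].
  + by move=> a x aG; exists (a ** x); rewrite gptE // [a ** gstar]gstarP.
  move=> x e; rewrite prod_secE /prod_val point_sec1.
  rewrite (gmor_Delta1 (X := prod_set point_set X) (Y := point_set)) ?stab_gptl //.
  rewrite gmul1l; apply: sv_stab_cast => // b c.
  by rewrite [LHS]mem_Delta e.
- by rewrite plus_mulDr e e'.
- by rewrite plus_mulNr e.
Qed.

Lemma plus_mul1r : right_id plus_one plus_mul.
Proof.
move=> x; elim/plus_car_gen: x => [|X s|x x' e e'|x e].
- by rewrite plus_mul0l.
- rewrite plus_mul_sym; apply: (psym_eq (X := prod_set X point_set) (Y := X)
    (p := fun x : X => gpt x gstar) (q := fun x : X => x)).
  + by move=> z; have [x [y <-]] := gpt_surj z; exists x; rewrite (gstarP y).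
  + by move=> x; exists x.
  + by move=> x x'; split=> [/gpt_inj[-> _]|->].
  + by move=> a x aG; exists (a ** x); rewrite gptE // [a ** gstar]gstarP.
  move=> x e; rewrite prod_secE /prod_val point_sec1.
  rewrite (gmor_Delta1 (X := prod_set X point_set) (Y := point_set)) ?stab_gptr //.
  rewrite gmul1r; apply: sv_stab_cast => // b c.
  by rewrite [LHS]mem_Delta e.
- by rewrite plus_mulDl e e'.
- by rewrite plus_mulNl e.
Qed.

Lemma plus_mulZl r x y : plus_mul (r *: x) y = r *: plus_mul x y.
Proof.
elim/plus_car_gen: x => [|X s|x x' e e'|x e].
- by rewrite scaler0 !plus_mul0l scaler0.
- elim/plus_car_gen: y => [|Y t|y y' e e'|y e].
  + by rewrite !plus_mul0r scaler0.
  + rewrite scale_psym !plus_mul_sym scale_psym; congr psym; apply: gsecP => z.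
    rewrite -[RHS]amulZl; congr (amul _ _ _); exact: (linearZ_LR (gmor F _)).
  + by rewrite !plus_mulDr e e' scalerDr.
  + by rewrite !plus_mulNr e scalerN.
- by rewrite scalerDr !plus_mulDl e e' scalerDr.
- by rewrite scalerN !plus_mulNl e scalerN.
Qed.

Lemma plus_mulZr r x y : plus_mul x (r *: y) = r *: plus_mul x y.
Proof.
elim/plus_car_gen: y => [|Y t|y y' e e'|y e].
- by rewrite scaler0 !plus_mul0r scaler0.
- elim/plus_car_gen: x => [|X s|x x' e e'|x e].
  + by rewrite !plus_mul0l scaler0.
  + rewrite scale_psym !plus_mul_sym scale_psym; congr psym; apply: gsecP => z.
    rewrite -[RHS]amulZr; congr (amul _ _ _); exact: (linearZ_LR (gmor F _)).
  + by rewrite !plus_mulDl e e' scalerDr.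
  + by rewrite !plus_mulNl e scalerN.
- by rewrite scalerDr !plus_mulDr e e' scalerDr.
- by rewrite scalerN !plus_mulNr e scalerN.
Qed.

Definition plus_alg : alg_on (plus_mod F G) :=
  @AlgOn R (plus_mod F G) plus_mul plus_one plus_mulA plus_mul1l plus_mul1r
    plus_mulDl plus_mulDr plus_mulZl plus_mulZr.

End OneGroup.
End Product.

(** * Compatibility with restriction and induction *)

Section PlusGreen.
Variables (GG : gclass) (S : sfam GG) (hS : axioms S) (R : comPzRingType).
Variables (F : green (Sminus S) R).

Section Restriction.
Variables (H K : obj GG) (D : {group ogT H * ogT K}) (phi : ogT H -> ogT K).
Hypothesis PD : Splus S H K D.
Hypothesis DE : forall a b,
  ((a, b) \in D) = (a \in (H : {group _})) && (b == phi a).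
Let sD := smem_sub PD.
Let hD := splus_gcosets hS PD.
Let o := gbase (setX_group H K) D.

Definition graph_restr (L : {group ogT H}) : {group ogT H * ogT K} :=
  (D :&: setX_group L K)%G.

Lemma graph_restrE (L : {group ogT H}) : L \subset H -> forall a b,
  ((a, b) \in graph_restr L) = (a \in L) && (b == phi a).
Proof.
move=> sL a b; rewrite in_setI in_setX DE; apply/idP/idP => /andP[].
  by move=> /andP[_ ->] /andP[-> _].
move=> aL /eqP ->; have aH := subsetP sL a aL.
by rewrite aH eqxx aL (graph_in sD DE).
Qed.

(** The group (H x K_x)_o is the graph of phi on the stabilizer of [o,x]; hence the values of the
    transferred section arise from algebra homomorphisms of F. *)
Lemma graph_cutE (X : gset K) (x : X) a b :
  ((a, b) \in stab_cut o x) = (a \in stab (tensx_cl o x)) && (b == phi a).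
Proof.
rewrite mem_stab_cut mem_stab_gbase // DE stab_tensx.
apply/idP/idP.
  move=> /andP[/andP[aH /eqP ->] bx]; rewrite eqxx andbT.
  by apply/mem_starl; exists (phi a); rewrite // mem_stab_gbase // DE aH eqxx.
move=> /andP[/mem_starl[k kx]]; rewrite mem_stab_gbase // DE => /andP[-> /eqP e].
by move=> /eqP ->; rewrite eqxx -e.
Qed.

Lemma graph_cut_Sminus (X : gset_in K) (x : X) :
  Sminus S (stabo (X := tens_set hS hD X) (tensx_cl o x)) (stabo x) (stab_cut o x).
Proof.
exact: (@Sminus_stab_cut _ _ hS _ _ _ hD X (tensx_cl o x) o x erefl).
Qed.

Lemma plus_res1 : plus_mor hS (btrans H K D) (plus_one hS F K) = plus_one hS F H.
Proof.
rewrite /plus_one /btrans (plus_mor_bcls hS hD).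
apply: (psym_eq (X := tens_set hS hD (point_set K)) (Y := point_set H)
  (p := fun _ : unit => tensx_cl o (gstar K)) (q := fun=> gstar H)).
- move=> w; have [x <-] := graph_base_surj sD DE w.
  by exists tt; rewrite (gstarP x).
- by move=> y; exists tt; rewrite (gstarP y).
- by [].
- move=> a _ aH; exists tt.
  by rewrite (graph_base_lmul sD DE) // [_ ** gstar K]gstarP [_ ** gstar H]gstarP.
move=> _ e; rewrite tens_secE /tens_val !point_sec1.
rewrite (gmor_sub1 (phi := phi) _ (graph_cut_Sminus (gstar K : point_set K))).
  exact: sv_stab_gone.
exact: graph_cutE.
Qed.

Lemma graph_gptP (X Y : gset K) (x x' : X) (y y' : Y) :
  tensx_cl o (gpt x y) = tensx_cl o (gpt x' y') <->
  gpt (tensx_cl o x) (tensx_cl o y) = gpt (tensx_cl o x') (tensx_cl o y').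
Proof.
split=> e; first by have /gpt_inj[-> ->] := graph_base_inj sD DE e.
have [ex ey] := (iffLR (gpt_inj _ _ _ _)) e.
by rewrite (graph_base_inj sD DE ex) (graph_base_inj sD DE ey).
Qed.

(** Restricting X x Y along phi and multiplying the restrictions of X and Y both yield X x Y with H
    acting through phi. *)
Lemma plus_resM (x y : plus_car F K) :
  plus_mor hS (btrans H K D) (plus_mul hS x y) =
  plus_mul hS (plus_mor hS (btrans H K D) x) (plus_mor hS (btrans H K D) y).
Proof.
elim/plus_car_gen: x => [|X s|x x' e e'|x e].
- by rewrite plus_mul0l !raddf0 plus_mul0l.
- elim/plus_car_gen: y => [|Y t|y y' e e'|y e].
  + by rewrite plus_mul0r !raddf0 plus_mul0r.
  + rewrite /btrans plus_mul_sym !(plus_mor_bcls hS hD) plus_mul_sym.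
    apply: (psym_eq (X := tens_set hS hD (prod_set hS X Y))
      (Y := prod_set hS (tens_set hS hD X) (tens_set hS hD Y))
      (p := fun z : X * Y => tensx_cl o (gpt z.1 z.2))
      (q := fun z : X * Y => gpt (tensx_cl o z.1) (tensx_cl o z.2))).
    * move=> w; have [z <-] := graph_base_surj sD DE w.
      by have [x [y <-]] := gpt_surj z; exists (x, y).
    * move=> z; have [w [w' <-]] := gpt_surj z.
      have [x <-] := graph_base_surj sD DE w.
      by have [y <-] := graph_base_surj sD DE w'; exists (x, y).
    * by move=> z z'; apply: graph_gptP.
    * move=> a [x y] aH; exists (phi a ** x, phi a ** y); split.
        by rewrite (graph_base_lmul sD DE) // gptE // (graph_in sD DE).
      by rewrite gptE // !(graph_base_lmul sD DE).
    move=> [x y] e.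
    rewrite tens_secE /tens_val prod_secE prod_secE /prod_val !tens_secE /tens_val.
    have Sxy := graph_cut_Sminus (X := prod_set hS X Y) (gpt x y).
    rewrite (gmor_subM (phi := phi) Sxy); last exact: graph_cutE.
    have key (Z : gset_in K) (z : Z) (c : F (stabo z)) :
        stab (gpt x y) \subset stab z ->
        stab (gpt (tensx_cl o x : tens_set hS hD X) (tensx_cl o y : tens_set hS hD Y))
          \subset stab (tensx_cl o z) ->
      same_value
        (gmor F (btrans (stabo (X := tens_set hS hD (prod_set hS X Y)) (tensx_cl o (gpt x y)))
                    (stabo (X := prod_set hS X Y) (gpt x y)) (stab_cut o (gpt x y)))
          (gmor F (btrans (stabo (X := prod_set hS X Y) (gpt x y)) (stabo z)
                      (Delta_group (stab (gpt x y)))) c))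
        (gmor F (btrans (stabo (X := prod_set hS (tens_set hS hD X) (tens_set hS hD Y))
                      (gpt (tensx_cl o x) (tensx_cl o y)))
                    (stabo (X := tens_set hS hD Z) (tensx_cl o z))
             (Delta_group (stab (gpt (tensx_cl o x : tens_set hS hD X)
                                   (tensx_cl o y : tens_set hS hD Y)))))
           (gmor F (btrans (stabo (X := tens_set hS hD Z) (tensx_cl o z)) (stabo z)
              (stab_cut o z)) c)).
      move=> sz sz'.
      have Sz := graph_cut_Sminus z.
      have CE := graph_restrE (stab_sub (tensx_cl o (gpt x y))).
      have Sd := @Sminus_stab_Delta _ _ hS K (prod_set hS X Y) Z (gpt x y) z sz.
      have Sd' := @Sminus_stab_Delta _ _ hS H
        (prod_set hS (tens_set hS hD X) (tens_set hS hD Y)) (tens_set hS hD Z) _ _ sz'.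
      (* [C] is the graph of phi on the stabilizer of [o,(x,y)]; restricting to this stabilizer
         before or after passing along phi gives this one subgroup. *)
      pose C := graph_restr (stab (tensx_cl o (gpt x y))).
      rewrite (gmor_Sminus _ Sxy Sd (D' := C)); last first.
        move=> a b; rewrite CE; split=> [/andP[aw /eqP ->]|[b']].
          have apt : (a, phi a) \in stab_cut o (gpt x y) by rewrite graph_cutE aw eqxx.
          exists (phi a) => //; rewrite mem_Delta eqxx /=.
          by move: apt; rewrite mem_stab_cut => /andP[].
        by rewrite graph_cutE mem_Delta => h /andP[/eqP <- _].
      rewrite (gmor_Sminus _ Sd' Sz (D' := C)); last first.
        move=> a b; rewrite CE e; split=> [/andP[aw bE]|[b']].
          exists a; first by rewrite mem_Delta eqxx.
          by rewrite graph_cutE bE (subsetP sz').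
        by rewrite graph_cutE mem_Delta => /andP[/eqP <- ->] /andP[_ ->].
      exact: sv_stab_gmor.
    by apply: sv_stab_gmul => //; apply: key => //; rewrite ?stab_gptl ?stab_gptr.
  + by rewrite plus_mulDr !raddfD /= e e' plus_mulDr.
  + by rewrite plus_mulNr !raddfN /= e plus_mulNr.
- by rewrite plus_mulDl !raddfD /= e e' plus_mulDl.
- by rewrite plus_mulNl !raddfN /= e plus_mulNl.
Qed.

Section Frobenius.
Variable E : {group ogT K * ogT H}.
Hypothesis PE : Splus S K H E.
Hypothesis EE : forall a b, ((b, a) \in E) = ((a, b) \in D).
Let sE := smem_sub PE.
Let hE := splus_gcosets hS PE.
Let o' := gbase (setX_group K H) E.

Lemma EphiE a b : ((b, a) \in E) = (a \in (H : {group _})) && (b == phi a).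
Proof. by rewrite EE DE. Qed.

Lemma cograph_cutE (X : gset H) (x : X) a b :
  ((b, a) \in stab_cut o' x) = (a \in stab x) && (b == phi a).
Proof.
rewrite mem_stab_cut mem_stab_gbase // EphiE; apply/idP/idP => /andP[].
  by move=> /andP[_ ->] ->.
by move=> ax ->; rewrite ax (subsetP (stab_sub x)).
Qed.

Lemma mem_stab_cograph (X : gset H) (x : X) c :
  reflect (exists2 a, a \in stab x & c = phi a) (c \in stab (tensx_cl o' x)).
Proof.
rewrite stab_tensx; apply: (iffP (mem_starl _ _ _)) => -[a ax].
  by rewrite mem_stab_gbase // EphiE => /andP[_ /eqP ->]; exists a.
by move=> ->; exists a; rewrite // mem_stab_gbase // EphiE eqxx (subsetP (stab_sub x)).
Qed.

Section Values.
Variables (X U : gset_in H) (Y Z : gset_in K) (x : X) (u : U) (y : Y) (z : Z).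
Let w : tens_set hS hE U := tensx_cl o' u.
Let wx : tens_set hS hE X := tensx_cl o' x.
Let wy : tens_set hS hD Y := tensx_cl o y.
Hypothesis stabu : stab u = (stab x :&: stab wy)%G.
Hypothesis stabz : stab z = stab w.
Variables (a : F (stabo x)) (b : F (stabo y)).

(** In this section u stands for the pair of x and [o,y], and z for the pair of [o',x] and y. Only
    their stabilizers enter, so the same lemmas serve both orders of the factors. *)
Lemma frob_stab_ux : stab u \subset stab x.
Proof. by rewrite stabu subsetIl. Qed.

Lemma frob_stab_uy : stab u \subset stab wy.
Proof. by rewrite stabu subsetIr. Qed.

Lemma frob_stab_phi c : c \in stab u -> phi c \in stab y.
Proof.
move=> cu; have := subsetP frob_stab_uy c cu.
rewrite stab_tensx => /mem_starl[k ky].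
by rewrite mem_stab_gbase // DE => /andP[_ /eqP <-].
Qed.

Lemma frob_stab_wy : stab w \subset stab y.
Proof.
by apply/subsetP=> c /mem_stab_cograph[d du ->]; apply: frob_stab_phi.
Qed.

Lemma frob_stab_wx : stab w \subset stab wx.
Proof.
apply/subsetP=> c /mem_stab_cograph[d du ->]; apply/mem_stab_cograph.
by exists d => //; apply: (subsetP frob_stab_ux).
Qed.

Lemma frob_Sminus_graph : Sminus S (stabo u) (stabo w) (graph_restr (stab u)).
Proof.
have su : stab u \subset starl D (stab w).
  apply/subsetP=> c cu; apply/mem_starl; exists (phi c).
    by apply/mem_stab_cograph; exists c.
  by rewrite DE eqxx (subsetP (stab_sub u)).
apply: (Splus_restr hS (gset_inP u) (gset_inP w) PD (stab_sub w) su) => c d.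
rewrite (graph_restrE (stab_sub u)) DE.
change ((c \in stab u) && (d == phi c) =
  [&& c \in stab u, d \in stab w & (c \in (H : {group _})) && (d == phi c)]).
apply/idP/idP => [/andP[cu /eqP ->]|/and3P[-> _ /andP[_ ->]] //].
rewrite cu eqxx (subsetP (stab_sub u) _ cu) !andbT.
by apply/mem_stab_cograph; exists c.
Qed.

Lemma frob_Sminus_cograph : Sminus S (stabo w) (stabo u) (stab_cut o' u).
Proof. exact: (@Sminus_stab_cut _ _ hS _ _ _ hE U w o' u erefl). Qed.

(** Both composites are F of the opposite graph of phi on the stabilizer of u. *)
Lemma frob_valx :
  same_value
    (gmor F (btrans (stabo z) (stabo wx) (Delta_group (stab z)))
       (gmor F (btrans (stabo wx) (stabo x) (stab_cut o' x)) a))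
    (gmor F (btrans (stabo w) (stabo u) (stab_cut o' u))
       (gmor F (btrans (stabo u) (stabo x) (Delta_group (stab u))) a)).
Proof.
have szx : stab z \subset stab wx by rewrite stabz frob_stab_wx.
have Swx := @Sminus_stab_cut _ _ hS _ _ _ hE X wx o' x erefl.
rewrite (gmor_Sminus _ (Sminus_stab_Delta hS szx) Swx (D' := stab_cut o' u)).
  rewrite (gmor_Sminus _ frob_Sminus_cograph (Sminus_stab_Delta hS frob_stab_ux)
    (D' := stab_cut o' u)); first exact: sv_stab_gmor.
  move=> c d; split=> [|[d']].
    move=> cd; exists d => //; move: cd; rewrite cograph_cutE mem_Delta eqxx.
    by move=> /andP[].
  by rewrite mem_Delta => + /andP[/eqP <- _].
move=> c d; rewrite cograph_cutE; split=> [/andP[du /eqP ec]|[c']].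
  have cz : c \in stab z by rewrite stabz; apply/mem_stab_cograph; exists d.
  exists c; first by rewrite mem_Delta eqxx.
  by rewrite cograph_cutE ec eqxx (subsetP frob_stab_ux).
rewrite mem_Delta => /andP[/eqP <- cz]; rewrite cograph_cutE => /andP[dx e].
(* Besides fixing x, the element d fixes [o,y], since c = phi(d) fixes y; hence d lies in the
   stabilizer of u. *)
have cw : c \in stab w by rewrite -stabz.
have cy := subsetP frob_stab_wy c cw.
rewrite e andbT stabu; apply/setIP; split=> //.
rewrite stab_tensx; apply/mem_starl; exists c => //.
by rewrite mem_stab_gbase // DE e (subsetP (stab_sub x)).
Qed.

Lemma frob_valy :
  gmor F (btrans (stabo u) (stabo wy) (Delta_group (stab u)))
    (gmor F (btrans (stabo wy) (stabo y) (stab_cut o y)) b) =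
  gmor F (btrans (stabo u) (stabo w) (graph_restr (stab u)))
    (gmor F (btrans (stabo w) (stabo y) (Delta_group (stab w))) b).
Proof.
rewrite (gmor_Sminus _ (Sminus_stab_Delta hS frob_stab_uy) (graph_cut_Sminus y)
  (D' := graph_restr (stab u))).
  apply/esym.
  apply: (gmor_Sminus _ frob_Sminus_graph (Sminus_stab_Delta hS frob_stab_wy)) => c d.
  rewrite (graph_restrE (stab_sub u)); split=> [/andP[cu /eqP ->]|[d']].
    exists (phi c); first by rewrite (graph_restrE (stab_sub u)) cu eqxx.
    by rewrite mem_Delta eqxx; apply/mem_stab_cograph; exists c.
  by rewrite (graph_restrE (stab_sub u)) mem_Delta => h /andP[/eqP <- _].
move=> c d; rewrite (graph_restrE (stab_sub u)).
split=> [/andP[cu e]|[c']].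
  exists c; first by rewrite mem_Delta eqxx.
  by rewrite graph_cutE e (subsetP frob_stab_uy).
by rewrite mem_Delta graph_cutE => /andP[/eqP <- ->] /andP[_ ->].
Qed.

Lemma frob_cut c d : ((d, c) \in stab_cut o' u) = ((c, d) \in graph_restr (stab u)).
Proof. by rewrite cograph_cutE (graph_restrE (stab_sub u)). Qed.

(** This is condition (2) in F for phi from the stabilizer of u to that of w, whose graph and
    opposite graph both lie in S_-; [frob_valx] and [frob_valy] bring the factors to that form. *)
Lemma frob_val_l :
  same_value
    (gmul F (gmor F (btrans (stabo z) (stabo wx) (Delta_group (stab z)))
               (gmor F (btrans (stabo wx) (stabo x) (stab_cut o' x)) a))
            (gmor F (btrans (stabo z) (stabo y) (Delta_group (stab z))) b))
    (gmor F (btrans (stabo w) (stabo u) (stab_cut o' u))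
       (gmul F (gmor F (btrans (stabo u) (stabo x) (Delta_group (stab u))) a)
          (gmor F (btrans (stabo u) (stabo wy) (Delta_group (stab u)))
             (gmor F (btrans (stabo wy) (stabo y) (stab_cut o y)) b)))).
Proof.
rewrite frob_valy -(gmor_sub_frobl frob_Sminus_graph (graph_restrE (stab_sub u))
  frob_Sminus_cograph frob_cut).
apply: sv_stab_gmul => //; first exact: frob_valx.
exact: sv_stab_Delta.
Qed.

Lemma frob_val_r :
  same_value
    (gmul F (gmor F (btrans (stabo z) (stabo y) (Delta_group (stab z))) b)
            (gmor F (btrans (stabo z) (stabo wx) (Delta_group (stab z)))
               (gmor F (btrans (stabo wx) (stabo x) (stab_cut o' x)) a)))
    (gmor F (btrans (stabo w) (stabo u) (stab_cut o' u))
       (gmul F (gmor F (btrans (stabo u) (stabo wy) (Delta_group (stab u)))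
                  (gmor F (btrans (stabo wy) (stabo y) (stab_cut o y)) b))
          (gmor F (btrans (stabo u) (stabo x) (Delta_group (stab u))) a))).
Proof.
rewrite frob_valy -(gmor_sub_frobr frob_Sminus_graph (graph_restrE (stab_sub u))
  frob_Sminus_cograph frob_cut).
apply: sv_stab_gmul => //; last exact: frob_valx.
exact: sv_stab_Delta.
Qed.
End Values.

(** The product of Y with the K-set induced from X is compared with the K-set induced from X times
    the restriction of Y. On base classes either equality means k = phi(h), x' = h x and y' = phi(h)
    y for a single h. *)
Lemma frob_base_l (X : gset H) (Y : gset K) k (x x' : X) (y y' : Y) :
  k \in (K : {group _}) ->
  k ** gpt (tensx_cl o' x) y = gpt (tensx_cl o' x') y' <->
  k ** tensx_cl o' (gpt x (tensx_cl o y)) = tensx_cl o' (gpt x' (tensx_cl o y')).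
Proof.
move=> kK; rewrite gptE //; split=> [|/(cograph_baseP sE EphiE _ _ kK)[h hH [-> e]]].
  move=> /gpt_inj[/(cograph_baseP sE EphiE _ _ kK)[h hH [-> ->]] <-].
  apply/(cograph_baseP sE EphiE); first exact: (graph_in sD DE).
  by exists h => //; split=> //; rewrite gptE // (graph_base_lmul sD DE).
move: e; rewrite gptE // (graph_base_lmul sD DE) // => /gpt_inj[-> ey].
apply/gpt_inj; split; last by rewrite (graph_base_inj sD DE ey).
by apply/(cograph_baseP sE EphiE); [exact: (graph_in sD DE)|exists h].
Qed.

Lemma frob_base_r (X : gset H) (Y : gset K) k (x x' : X) (y y' : Y) :
  k \in (K : {group _}) ->
  k ** gpt y (tensx_cl o' x) = gpt y' (tensx_cl o' x') <->
  k ** tensx_cl o' (gpt (tensx_cl o y) x) = tensx_cl o' (gpt (tensx_cl o y') x').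
Proof.
move=> kK; rewrite gptE //; split=> [|/(cograph_baseP sE EphiE _ _ kK)[h hH [-> e]]].
  move=> /gpt_inj[<- /(cograph_baseP sE EphiE _ _ kK)[h hH [-> ->]]].
  apply/(cograph_baseP sE EphiE); first exact: (graph_in sD DE).
  by exists h => //; split=> //; rewrite gptE // (graph_base_lmul sD DE).
move: e; rewrite gptE // (graph_base_lmul sD DE) // => /gpt_inj[ey ->].
apply/gpt_inj; split; first by rewrite (graph_base_inj sD DE ey).
by apply/(cograph_baseP sE EphiE); [exact: (graph_in sD DE)|exists h].
Qed.

Lemma plus_frobl (x : plus_car F H) (y : plus_car F K) :
  plus_mul hS (plus_mor hS (btrans K H E) x) y =
  plus_mor hS (btrans K H E) (plus_mul hS x (plus_mor hS (btrans H K D) y)).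
Proof.
elim/plus_car_gen: x => [|X s|x x' e e'|x e].
- by rewrite plus_mul0l !raddf0 plus_mul0l.
- elim/plus_car_gen: y => [|Y t|y y' e e'|y e].
  + by rewrite !raddf0 !plus_mul0r raddf0.
  + rewrite /btrans (plus_mor_bcls hS hD) (plus_mor_bcls hS hE) !plus_mul_sym.
    rewrite (plus_mor_bcls hS hE).
    apply: (psym_eq_orbit (X := prod_set hS (tens_set hS hE X) Y)
      (Y := tens_set hS hE (prod_set hS X (tens_set hS hD Y)))
      (p := fun v : X * Y => gpt (tensx_cl o' v.1) v.2)
      (q := fun v : X * Y => tensx_cl o' (gpt v.1 (tensx_cl o v.2)))).
    * move=> z; have [w [y <-]] := gpt_surj z; have [k kK [x ->]] := base_surj w.
      exists k => //; exists (x, k^-1%g ** y).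
      by rewrite gptE // lmulKV.
    * move=> w; have [k kK [v ->]] := base_surj w; exists k => //.
      have [x [w' <-]] := gpt_surj v; have [y <-] := graph_base_surj sD DE w'.
      by exists (x, y).
    * by move=> k v v' kK; apply: frob_base_l.
    move=> [x y] e.
    rewrite [X in same_value X]prod_secE [X in same_value _ X]tens_secE.
    rewrite /prod_val /tens_val prod_secE /prod_val !tens_secE /tens_val.
    apply: (frob_val_l (U := prod_set hS X (tens_set hS hD Y))
      (Z := prod_set hS (tens_set hS hE X) Y)) => //.
    exact: stab_gpt.
  + by rewrite !(plus_mulDr, raddfD) /= e e'.
  + by rewrite !(plus_mulNr, raddfN) /= e.
- by rewrite !(plus_mulDl, raddfD) /= e e'.
- by rewrite !(plus_mulNl, raddfN) /= e.
Qed.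

Lemma plus_frobr (x : plus_car F H) (y : plus_car F K) :
  plus_mul hS y (plus_mor hS (btrans K H E) x) =
  plus_mor hS (btrans K H E) (plus_mul hS (plus_mor hS (btrans H K D) y) x).
Proof.
elim/plus_car_gen: x => [|X s|x x' e e'|x e].
- by rewrite plus_mul0r !raddf0 plus_mul0r.
- elim/plus_car_gen: y => [|Y t|y y' e e'|y e].
  + by rewrite !raddf0 !plus_mul0l raddf0.
  + rewrite /btrans (plus_mor_bcls hS hD) (plus_mor_bcls hS hE) !plus_mul_sym.
    rewrite (plus_mor_bcls hS hE).
    apply: (psym_eq_orbit (X := prod_set hS Y (tens_set hS hE X))
      (Y := tens_set hS hE (prod_set hS (tens_set hS hD Y) X))
      (p := fun v : X * Y => gpt v.2 (tensx_cl o' v.1))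
      (q := fun v : X * Y => tensx_cl o' (gpt (tensx_cl o v.2) v.1))).
    * move=> z; have [y [w <-]] := gpt_surj z; have [k kK [x ->]] := base_surj w.
      exists k => //; exists (x, k^-1%g ** y).
      by rewrite gptE // lmulKV.
    * move=> w; have [k kK [v ->]] := base_surj w; exists k => //.
      have [w' [x <-]] := gpt_surj v; have [y <-] := graph_base_surj sD DE w'.
      by exists (x, y).
    * by move=> k v v' kK; apply: frob_base_r.
    move=> [x y] e.
    rewrite [X in same_value X]prod_secE [X in same_value _ X]tens_secE.
    rewrite /prod_val /tens_val prod_secE /prod_val !tens_secE /tens_val.
    apply: (frob_val_r (U := prod_set hS (tens_set hS hD Y) X)
      (Z := prod_set hS Y (tens_set hS hE X))) => //.
    by apply: val_inj; rewrite stab_gpt; apply: setIC.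
  + by rewrite !(plus_mulDl, raddfD) /= e e'.
  + by rewrite !(plus_mulNl, raddfN) /= e.
- by rewrite !(plus_mulDr, raddfD) /= e e'.
- by rewrite !(plus_mulNr, raddfN) /= e.
Qed.

End Frobenius.
End Restriction.
End PlusGreen.

(** * The functor on morphisms *)

Section GhomTheory.
Variables (GG : gclass) (T : sfam GG) (R : comPzRingType) (F M : green T R).
Variable f : ghom F M.

Lemma gappD G x y : f G (x + y) = f G x + f G y.
Proof. by rewrite -[x]scale1r gapp_linear !scale1r. Qed.

Lemma gapp0 G : f G 0 = 0.
Proof. by apply: (addrI (f G 0)); rewrite -gappD !addr0. Qed.

Lemma gappZ G r x : f G (r *: x) = r *: f G x.
Proof. by rewrite -[r *: x]addr0 gapp_linear gapp0 addr0. Qed.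

Lemma gappN G x : f G (- x) = - f G x.
Proof. by rewrite -scaleN1r gappZ scaleN1r. Qed.

Lemma sv_gapp (A B : obj GG) (a : F A) (b : F B) :
  same_value a b -> same_value (f A a) (f B b).
Proof.
exact: (@congr1 _ _ (fun z : {A : obj GG & F A : Type} =>
  existT (fun A => M A : Type) (projT1 z) (f _ (projT2 z)))).
Qed.
End GhomTheory.

Section Graphs.
Variables (gT hT : finGroupType) (G : {group gT}) (phi : {morphism G >-> hT}).

Lemma mem_graphr a b : ((a, b) \in graphr_group phi) = (a \in G) && (b == phi a).
Proof.
apply/imsetP/andP => [[c cG [-> ->]]|[aG /eqP ->]]; first by [].
by exists a.
Qed.

Lemma mem_graphl a b : ((b, a) \in graphl_group phi) = (a \in G) && (b == phi a).
Proof.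
apply/imsetP/andP => [[c cG [-> ->]]|[aG /eqP ->]]; first by [].
by exists a.
Qed.
End Graphs.

Section PlusFunctor.
Variables (GG : gclass) (S : sfam GG) (hS : axioms S) (R : comPzRingType).

Section OnObjects.
Variable F : green (Sminus S) R.

Lemma graphl_graphr (H K : obj GG) (phi : {morphism H >-> ogT K}) a b :
  ((b, a) \in graphl_group phi) = ((a, b) \in graphr_group phi).
Proof. by rewrite mem_graphl mem_graphr. Qed.

Definition plus_green : green_on (Splus S) (plus_mod F) :=
  @GreenOn GG (Splus S) R (plus_mod F) (plus_bfun hS F) (plus_alg hS F)
    (fun H K phi _ PD => plus_res1 hS F PD (mem_graphr phi))
    (fun H K phi _ PD x y => plus_resM hS PD (mem_graphr phi) x y)
    (fun H K phi _ PD PE a b =>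
       plus_frobl hS PD (mem_graphr phi) PE (graphl_graphr phi) a b)
    (fun H K phi _ PD PE a b =>
       plus_frobr hS PD (mem_graphr phi) PE (graphl_graphr phi) a b).

Lemma plus_green_morE : plus_morE plus_green.
Proof. by move=> G H U hU X s; apply: plus_bfun_morE. Qed.

Lemma plus_green_mulE : plus_mulE plus_green.
Proof.
move=> G X Y s t; exists (gprod_in hS (X := X) (Y := Y)), (prod_sec hS s t).
split=> [x y Gxy|]; first exact: prod_secE.
exact: plus_mul_sym.
Qed.
End OnObjects.

Section OnMorphisms.
Variables (F F' : green (Sminus S) R) (psi : ghom F F').

Section OneGroup.
Variable G : obj GG.

Lemma map_is_section (X : gset_in G) (s : gsec F X) :
  is_section (fun x => psi (stabo x) (s x)).
Proof.
move=> g x gG; rewrite secP // gapp_nat //.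
exact/in_hom_gen/Sminus_stab_conj.
Qed.

Definition map_sec (X : gset_in G) (s : gsec F X) : gsec F' X :=
  Gsec (map_is_section s).

Definition map_gen (P : gpair F G) : plus_car F' G := psym (map_sec (gp_sec P)).

Lemma map_gen_union : union_additive map_gen.
Proof.
move=> W X Y w s t p q U ws wt.
apply: (@psym_union _ _ hS _ F' G W X Y (map_sec w) (map_sec s) (map_sec t) p q U).
  by move=> x; apply: sv_gapp.
by move=> y; apply: sv_gapp.
Qed.

Lemma map_gen_add : section_additive map_gen.
Proof.
move=> X s u; rewrite -(psym_add (map_sec s)); congr psym; apply: gsecP => x.
exact: gappD.
Qed.

Definition plus_map (x : plus_car F G) : plus_car F' G :=
  plift map_gen (union_additive_respects map_gen_union map_gen_add) x.

Lemma plus_map_sym (X : gset_in G) (s : gsec F X) :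
  plus_map (psym s) = psym (map_sec s).
Proof. exact: plift_gen. Qed.

Lemma plus_mapD x y : plus_map (x + y) = plus_map x + plus_map y.
Proof. exact: pliftD. Qed.

Lemma plus_mapN x : plus_map (- x) = - plus_map x.
Proof. exact: pliftN. Qed.

Lemma plus_map0 : plus_map 0 = 0.
Proof. exact: plift0. Qed.

Lemma plus_mapZ r x : plus_map (r *: x) = r *: plus_map x.
Proof.
elim/plus_car_gen: x => [|X s|x y ex ey|x ex].
- by rewrite scaler0 plus_map0 scaler0.
- rewrite scale_psym !plus_map_sym scale_psym; congr psym; apply: gsecP => x.
  exact: gappZ.
- by rewrite scalerDr !plus_mapD ex ey scalerDr.
- by rewrite scalerN !plus_mapN ex scalerN.
Qed.

Lemma plus_map_linear : linear plus_map.
Proof. by move=> r x y; rewrite plus_mapD plus_mapZ. Qed.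

Lemma plus_map1 : plus_map (plus_one hS F G) = plus_one hS F' G.
Proof.
rewrite /plus_one plus_map_sym; congr psym; apply: gsecP => x.
by rewrite point_sec1 -(gapp1 psi); congr (gapp psi _ _); apply: point_sec1.
Qed.

Lemma plus_mapM x y :
  plus_map (plus_mul hS x y) = plus_mul hS (plus_map x) (plus_map y).
Proof.
elim/plus_car_gen: x => [|X s|x x' e e'|x e].
- by rewrite plus_mul0l !plus_map0 plus_mul0l.
- elim/plus_car_gen: y => [|Y t|y y' e e'|y e].
  + by rewrite plus_mul0r !plus_map0 plus_mul0r.
  + rewrite plus_mul_sym !plus_map_sym plus_mul_sym; congr psym; apply: gsecP => z.
    have sl := Sminus_stab_Delta hS (stab_gfst z).
    have sr := Sminus_stab_Delta hS (stab_gsnd z).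
    apply: etrans (gappM psi _ _) _; congr (gmul F' _ _); apply: gapp_nat.
      exact: in_hom_gen.
    exact: in_hom_gen.
  + by rewrite plus_mulDr !plus_mapD e e' plus_mulDr.
  + by rewrite plus_mulNr !plus_mapN e plus_mulNr.
- by rewrite plus_mulDl !plus_mapD e e' plus_mulDl.
- by rewrite plus_mulNl !plus_mapN e plus_mulNl.
Qed.
End OneGroup.

Lemma plus_map_nat (G H : obj GG) (a : bgrp G H) (x : plus_car F H) :
  in_hom (Splus S) a -> plus_map (plus_mor hS a x) = plus_mor hS a (plus_map x).
Proof.
elim=> [|b c _ eb _ ec|D PD].
- by rewrite !plus_mor0 plus_map0.
- by rewrite !plus_morD !plus_morN plus_mapD plus_mapN eb ec.
elim/plus_car_gen: x => [|X s|x y ex ey|x ex].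
- by rewrite plus_map0 !raddf0 plus_map0.
- have hD := splus_gcosets hS PD.
  rewrite /btrans !(plus_mor_bcls hS hD, plus_map_sym); congr psym.
  apply: gsecP => w; apply: gapp_nat; apply: in_hom_gen.
  by apply: (@Sminus_stab_cut _ _ hS _ _ _ hD X w); rewrite tens_uxK.
- by rewrite !(raddfD, plus_mapD) /= ex ey.
- by rewrite !(raddfN, plus_mapN) /= ex.
Qed.

Definition plus_ghom : ghom (Green (plus_green F)) (Green (plus_green F')) :=
  @Ghom GG (Splus S) R (Green (plus_green F)) (Green (plus_green F'))
    (fun G x => plus_map x) plus_map_linear plus_map1 plus_mapM plus_map_nat.

Lemma plus_ghomE : plus_mapE psi plus_ghom.
Proof. by move=> G X s; exists (map_sec s); split=> //; exact: plus_map_sym. Qed.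
End OnMorphisms.

Definition plus_functor_exists : plus_functor S R :=
  PlusFunctor plus_green_morE plus_green_mulE plus_ghomE.

End PlusFunctor.

(** * Uniqueness of the structure and the unit *)

Section Agreement.
Variables (GG : gclass) (S : sfam GG) (hS : axioms S) (R : comPzRingType).
Variables (P : plus_functor S R) (F : green (Sminus S) R).

(** The theorem concerns an arbitrary [P]. Its formula fixes the values on generators, up to the
    proof that the stabilizers lie in the class, which is irrelevant. *)
Lemma pf_mor_btrans (G H : obj GG) (D : {group ogT G * ogT H}) (x : plus_car F H) :
  Splus S G H D ->
  bmor (pf_green P F) (btrans G H D) x = plus_mor hS (btrans G H D) x.
Proof.
move=> PD; elim/plus_car_gen: x => [|X s|x y ex ey|x ex].
- by rewrite !raddf0.
- have hD := splus_gcosets hS PD.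
  rewrite /btrans (plus_mor_bcls hS hD).
  have [i [t [tE ->]]] := pf_morE P hD s.
  have ei : i = tens_in hS hD (X := X) by apply: Prop_irrelevance.
  subst i; congr psym; apply: gsecP => w.
  have [u [x <-]] := tensx_cl_surj w.
  by apply: etrans (tE u x) _; rewrite tens_secE.
- by rewrite !raddfD /= ex ey.
- by rewrite !raddfN /= ex.
Qed.

Lemma bmor0 (T : sfam GG) (A : obj GG -> lmodType R) (B : bfun_on T A)
    (G H : obj GG) x : bmor B (0 : bgrp G H) x = 0.
Proof.
have h : in_hom T (0 : bgrp G H) by exact: in_hom0.
by apply: (addrI (bmor B (0 : bgrp G H) x)); rewrite -bmorD // !addr0.
Qed.

Lemma bmorB (T : sfam GG) (A : obj GG -> lmodType R) (B : bfun_on T A)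
    (G H : obj GG) (a b : bgrp G H) x :
  in_hom T a -> in_hom T b -> bmor B (a - b) x = bmor B a x - bmor B b x.
Proof.
move=> ha hb; apply/eqP; rewrite eq_sym subr_eq -bmorD ?subrK //.
exact: in_homB.
Qed.

Lemma pf_mor (G H : obj GG) (a : bgrp G H) (x : plus_car F H) :
  in_hom (Splus S) a -> bmor (pf_green P F) a x = plus_mor hS a x.
Proof.
elim=> [|b c hb eb hc ec|D PD].
- by rewrite bmor0 plus_mor0.
- by rewrite bmorB // eb ec plus_morD plus_morN.
exact: pf_mor_btrans.
Qed.

Lemma pf_mul (G : obj GG) (x y : plus_car F G) :
  amul (green_alg (pf_green P F) G) x y = plus_mul hS x y.
Proof.
pose m := amul (green_alg (pf_green P F) G).
have mDl a b c : m (a + b) c = m a c + m b c by exact: amulDl.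
have mDr a b c : m a (b + c) = m a b + m a c by exact: amulDr.
have m0l c : m 0 c = 0 by apply: (addrI (m 0 c)); rewrite -mDl !addr0.
have m0r c : m c 0 = 0 by apply: (addrI (m c 0)); rewrite -mDr !addr0.
have mNl a c : m (- a) c = - m a c.
  by apply/eqP; rewrite -addr_eq0 -mDl addNr m0l.
have mNr a c : m a (- c) = - m a c.
  by apply/eqP; rewrite -addr_eq0 -mDr addNr m0r.
rewrite -/(m x y); elim/plus_car_gen: x => [|X s|x x' e e'|x e].
- by rewrite m0l plus_mul0l.
- elim/plus_car_gen: y => [|Y t|y y' e e'|y e].
  + by rewrite m0r plus_mul0r.
  + have [i [w [wE]]] := pf_mulE P s t; rewrite -/(m _ _) => ->.
    have ei : i = gprod_in hS (X := X) (Y := Y) by apply: Prop_irrelevance.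
    subst i; rewrite plus_mul_sym; congr psym; apply: gsecP => z.
    have [x [y <-]] := gpt_surj z.
    by apply: etrans (wE x y) _; rewrite prod_secE.
  + by rewrite mDr plus_mulDr e e'.
  + by rewrite mNr plus_mulNr e.
- by rewrite mDl plus_mulDl e e'.
- by rewrite mNl plus_mulNl e.
Qed.

(** The formulas do not prescribe the unit, but a two-sided unit of the common product is unique. *)
Lemma pf_one (G : obj GG) : aone (green_alg (pf_green P F) G) = plus_one hS F G.
Proof.
rewrite -[LHS](plus_mul1l hS) -[RHS](amul1r (green_alg (pf_green P F) G)).
by rewrite -pf_mul.
Qed.
End Agreement.

Section Unit.
Variables (GG : gclass) (S : sfam GG) (hS : axioms S) (R : comPzRingType).
Variables (F : green (Sminus S) R).

Definition unit_map (G : obj GG) (a : F G) : plus_car F G := psym (point_sec hS a).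

Lemma unit_mapD (G : obj GG) (a b : F G) : unit_map (a + b) = unit_map a + unit_map b.
Proof.
rewrite -(psym_add (point_sec hS a)); congr psym; apply: gsecP => z.
exact: (raddfD (gmor F _)).
Qed.

Lemma unit_mapZ (G : obj GG) r (a : F G) : unit_map (r *: a) = r *: unit_map a.
Proof.
rewrite scale_psym; congr psym; apply: gsecP => z.
exact: (linearZ_LR (gmor F _)).
Qed.

Lemma unit_map_linear (G : obj GG) : linear (@unit_map G).
Proof. by move=> r a b; rewrite unit_mapD unit_mapZ. Qed.

Lemma Sminus_point (G : obj GG) (z : point_set G) :
  Sminus S (stabo z) G (Delta_group G).
Proof.
have sz : stab z \subset G by apply: stab_sub.
have e : (Delta_group G : {set _}) = Delta (stab z) by rewrite stab_point.
exact: (Sminus_DeltaG hS (gset_inP z) sz e).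
Qed.

Lemma unit_mapM (G : obj GG) (a b : F G) :
  unit_map (gmul F a b) = plus_mul hS (unit_map a) (unit_map b).
Proof.
rewrite plus_mul_sym; apply: (psym_eq (X := point_set G)
  (Y := prod_set hS (point_set G) (point_set G))
  (p := fun _ : unit => gstar G) (q := fun=> gpt (gstar G) (gstar G))).
- by move=> z; exists tt; rewrite [z]gstarP.
- move=> z; have [x [y <-]] := gpt_surj z; exists tt.
  by rewrite [x]gstarP [y]gstarP.
- by [].
- by move=> c _ cG; exists tt; rewrite gptE // [_ ** gstar G]gstarP.
move=> _ e; rewrite prod_secE /prod_val.
have ps c : point_sec hS c (gstar G) =
    gmor F (btrans (stabo (gstar G : point_set G)) G (Delta_group G)) c by [].
rewrite {1}ps.
rewrite (@gmor_graphM _ _ _ F (stabo (gstar G : point_set G)) G _ id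
  (Sminus_point _)); last first.
  move=> c d; change (((c, d) \in Delta G) = (c \in stab (gstar G)) && (d == c)).
  by rewrite mem_Delta andbC eq_sym stab_point.
apply: sv_stab_gmul => //; apply/esym; rewrite -ps; apply: sv_stab_cast => //.
  by move=> c d; rewrite [LHS]mem_Delta e.
by move=> c d; rewrite [LHS]mem_Delta e.
Qed.

Lemma sv_gmor_whole (G H : obj GG) (K L : {group ogT G}) pK pL
    (D E : {group ogT G * ogT H}) (a : F H) :
  K = L -> (forall c d, ((c, d) \in D) = ((c, d) \in E)) ->
  same_value (gmor F (btrans (@Obj GG _ K pK) H D) a)
             (gmor F (btrans (@Obj GG _ L pL) H E) a).
Proof.
move=> e eD; subst L; rewrite (Prop_irrelevance pL pK).
by have -> : D = E by apply/val_inj/setP=> -[c d].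
Qed.

(** Since p_1(D) = G, the tensor product of (G x H)/D with a point is again a point. For D in S_+ it
    would be G/p_1(D); this is where S_- matters. *)
Lemma unit_map_nat_btrans (G H : obj GG) (D : {group ogT G * ogT H}) (a : F H) :
  Sminus S G H D ->
  unit_map (gmor F (btrans G H D) a) = plus_mor hS (btrans G H D) (unit_map a).
Proof.
move=> SD; have sD := smem_sub SD; have hD := splus_gcosets hS (Sminus_plus SD).
rewrite {2}/btrans (plus_mor_bcls hS hD).
pose o := gbase (setX_group G H) D.
apply: (psym_eq (X := point_set G) (Y := tens_set hS hD (point_set H))
  (p := fun _ : unit => gstar G) (q := fun=> tensx_cl o (gstar H))).
- by move=> z; exists tt; rewrite [z]gstarP.
- move=> w; have [u [x <-]] := tensx_cl_surj w; exists tt.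
  have [[g h] /setXP[gG hH] ->] := gbase_trans u; rewrite [x]gstarP.
  (* The pair (g,h') fixes the base point o, so (g,h) o = (1, h h'^-1) o. *)
  have [h' ghD] := Sminus_mem1 SD gG.
  have /setXP[_ h'H] := subsetP sD _ ghD.
  have hhH : (h * h'^-1)%g \in (H : {group _}) by rewrite groupM ?groupV.
  apply/tensx_clP; exists (h * h'^-1)%g => //; split; last by rewrite [RHS]gstarP.
  have : (g, h') \in stab o by rewrite mem_stab_gbase.
  rewrite in_stab => /andP[_ /eqP e].
  rewrite -/o -{2}e -lmulM ?in_setX ?group1 ?gG ?h'H ?hhH //.
  by congr lmul; congr (_, _); rewrite ?mul1g ?mulgKV.
- by [].
- move=> c _ cG; exists tt; split; first by rewrite [RHS]gstarP.
  have [d cdD] := Sminus_mem1 SD cG; have /setXP[_ dH] := subsetP sD _ cdD.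
  rewrite tensx_cl_lmul // -[in RHS](tensx_clE _ (gstar H) dH) -lmul_pair //.
  rewrite [_ ** gstar H]gstarP.
  have : (c, d) \in stab o by rewrite mem_stab_gbase.
  by rewrite in_stab => /andP[_ /eqP ->].
move=> _ e; rewrite tens_secE /tens_val.
have ps (K : obj GG) (c : F K) : point_sec hS c (gstar K) =
    gmor F (btrans (stabo (gstar K : point_set K)) K (Delta_group K)) c by [].
rewrite !ps.
have dG c d : (c, d) \in D -> c \in (G : {group _}) /\ d \in (H : {group _}).
  by move=> cd; split; have /setXP[] := subsetP sD _ cd.
rewrite (@gmor_star _ _ _ F (stabo (gstar G : point_set G)) G H _ _ D);
  [|exact: Sminus_point|exact: SD| |]; last 2 first.
- by move=> b bG; apply: (Sminus_mem1 SD bG).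
- move=> b c; split=> [bc|[b']].
    by exists b => //; rewrite mem_Delta eqxx; have [] := dG _ _ bc.
  by rewrite mem_Delta => /andP[/eqP <- _].
have Sw := @Sminus_stab_cut _ _ hS _ _ _ hD (point_set H) (tensx_cl o (gstar H))
  o (gstar H) erefl.
rewrite (@gmor_star _ _ _ F (stabo (X := tens_set hS hD (point_set H)) (tensx_cl o (gstar H)))
  (stabo (gstar H : point_set H)) H _ _ D);
  [|exact: Sw|exact: Sminus_point| |].
- exact: sv_gmor_whole.
- move=> b bH; have bH' : b \in stab (gstar H) by exact: bH.
  by rewrite stab_point in bH'; exists b; rewrite mem_Delta eqxx.
have cutE b c : ((b, c) \in stab_cut o (gstar H)) = ((b, c) \in D).
  rewrite mem_stab_cut mem_stab_gbase // stab_point; apply/andP/idP => [[]//|bc].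
  by split=> //; have [] := dG _ _ bc.
move=> b c; split=> [bc|[b' h]].
  exists c; last by rewrite mem_Delta eqxx; have [] := dG _ _ bc.
  have h : (b, c) \in stab_cut o (gstar H) by rewrite cutE.
  exact: h.
have {h}h : (b, b') \in stab_cut o (gstar H) := h.
by rewrite cutE in h; rewrite mem_Delta => /andP[/eqP <- _].
Qed.

Lemma unit_map_nat (G H : obj GG) (a : bgrp G H) (x : F H) :
  in_hom (Sminus S) a -> unit_map (gmor F a x) = plus_mor hS a (unit_map x).
Proof.
have u0 K : unit_map (0 : F K) = 0.
  by apply: (addrI (unit_map (0 : F K))); rewrite -unit_mapD !addr0.
have uB K (b c : F K) : unit_map (b - c) = unit_map b - unit_map c.
  by apply/eqP; rewrite eq_sym subr_eq -unit_mapD subrK.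
elim=> [|b c hb eb hc ec|D SD].
- by rewrite /gmor bmor0 u0 plus_mor0.
- by rewrite /gmor bmorB // uB eb ec plus_morD plus_morN.
exact: unit_map_nat_btrans.
Qed.
End Unit.

(** * Generation by induced elements *)

Section Generation.
Variables (GG : gclass) (S : sfam GG) (hS : axioms S) (R : comPzRingType).
Variables (F : green (Sminus S) R) (G : obj GG).

Section Induction.
Variables (K : {group ogT G}) (pK : gmem GG K) (sK : K \subset G).
Let A : obj GG := Obj pK.

Definition ind_splus : splus_set S (gcosets (setX_group G A) (Delta_group K)) :=
  splus_gcosets hS (Splus_Delta hS pK sK).

Definition ind_base (X : gset A) (x : X) :
    tensx (gcosets (setX_group G A) (Delta_group K)) X :=
  tensx_cl (gbase (setX_group G A) (Delta_group K)) x.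

Lemma ind_sub : Delta_group K \subset setX G A.
Proof. exact: (smem_sub (Splus_Delta hS pK sK)). Qed.

Lemma ind_mem a b : ((b, a) \in Delta_group K) = (a \in K) && (b == id a).
Proof. by rewrite mem_Delta; case: eqP => [->|]; rewrite ?andbT ?andbF. Qed.

Lemma stab_ind_base : stab (ind_base (gstar A)) = K.
Proof.
apply/val_inj/setP=> b; rewrite stab_tensx.
apply/mem_starl/idP => [[k kp]|bK].
  by rewrite (mem_stab_gbase _ _ ind_sub) mem_Delta => /andP[].
exists b; last by rewrite (mem_stab_gbase _ _ ind_sub) mem_Delta eqxx.
by rewrite stab_point.
Qed.

Lemma ind_base_trans : gtrans (ind_base (gstar A)).
Proof.
move=> w; have [k kG [x ->]] := base_surj w; exists k => //.
by rewrite [x]gstarP.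
Qed.

Variable a : F A.

Lemma ind_base_val :
  same_value (tens_sec hS ind_splus (point_sec hS a) (ind_base (gstar A))) a.
Proof.
rewrite /ind_base tens_secE /tens_val.
have Sw := @Sminus_stab_cut _ _ hS _ _ _ ind_splus (point_set A)
  (ind_base (gstar A)) (gbase (setX_group G A) (Delta_group K)) (gstar A) erefl.
have cE b c : ((b, c) \in stab_cut (gbase (setX_group G A) (Delta_group K)) (gstar A)) =
    ((b, c) \in Delta K).
  rewrite mem_stab_cut (mem_stab_gbase _ _ ind_sub) stab_point mem_Delta.
  by case: eqP => [->|] //; rewrite andTb; apply: andbb.
rewrite (gmor_Sminus _ Sw (Sminus_point hS (gstar A : point_set A)) (D' := Delta_group K)).
  apply: sv_cast => [|b c]; first exact: (esym stab_ind_base).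
  by rewrite mem_Delta.
move=> b c; split=> [bc|[b' h]].
  have cK : c \in K by move: bc; rewrite ind_mem => /andP[].
  have h : (b, c) \in stab_cut (gbase (setX_group G A) (Delta_group K)) (gstar A).
    by rewrite cE.
  by exists c; [exact: h|rewrite mem_Delta eqxx].
have {}h : (b, b') \in stab_cut (gbase (setX_group G A) (Delta_group K)) (gstar A) := h.
by rewrite cE in h; rewrite mem_Delta => /andP[/eqP <- _].
Qed.
End Induction.

(** Inducing the one-point set of the stabilizer of x0 gives a transitive G-set with that
    stabilizer, which is X up to isomorphism; by equivariance the section is determined by its value
    at x0. *)
Lemma psym_trans (X : gset_in G) (s : gsec F X) (x0 : X) : gtrans x0 ->
  psym s = plus_mor hS (btrans G (stabo x0) (Delta_group (stab x0)))
             (unit_map hS (s x0)).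
Proof.
move=> tx; have sK := stab_sub x0.
have hD := @ind_splus (stab x0) (gset_inP x0) sK.
rewrite /btrans (plus_mor_bcls hS hD).
apply: (psym_eq_orbit (Y := tens_set hS hD (point_set (stabo x0)))
  (p := fun _ : unit => x0)
  (q := fun _ : unit => ind_base (K := stab x0) (gstar (stabo x0)))).
- by move=> x; have [a aG ->] := tx x; exists a => //; exists tt.
- move=> w; have [a aG ->] := ind_base_trans (pK := gset_inP x0) w.
  by exists a => //; exists tt.
- move=> a _ _ aG.
  (* With a single representative, the matching condition says that the two base points have the
     same stabilizer. *)
  have e (Y : gset G) (y : Y) : a ** y = y <-> a \in stab y.
    by rewrite in_stab aG; split=> /eqP.
  by rewrite !e (@stab_ind_base (stab x0) (gset_inP x0) sK).
move=> _ _; apply/esym.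
have -> : hD = @ind_splus (stab x0) (gset_inP x0) sK by apply: Prop_irrelevance.
exact: ind_base_val.
Qed.

Lemma plus_ind_gen (Q : plus_car F G -> Prop) :
  Q 0 -> (forall x y, Q x -> Q y -> Q (x + y)) -> (forall x, Q x -> Q (- x)) ->
  (forall (K : {group ogT G}) (pK : gmem GG K) (a : F (Obj pK)), K \subset G ->
     Q (plus_mor hS (btrans G (Obj pK) (Delta_group K)) (unit_map hS a))) ->
  forall x, Q x.
Proof.
move=> Q0 QD QN Qi; apply: (plus_car_ind hS Q0 QD QN) => X s x0 tx.
by rewrite (psym_trans s tx); apply: Qi; apply: stab_sub.
Qed.
End Generation.

(** * Sums over orbits *)

Section OrbitSum.
Variables (gT : finGroupType) (G : {group gT}) (A : zmodType).

Definition gorb (X : gset G) (x : X) : {set X} := [set a ** x | a in G].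

Definition gorbs (X : gset G) : {set {set X}} := [set gorb x | x : X].

(** The default 0 concerns only the empty set, which is no orbit; for an invariant v the choice of x
    is immaterial. *)
Definition orbit_val (X : gset G) (v : X -> A) (O : {set X}) : A :=
  if [pick x in O] is Some x then v x else 0.

Definition orbit_sum (X : gset G) (v : X -> A) : A :=
  \sum_(O in gorbs X) orbit_val v O.

Definition ginvariant (X : gset G) (v : X -> A) :=
  forall a x, a \in G -> v (a ** x) = v x.

Lemma gorb_self (X : gset G) (x : X) : x \in gorb x.
Proof. by apply/imsetP; exists 1%g; rewrite ?lmul1. Qed.

Lemma orbit_val_gorb (X : gset G) (v : X -> A) x : ginvariant v ->
  orbit_val v (gorb x) = v x.
Proof.
move=> vi; rewrite /orbit_val; case: pickP => [y /imsetP[a aG ->]|/(_ x)].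
  exact: vi.
by rewrite gorb_self.
Qed.

Lemma gorb_emb (X Y : gset G) (p : X -> Y) x : gemb p ->
  gorb (p x) = p @: gorb x.
Proof.
move=> [_ pe]; apply/setP=> y; apply/imsetP/imsetP => [[a aG ->]|[_ /imsetP[a aG ->] ->]].
  by exists (a ** x); rewrite ?pe //; apply/imsetP; exists a.
by exists a; rewrite ?pe.
Qed.

Lemma orbit_sum_union (W X Y : gset G) (p : X -> W) (q : Y -> W) (v : W -> A)
    (vX : X -> A) (vY : Y -> A) :
  is_union p q -> ginvariant v -> ginvariant vX -> ginvariant vY ->
  (forall x, v (p x) = vX x) -> (forall y, v (q y) = vY y) ->
  orbit_sum v = orbit_sum vX + orbit_sum vY.
Proof.
move=> [pe qe dis cov] vi vXi vYi eX eY.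
have gorbsE : gorbs W = [set p @: (O : {set X}) | O in gorbs X] :|:
                        [set q @: (O : {set Y}) | O in gorbs Y].
  apply/setP=> O; rewrite inE; apply/imsetP/orP => [[w _ ->]|].
    case: (cov w) => -[x <-]; [left|right]; apply/imsetP; exists (gorb x);
      rewrite ?gorb_emb //; exact: imset_f.
  case=> /imsetP[_ /imsetP[x _ ->] ->].
    by exists (p x); rewrite ?gorb_emb.
  by exists (q x); rewrite ?gorb_emb.
rewrite /orbit_sum gorbsE; set gX := imset _ _; set gY := imset _ _.
have dXY : [disjoint gX & gY].
  rewrite -setI_eq0; apply/eqP/setP=> O; rewrite !inE; apply/negP.
  move=> /andP[/imsetP[_ /imsetP[x _ ->] ->] /imsetP[_ /imsetP[y _ ->]]].
  rewrite -!gorb_emb // => e; have := gorb_self (p x).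
  by rewrite e gorb_emb // => /imsetP[z _ /dis].
rewrite (eq_bigl [in [predU gX & gY]]) => [|O]; last by rewrite !inE.
rewrite bigU // {dXY}/gX /gY /=.
have key (Z : gset G) (f : Z -> W) (u : Z -> A) : gemb f -> ginvariant u ->
    (forall z, v (f z) = u z) ->
  \sum_(O in [set f @: (O : {set Z}) | O in gorbs Z]) orbit_val v O =
  \sum_(O in gorbs Z) orbit_val u O.
  move=> fe ui fu; rewrite big_imset /=; last first.
    by move=> ? ? _ _; apply: imset_inj; apply: fe.1.
  apply: eq_bigr => _ /imsetP[z _ ->].
  by rewrite -gorb_emb // !orbit_val_gorb.
by rewrite !(key _ _ _ _ _ eX, key _ _ _ _ _ eY).
Qed.

Lemma orbit_sumD (X : gset G) (u v : X -> A) :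
  orbit_sum (fun x => u x + v x) = orbit_sum u + orbit_sum v.
Proof.
rewrite /orbit_sum -big_split /=; apply: eq_bigr => O _.
by rewrite /orbit_val; case: pickP => // _; rewrite addr0.
Qed.

Lemma orbit_sum_trans (X : gset G) (v : X -> A) (x0 : X) : ginvariant v ->
  gtrans x0 -> orbit_sum v = v x0.
Proof.
move=> vi tx; rewrite /orbit_sum.
have -> : gorbs X = [set gorb x0].
  apply/setP=> O; rewrite inE; apply/imsetP/eqP => [[x _ ->]|->]; last by exists x0.
  have sur (y : X) : gorb y = setT.
    apply/setP=> z; rewrite inE; apply/imsetP.
    have [a aG ->] := tx z; have [b bG ->] := tx y.
    by exists (a * b^-1)%g; rewrite ?groupM ?groupV // lmulM ?groupV // lmulVK.
  by rewrite !sur.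
by rewrite big_set1 orbit_val_gorb.
Qed.
End OrbitSum.

(** * The adjunction *)

Section GmulTheory.
Variables (GG : gclass) (T : sfam GG) (R : comPzRingType) (F : green T R).
Variable G : obj GG.
Implicit Types a b c : F G.

Lemma gmulDl a b c : gmul F (a + b) c = gmul F a c + gmul F b c.
Proof. exact: amulDl. Qed.

Lemma gmulDr a b c : gmul F a (b + c) = gmul F a b + gmul F a c.
Proof. exact: amulDr. Qed.

Lemma gmul0l a : gmul F 0 a = 0.
Proof. by apply: (addrI (gmul F 0 a)); rewrite -gmulDl !addr0. Qed.

Lemma gmul0r a : gmul F a 0 = 0.
Proof. by apply: (addrI (gmul F a 0)); rewrite -gmulDr !addr0. Qed.

Lemma gmulNl a b : gmul F (- a) b = - gmul F a b.
Proof. by apply/eqP; rewrite -addr_eq0 -gmulDl addNr gmul0l. Qed.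

Lemma gmulNr a b : gmul F a (- b) = - gmul F a b.
Proof. by apply/eqP; rewrite -addr_eq0 -gmulDr addNr gmul0r. Qed.
End GmulTheory.

(** * Extension of a morphism from F to F_+ *)

Section Extension.
Variables (GG : gclass) (S : sfam GG) (hS : axioms S) (R : comPzRingType).
Variables (F : green (Sminus S) R) (M : green (Splus S) R).
Variable psi : ghom F (res_green M).

Lemma psi_nat (G H : obj GG) (a : bgrp G H) x : in_hom (Sminus S) a ->
  psi G (gmor F a x) = gmor M a (psi H x).
Proof. exact: gapp_nat. Qed.

Lemma psiM (G : obj GG) (x y : F G) : psi G (gmul F x y) = gmul M (psi G x) (psi G y).
Proof. exact: gappM. Qed.

Section OneGroup.
Variable G : obj GG.

Definition ind_val (K : {group ogT G}) (pK : gmem GG K) (a : F (Obj pK)) : M G :=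
  gmor M (btrans G (Obj pK) (Delta_group K)) (psi (Obj pK) a).

Definition ext_val (P : gpair F G) (x : P) : M G :=
  ind_val (pK := gset_inP x) (gp_sec P x).

(** Conjugation by g followed by induction from the stabilizer of gx is the class of the conjugation
    graph in G x G_x. This graph is conjugate by (g^-1,1) to Delta(G_x), which gives the induction
    from G_x. *)
Lemma ext_val_invariant (P : gpair F G) : ginvariant (@ext_val P).
Proof.
move=> g x gG; rewrite /ext_val /ind_val secP //.
have Sc := Sminus_stab_conj hS x gG.
have gVG : (g^-1)%g \in (G : {group _}) by rewrite groupV.
rewrite (psi_nat _ (in_hom_gen Sc)).
have PD := Splus_Delta hS (gset_inP (g ** x)) (stab_sub (g ** x)).
have PD' := Splus_Delta hS (gset_inP x) (stab_sub x).
rewrite (@gmor_star _ _ _ M G (stabo (g ** x)) (stabo x) _ _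
  (conjgraph_group g (stab x)) _ PD (Sminus_plus Sc)).
- have e : conjgraph_group g (stab x) = (Delta_group (stab x) :^ (g^-1%g, 1%g))%G.
    exact/val_inj/esym/Delta_conj.
  rewrite e; congr (gmor M _ _); apply: btrans_conj; first exact: (smem_sub PD').
  by rewrite in_setX gVG group1.
- by move=> b bx; apply: (Sminus_mem1 Sc bx).
move=> b c; rewrite mem_conjgraph; split=> [/andP[cx /eqP ->]|[b']].
  exists (c ^ g^-1)%g; last by rewrite mem_conjgraph cx eqxx.
  have h : (c ^ g^-1)%g \in stab (g ** x) by rewrite stab_lmul // memJ_conjg.
  by rewrite mem_Delta eqxx; apply: h.
rewrite mem_Delta => /andP[/eqP <- _] h.
have {}h : (b, c) \in conjgraph_group g (stab x) := h.
by rewrite mem_conjgraph in h.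
Qed.

Definition ext_gen (P : gpair F G) : M G := orbit_sum (@ext_val P).

Lemma sv_ind_val (K L : {group ogT G}) pK pL (a : F (@Obj GG _ K pK))
    (b : F (@Obj GG _ L pL)) : K = L -> same_value a b -> ind_val a = ind_val b.
Proof.
move=> e ab.
exact: (sv_elim (Q := fun L pL b => ind_val a = @ind_val L pL b) e ab).
Qed.

Lemma ext_gen_union : union_additive ext_gen.
Proof.
move=> W X Y w s t p q U ws wt; have [pe qe _ _] := U.
apply: (orbit_sum_union U (@ext_val_invariant (Gpair w))
  (@ext_val_invariant (Gpair s)) (@ext_val_invariant (Gpair t))).
  by move=> x; exact: (sv_ind_val (stab_emb x pe) (ws x)).
by move=> y; exact: (sv_ind_val (stab_emb y qe) (wt y)).
Qed.

Lemma ext_gen_add : section_additive ext_gen.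
Proof.
move=> X s u; rewrite /ext_gen -orbit_sumD; congr orbit_sum.
apply: functional_extensionality_dep => x.
by rewrite /ext_val /ind_val /= gappD; apply: (raddfD (gmor M _)).
Qed.

Definition ext_map (x : plus_car F G) : M G :=
  plift ext_gen (union_additive_respects ext_gen_union ext_gen_add) x.

Lemma ext_mapD x y : ext_map (x + y) = ext_map x + ext_map y.
Proof. exact: pliftD. Qed.

Lemma ext_mapN x : ext_map (- x) = - ext_map x.
Proof. exact: pliftN. Qed.

Lemma ext_map0 : ext_map 0 = 0.
Proof. exact: plift0. Qed.

Lemma ext_map_trans (X : gset_in G) (s : gsec F X) (x0 : X) : gtrans x0 ->
  ext_map (psym s) = ind_val (pK := gset_inP x0) (s x0).
Proof.
move=> tx; rewrite /ext_map /psym plift_gen /ext_gen.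
by rewrite (orbit_sum_trans (@ext_val_invariant (Gpair s)) tx).
Qed.

Lemma ext_map_ind (K : {group ogT G}) (pK : gmem GG K) (a : F (Obj pK)) :
  K \subset G ->
  ext_map (plus_mor hS (btrans G (Obj pK) (Delta_group K)) (unit_map hS a)) =
  gmor M (btrans G (Obj pK) (Delta_group K)) (psi (Obj pK) a).
Proof.
move=> sK; have hD := @ind_splus _ _ hS G K pK sK.
rewrite {1}/btrans /unit_map (plus_mor_bcls hS hD).
rewrite (ext_map_trans (X := tens_set hS hD (point_set (Obj pK))) _
  (ind_base_trans (pK := pK))).
apply: sv_ind_val; first exact: (@stab_ind_base _ _ hS G K pK sK).
have -> : hD = @ind_splus _ _ hS G K pK sK by apply: Prop_irrelevance.
exact: ind_base_val.
Qed.

Lemma ext_mapZ r (x : plus_car F G) : ext_map (r *: x) = r *: ext_map x.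
Proof.
elim/(@plus_ind_gen _ _ hS): x => [|x y ex ey|x ex|K pK a sK].
- by rewrite scaler0 ext_map0 scaler0.
- by rewrite scalerDr !ext_mapD ex ey scalerDr.
- by rewrite scalerN !ext_mapN ex scalerN.
rewrite -[r *: _](linearZ_LR (plus_mor hS _)) -unit_mapZ !ext_map_ind //.
by rewrite gappZ; apply: (linearZ_LR (gmor M _)).
Qed.

Lemma ext_map_linear : linear ext_map.
Proof. by move=> r x y; rewrite ext_mapD ext_mapZ. Qed.
End OneGroup.

Lemma ext_map_btrans (G K : obj GG) (D : {group ogT G * ogT K}) (a : F K) :
  Splus S G K D ->
  ext_map (plus_mor hS (btrans G K D) (unit_map hS a)) =
  gmor M (btrans G K D) (psi K a).
Proof.
move=> PD; have [sD [p SD]] := PD.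
have SmD : Sminus S (Obj p) K D by [].
have sp : p1 D \subset G.
  by apply/subsetP=> b /mem_p1[c /(subsetP sD)]; rewrite in_setX => /andP[].
have PI := Splus_Delta hS p sp.
have e : btrans G K D = bcomp (btrans G (Obj p) (Delta_group (p1 D))) (btrans (Obj p) K D).
  rewrite bcomp_btrans; first last.
  - by move=> h hp; apply: (Sminus_mem1 SmD hp).
  - exact: (smem_sub SmD).
  - exact: (smem_sub PI).
  congr btrans; apply/val_inj/setP=> -[b c]; apply/idP/mem_star => [bc|[d]].
    by exists b => //; rewrite mem_Delta eqxx; apply/mem_p1; exists c.
  by rewrite mem_Delta => /andP[/eqP <- _].
have hI : in_hom (Splus S) (btrans G (Obj p) (Delta_group (p1 D))) by apply: in_hom_gen.
have hD : in_hom (Splus S) (btrans (Obj p) K D).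
  exact/in_hom_gen/Sminus_plus.
(* The unit commutes with the factor from S_-, so only an induction remains, to which [ext_map_ind]
   applies. *)
rewrite e plus_mor_comp // -(unit_map_nat_btrans hS a SmD) ext_map_ind //.
by rewrite (psi_nat _ (in_hom_gen SmD)) /gmor bmor_comp.
Qed.

Lemma ext_map_unit_mor (G K : obj GG) (c : bgrp G K) (a : F K) :
  in_hom (Splus S) c ->
  ext_map (plus_mor hS c (unit_map hS a)) = gmor M c (psi K a).
Proof.
elim=> [|b d hb eb hd ed|D PD].
- by rewrite plus_mor0 ext_map0 /gmor bmor0.
- by rewrite plus_morD plus_morN ext_mapD ext_mapN eb ed /gmor bmorB.
exact: ext_map_btrans.
Qed.

Lemma in_hom_bid (G : obj GG) : in_hom (Splus S) (bid G).
Proof. by rewrite bid_Delta; apply/in_hom_gen/Sminus_plus/(Sminus_id hS). Qed.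

Lemma ext_map_unit (G : obj GG) (a : F G) : ext_map (unit_map hS a) = psi G a.
Proof.
rewrite -[X in ext_map X](plus_mor_id hS) ext_map_unit_mor; last exact: in_hom_bid.
exact: bmor_id.
Qed.

(** On a generator, a composed with the induction is again a morphism of D_+ applied to an element
    of the image of the unit, so [ext_map_unit_mor] evaluates both sides. *)
Lemma ext_map_nat (G H : obj GG) (a : bgrp G H) (x : plus_car F H) :
  in_hom (Splus S) a -> ext_map (plus_mor hS a x) = gmor M a (ext_map x).
Proof.
move=> ha; elim/(@plus_ind_gen _ _ hS): x => [|x y ex ey|x ex|K pK b sK].
- by rewrite !raddf0 !ext_map0 raddf0.
- by rewrite raddfD /= !ext_mapD ex ey raddfD.
- by rewrite raddfN /= !ext_mapN ex raddfN.
have hI := in_hom_gen (Splus_Delta hS pK sK).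
rewrite -plus_mor_comp // !ext_map_unit_mor //; last exact: in_hom_plus_comp.
by rewrite /gmor bmor_comp.
Qed.

Lemma ext_map1 (G : obj GG) : ext_map (plus_one hS F G) = gone M G.
Proof.
rewrite [plus_one _ _ _]/(unit_map hS (gone F G)) ext_map_unit.
exact: (gapp1 psi G).
Qed.

Section Multiplicative.
Variables (G : obj GG) (K : {group ogT G}) (pK : gmem GG K) (sK : K \subset G).

Lemma res_Sminus : Sminus S (Obj pK) G (Delta_group K).
Proof. exact: Sminus_DeltaG. Qed.

Lemma res_mem a b : ((a, b) \in Delta_group K) = (a \in K) && (b == id a).
Proof. by rewrite mem_Delta andbC eq_sym. Qed.

Lemma res_sym a b : ((b, a) \in Delta_group K) = ((a, b) \in Delta_group K).
Proof. by rewrite !mem_Delta eq_sym; case: eqP => [->|]. Qed.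
End Multiplicative.

(** Frobenius reciprocity in F_+ turns the product of [G,a] with an induced [K,b] into the induction
    of [K, res(a) b]; Frobenius reciprocity in M undoes this after psi has been applied. *)
Lemma ext_map_unitM (G : obj GG) (a : F G) (y : plus_car F G) :
  ext_map (plus_mul hS (unit_map hS a) y) = gmul M (psi G a) (ext_map y).
Proof.
elim/(@plus_ind_gen _ _ hS): y => [|x y ex ey|x ex|K pK b sK].
- by rewrite plus_mul0r ext_map0 gmul0r.
- by rewrite plus_mulDr !ext_mapD ex ey gmulDr.
- by rewrite plus_mulNr !ext_mapN ex gmulNr.
have Sr := res_Sminus pK sK; have PI := Splus_Delta hS pK sK.
rewrite (plus_frobr hS (Sminus_plus Sr) (res_mem K) PI (res_sym K)).
rewrite -(unit_map_nat_btrans hS a Sr) -unit_mapM ext_map_unit_mor; last exact: in_hom_gen.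
rewrite ext_map_unit_mor; last exact: in_hom_gen.
rewrite psiM (psi_nat _ (in_hom_gen Sr)).
by rewrite (gmor_frobr (Sminus_plus Sr) (res_mem K) PI (res_sym K)).
Qed.

(** Frobenius reciprocity in the first factor turns an induced [K,a] times y into the induction of
    [K,a] times res(y), where [ext_map_unitM] applies over K. *)
Lemma ext_mapM (G : obj GG) (x y : plus_car F G) :
  ext_map (plus_mul hS x y) = gmul M (ext_map x) (ext_map y).
Proof.
elim/(@plus_ind_gen _ _ hS): x => [|x x' ex ex'|x ex|K pK a sK].
- by rewrite plus_mul0l ext_map0 gmul0l.
- by rewrite plus_mulDl !ext_mapD ex ex' gmulDl.
- by rewrite plus_mulNl !ext_mapN ex gmulNl.
have Sr := res_Sminus pK sK; have PI := Splus_Delta hS pK sK.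
have PR := Sminus_plus Sr.
rewrite (plus_frobl hS PR (res_mem K) PI (res_sym K)).
rewrite ext_map_nat; last exact: in_hom_gen.
rewrite ext_map_unitM ext_map_nat; last exact: in_hom_gen.
rewrite ext_map_unit_mor; last exact: in_hom_gen.
by rewrite (gmor_frobl PR (res_mem K) PI (res_sym K)).
Qed.
End Extension.

(** * The unit morphism and the adjunction bijection *)

Section Adjunction.
Variables (GG : gclass) (S : sfam GG) (hS : axioms S) (R : comPzRingType).
Variable P : plus_functor S R.

Section UnitHom.
Variable F : green (Sminus S) R.

Lemma eta1 (G : obj GG) :
  unit_map hS (gone F G) = gone (Res S R (Plus P F)) G.
Proof. exact: (esym (pf_one hS P F G)). Qed.

Lemma etaM (G : obj GG) (a b : F G) :
  unit_map hS (gmul F a b) =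
  gmul (Res S R (Plus P F)) (unit_map hS a) (unit_map hS b).
Proof. by rewrite unit_mapM; apply/esym/(pf_mul hS P). Qed.

Lemma eta_nat (G H : obj GG) (a : bgrp G H) (x : F H) : in_hom (Sminus S) a ->
  unit_map hS (gmor F a x) = gmor (Res S R (Plus P F)) a (unit_map hS x).
Proof.
move=> ha; rewrite unit_map_nat //; apply/esym/(pf_mor hS P).
exact: in_hom_minus_plus.
Qed.

Definition eta : ghom F (Res S R (Plus P F)) :=
  @Ghom GG (Sminus S) R F (Res S R (Plus P F)) (fun G a => unit_map hS a)
    (@unit_map_linear _ _ hS _ F) eta1 etaM eta_nat.

Lemma eta_is_unit : is_unit (P := pf_green P F) eta.
Proof.
move=> G a; exists (@point_in _ G), (point_sec hS a); split=> // z.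
exact: point_secE.
Qed.
End UnitHom.

Section Bijection.
Variables (F : green (Sminus S) R) (M : green (Splus S) R).

Section ExtHom.
Variable psi : ghom F (res_green M).

Lemma ext_hom1 (G : obj GG) : ext_map hS psi (gone (Plus P F) G) = gone M G.
Proof. by rewrite -(ext_map1 hS psi); congr ext_map; apply: pf_one. Qed.

Lemma ext_homM (G : obj GG) (x y : plus_car F G) :
  ext_map hS psi (gmul (Plus P F) (G := G) x y) = gmul M (ext_map hS psi x) (ext_map hS psi y).
Proof. by rewrite -(ext_mapM hS psi); congr ext_map; apply: pf_mul. Qed.

Lemma ext_hom_nat (G H : obj GG) (a : bgrp G H) (x : plus_car F H) :
  in_hom (Splus S) a ->
  ext_map hS psi (gmor (Plus P F) a x) = gmor M a (ext_map hS psi x).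
Proof.
by move=> ha; rewrite -(ext_map_nat hS psi) //; congr ext_map; apply: pf_mor.
Qed.

Definition ext_hom : ghom (Plus P F) M :=
  @Ghom GG (Splus S) R (Plus P F) M (fun G x => ext_map hS psi x)
    (@ext_map_linear _ _ hS _ F M psi) ext_hom1 ext_homM ext_hom_nat.

Lemma ext_homK : ghom_comp (res_hom ext_hom) (eta F) = psi.
Proof. by apply: ghomP => G a; apply: ext_map_unit. Qed.
End ExtHom.

Lemma eta_generates (f g : ghom (Plus P F) M) :
  ghom_comp (res_hom f) (eta F) = ghom_comp (res_hom g) (eta F) -> f = g.
Proof.
move=> e; apply: ghomP => G x.
have fg (K : obj GG) (a : F K) : f K (unit_map hS a) = g K (unit_map hS a).
  exact: (congr1 (fun h : ghom F (res_green M) => h K a) e).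
elim/(@plus_ind_gen _ _ hS): x => [|x y ex ey|x ex|K pK a sK].
- by rewrite !gapp0.
- by rewrite !gappD ex ey.
- by rewrite !gappN ex.
have hI := in_hom_gen (Splus_Delta hS pK sK).
by rewrite -(pf_mor hS P) // !gapp_nat // fg.
Qed.
End Bijection.

Lemma eta_adjunction :
  is_adjunction (C := green_cat (Sminus S) R) (L := Plus P) (M := Res S R)
    (fun (F : green (Sminus S) R) (M : green (Splus S) R)
         (phi : ghom (Plus P F) M) => ghom_comp (res_hom phi) (eta F)).
Proof.
split=> [F M|F F' M f phi|F M M' g phi].
- exists (fun psi => ext_hom psi) => [phi|psi]; last exact: ext_homK.
  (* Injectivity of composition with the unit turns the right inverse [ext_homK] into a two-sided
     one. *)
  by apply: eta_generates; rewrite ext_homK.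
- apply: ghomP => G a /=; congr (gapp phi G _).
  (* On a one-point symbol the induced map is f at the transported value, and f commutes with this
     transport by naturality on D_-. *)
  have [s' [s'E ->]] := pf_mapE P f (point_sec hS a).
  congr psym; apply: gsecP => z; rewrite s'E; apply: gapp_nat.
  exact/in_hom_gen/Sminus_point.
by apply: ghomP.
Qed.
End Adjunction.

(** The first conjunct keeps the second from being vacuous; the second covers every functor given by
    the formulas, not only the one constructed above. *)
Theorem theorem8p4 (R : comPzRingType) (GG : gclass) (S : sfam GG)
    (hS : axioms S) :
  inhabited (plus_functor S R) /\
  forall P : plus_functor S R,
    exists eta : forall F : green (Sminus S) R,
        ghom F (Res S R (Plus P F)),
      (forall F, is_unit (eta F)) /\
      is_adjunction (C := green_cat (Sminus S) R)
        (L := Plus P) (M := Res S R)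
        (fun (F : green (Sminus S) R) (M : green (Splus S) R)
             (phi : ghom (Plus P F) M) =>
           ghom_comp (res_hom phi) (eta F)).
Proof.
split; first by constructor; exact: plus_functor_exists.
move=> P; exists (eta hS P); split; first exact: eta_is_unit.
exact: eta_adjunction.
Qed.
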